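(* Let $(L,Q)$ be a flat $L_\infty$-algebra with complete descending filtration and let $\pi\in\mathcal{F}^1L^1$ be a Maurer-Cartan element that is homotopy equivalent to $0$ via $\pi(t),\lambda(t)$ (so $\pi(0)=0$, $\pi(1)=\pi$). Let $F\colon(L,Q)\to(L',Q')$ be an $L_\infty$-morphism of flat $L_\infty$-algebras with complete descending filtrations. Let $\Phi_1\colon(L,Q)\to(L,Q^{\pi})$ be the $L_\infty$-isomorphism associated with $(\pi(t),\lambda(t))$, and let $\Phi_1'\colon(L',Q')\to(L',(Q')^{S})$, $S=F^1(\overline{\exp}(\pi))$, be the $L_\infty$-isomorphism associated with $\pi'(t)=F^1(\overline{\exp}(\pi(t)))$ and $\lambda'(t)=F^1(\lambda(t)\vee\exp(\pi(t)))$. Then the $L_\infty$-morphisms $F$ and $(\Phi_1')^{-1}\circ F^{\pi}\circ\Phi_1$ from $(L,Q)$ to $(L',Q')$ are homotopic.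
   Context: $\mathbb{K}$ is a field of characteristic zero; vector spaces are $\mathbb{Z}$-graded, $V[i]^k=V^{i+k}$, Koszul sign rule. $\mathrm{Sym}(V)$ is the graded symmetric coalgebra with product $\vee$ and shuffle coproduct $\Delta_{sh}$; $\overline{\mathrm{Sym}}(V)=\bigoplus_{n\ge1}\mathrm{Sym}^n(V)$ with reduced coproduct $\overline{\Delta_{sh}}$. A flat $L_\infty$-algebra $(L,Q)$ is a graded vector space with a degree $1$ coderivation $Q$ of $\mathrm{Sym}(L[1])$, $Q^2=0$, $Q(1)=0$; $Q^1=\mathrm{pr}_{L[1]}\circ Q$ and $Q_n=Q^1_n$ is its restriction to $\mathrm{Sym}^n(L[1])$. An $L_\infty$-morphism is a degree $0$ coalgebra morphism $F\colon\mathrm{Sym}(L[1])\to\mathrm{Sym}(L'[1])$ with $F(1)=1$, $FQ=Q'F$; $F^1=\mathrm{pr}_{L'[1]}\circ F$ determines it. Filtrations $\mathcal{F}^\bullet L$ are descending, exhaustive and complete, and codifferentials and morphisms are compatible with them. $\widehat{L[t]}$ is the completion of $L\otimes\mathbb{K}[t]$ with respect to $\mathcal{F}^kL\otimes\mathbb{K}[t]$. Put $\exp(\pi)=\sum_{n\ge0}\frac1{n!}\pi^{\vee n}$, $\overline{\exp}(\pi)=\sum_{n\ge1}\frac1{n!}\pi^{\vee n}$. A Maurer-Cartan element is $\pi\in\mathcal{F}^1L^1$ with $Q^1(\exp\pi)=0$. $\pi_0\sim\pi_1$ (homotopy equivalent via $\pi(t),\lambda(t)$) if there are $\pi(t)\in\mathcal{F}^1\widehat{L^1[t]}$,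 $\lambda(t)\in\mathcal{F}^1\widehat{L^0[t]}$ with $\frac{d}{dt}\pi(t)=Q^1(\lambda(t)\vee\exp\pi(t))$, $\pi(0)=\pi_0$, $\pi(1)=\pi_1$. Twisting: $Q^\pi(X)=\exp(-\pi)\vee Q(\exp(\pi)\vee X)$ and $F^\pi(X)=\exp(-S)\vee F(\exp(\pi)\vee X)$ with $S=F^1(\overline{\exp}(\pi))$; $F^\pi\colon(L,Q^\pi)\to(L',(Q')^S)$ is an $L_\infty$-morphism. Associated isomorphism: given $\pi(t),\lambda(t)$ encoding an equivalence $\pi_0\sim\pi_1$ in $(L,Q)$, the $\Phi_t$ are the coalgebra morphisms of $\mathrm{Sym}(L[1])$ whose Taylor coefficients are the unique solutions of $\frac{d}{dt}(\Phi_t)^1_i(a)=\sum_{k=1}^i(Q^{\pi(t)})^1_{k+1}(\lambda(t)\vee(\Phi_t)^k_i(a))$, $(\Phi_0)^1_i(a)=\mathrm{pr}_{L[1]}(a)$ for $a\in\mathrm{Sym}^i(L[1])$, where $(\Phi_t)^k_i=\mathrm{pr}_{\mathrm{Sym}^k}\circ\Phi_t|_{\mathrm{Sym}^i}$; $\Phi_1\colon(L,Q^{\pi_0})\to(L,Q^{\pi_1})$ is an $L_\infty$-isomorphism. Homotopic $L_\infty$-morphisms: the convolution $L_\infty$-algebra is $\mathcal{H}=\mathrm{Hom}(\overline{\mathrm{Sym}}(L[1]),L')$ (graded linear maps compatible with filtrations) with codifferential $\widehat Q$ given by $\widehat Q^1_1F=Q'^1_1\circ F-(-1)^{|F|}F\circ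 Q$ and $\widehat Q^1_n(F_1\vee\cdots\vee F_n)=Q'^1_n\circ(F_1\star\cdots\star F_n)$ for $n\geq 2$, where $|F|$ is the degree in $\mathcal{H}[1]$ and $F\star G=\vee\circ(F\otimes G)\circ\overline{\Delta_{sh}}$. It carries the complete descending filtration $\mathfrak{F}^k\mathcal{H}=\sum_{n+m=k}\{f\mid f|_{\mathrm{Sym}^{<n}(L[1])}=0,\ f\colon\mathcal{F}^\bullet\to\mathcal{F}^{\bullet+m}\}$, with the product filtration on $\overline{\mathrm{Sym}}(L[1])$. Its Maurer-Cartan elements correspond to $L_\infty$-morphisms via $F\leftrightarrow F^1$. Two $L_\infty$-morphisms are homotopic if the corresponding Maurer-Cartan elements of $\mathcal{H}$ are homotopy equivalent. *)

(* Defs.v *)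
From HB Require Import structures.
From mathcomp Require Import all_boot all_order all_algebra.
From mathcomp Require Import finmap.
From mathcomp Require Import boolp classical_sets functions.
From mathcomp.multinomials Require Import monalg.

Set Implicit Arguments.
Unset Strict Implicit.
Unset Printing Implicit Defensive.

Import GRing.Theory.
Local Open Scope ring_scope.
Local Open Scope classical_set_scope.
Local Open Scope quotient_scope.

(** * Modules given by generators and relations *)

Inductive lspan (K : fieldType) (M : lmodType K) (A : set M) : set M :=
| lspan0 : lspan A 0
| lspan_gen x : A x -> lspan A x
| lspanD x y : lspan A x -> lspan A y -> lspan A (x + y)
| lspanZ a x : lspan A x -> lspan A (a *: x).

Definition spanp (K : fieldType) (M : lmodType K) (A : set M) : {pred M} :=
  fun x => `[< lspan A x >].

Fact spanp_zmod (K : fieldType) (M : lmodType K) (A : set M) :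
  zmod_closed (spanp A).
Proof.
split; first exact/asboolP/lspan0.
move=> x y /asboolP hx /asboolP hy; apply/asboolP/lspanD => //.
by rewrite -scaleN1r; apply: lspanZ.
Qed.

HB.instance Definition _ (K : fieldType) (M : lmodType K) (A : set M) :=
  GRing.isZmodClosed.Build M (spanp A) (spanp_zmod A).

(** quotient of [M] by the submodule generated by [A] *)
Definition modquot (K : fieldType) (M : lmodType K) (A : set M) : Type :=
  Quotient.quot (spanp A).
HB.instance Definition _ (K : fieldType) (M : lmodType K) (A : set M) :=
  Choice.copy (modquot A) (Quotient.quot (spanp A)).

(* locked for the sake of unification *)
HB.lock Definition qproj (K : fieldType) (M : lmodType K) (A : set M) (x : M)
  : modquot A := \pi_(Quotient.quot (spanp A)) x.
HB.lock Definition qrepr (K : fieldType) (M : lmodType K) (A : set M)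
  (x : modquot A) : M := repr (x : Quotient.quot (spanp A)).

HB.lock Definition qzero (K : fieldType) (M : lmodType K) (A : set M) :
  modquot A := qproj A 0.
HB.lock Definition qopp (K : fieldType) (M : lmodType K) (A : set M)
  (x : modquot A) : modquot A := qproj A (- qrepr x).
HB.lock Definition qadd (K : fieldType) (M : lmodType K) (A : set M)
  (x y : modquot A) : modquot A := qproj A (qrepr x + qrepr y).
HB.lock Definition qscale (K : fieldType) (M : lmodType K) (A : set M) (c : K)
  (x : modquot A) : modquot A := qproj A (c *: qrepr x).

Section ModQuot.
Variables (K : fieldType) (M : lmodType K) (A : set M).
Implicit Types x y z : modquot A.
Local Notation pr := (@qproj K M A).

Lemma qprojP (x y : M) : (pr x = pr y) <-> lspan A (x - y).
Proof.
rewrite !qproj.unlock; split=> [/eqP|h].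
- by rewrite -[_ == _]/(_ == _ %[mod Quotient.quot (spanp A)])
    -Quotient.idealrBE => /asboolP.
- apply/eqP; rewrite -[_ == _]/(_ == _ %[mod Quotient.quot (spanp A)]).
  by rewrite -Quotient.idealrBE; apply/asboolP.
Qed.

Lemma qreprK x : pr (qrepr x) = x.
Proof. by rewrite qproj.unlock qrepr.unlock; exact: reprK. Qed.

Let qoppE (x : M) : qopp (pr x) = pr (- x).
Proof.
rewrite qopp.unlock; apply/qprojP; rewrite -opprD -[X in lspan _ X]scaleN1r; apply: lspanZ.
by apply/qprojP; rewrite qreprK.
Qed.
Let qaddE (x y : M) : qadd (pr x) (pr y) = pr (x + y).
Proof.
rewrite qadd.unlock; apply/qprojP; rewrite opprD addrACA.
by apply: lspanD; apply/qprojP; rewrite qreprK.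
Qed.
Let qscaleE c (x : M) : qscale c (pr x) = pr (c *: x).
Proof.
rewrite qscale.unlock; apply/qprojP; rewrite -scalerBr; apply: lspanZ.
by apply/qprojP; rewrite qreprK.
Qed.

Fact qaddA : associative (@qadd K M A).
Proof.
move=> x y z; rewrite -(qreprK x) -(qreprK y) -(qreprK z).
by rewrite !qaddE addrA.
Qed.
Fact qaddC : commutative (@qadd K M A).
Proof. by move=> x y; rewrite -(qreprK x) -(qreprK y) !qaddE addrC. Qed.
Fact qadd0 : left_id (qzero A) (@qadd K M A).
Proof. by move=> x; rewrite qzero.unlock -(qreprK x) !qaddE add0r. Qed.
Fact qaddN : left_inverse (qzero A) (@qopp K M A) (@qadd K M A).
Proof. by move=> x; rewrite qzero.unlock -(qreprK x) !qoppE !qaddE addNr. Qed.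

HB.instance Definition _ :=
  GRing.isZmodule.Build (modquot A) qaddA qaddC qadd0 qaddN.

Fact qscaleA a b x : qscale a (qscale b x) = qscale (a * b) x.
Proof. by rewrite -(qreprK x) !qscaleE scalerA. Qed.
Fact qscale1 : left_id 1 (@qscale K M A).
Proof. by move=> x; rewrite -(qreprK x) qscaleE scale1r. Qed.
Fact qscaleDr : right_distributive (@qscale K M A) +%R.
Proof.
move=> a x y; rewrite -(qreprK x) -(qreprK y).
by rewrite -![(_ + _ : modquot A)]/(qadd _ _) !(qscaleE, qaddE) scalerDr.
Qed.
Fact qscaleDl x : {morph (@qscale K M A)^~ x : a b / a + b}.
Proof.
move=> a b; rewrite -(qreprK x).
by rewrite -![(_ + _ : modquot A)]/(qadd _ _) !(qscaleE, qaddE) scalerDl.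
Qed.

HB.instance Definition _ :=
  GRing.Zmodule_isLmodule.Build K (modquot A) qscaleA qscale1 qscaleDr qscaleDl.

Fact qproj_linear : linear pr.
Proof.
move=> a x y.
by rewrite -[RHS]/(qadd (qscale _ _) _) !(qscaleE, qaddE).
Qed.
HB.instance Definition _ :=
  GRing.isLinear.Build K M (modquot A) _ pr qproj_linear.
End ModQuot.

(** [pres A] is the module with generators [X] and relations [A]; a map on
    generators extends to [pres A] by [plift], which is the induced linear map
    as soon as the relations are respected ([plift_linear], [plift_gen]). *)
Notation pres A := (modquot A) (only parsing).

Definition ext (K : fieldType) (X : choiceType) (W : lmodType K) (f : X -> W)
  (g : {malg K[X]}) : W := \sum_(k <- msupp g) g@_k *: f k.

HB.lock Definition gen (K : fieldType) (X : choiceType) (A : set {malg K[X]})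
  (x : X) : pres A := qproj A << x >>.

HB.lock Definition plift (K : fieldType) (X : choiceType) (A : set {malg K[X]})
  (W : lmodType K) (f : X -> W) (x : pres A) : W := ext f (qrepr x).

Lemma qproj_rel (K : fieldType) (M : lmodType K) (A : set M) x :
  A x -> qproj A x = 0.
Proof.
move=> Ax; have <- : qproj A 0 = 0 :> modquot A by exact: raddf0.
by apply/qprojP; rewrite subr0; apply: lspan_gen.
Qed.

Lemma gen_rel2 (K : fieldType) (X : choiceType) (A : set {malg K[X]}) x c y :
  A (<< x >> - c *: << y >>) -> gen A x = c *: gen A y.
Proof.
move=> /qproj_rel; rewrite gen.unlock linearB linearZZ /=.
by move/eqP; rewrite subr_eq0 => /eqP.
Qed.

Lemma gen_rel3 (K : fieldType) (X : choiceType) (A : set {malg K[X]}) x c y z :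
  A (<< x >> - c *: << y >> - << z >>) -> gen A x = c *: gen A y + gen A z.
Proof.
move=> /qproj_rel; rewrite gen.unlock !linearB linearZZ /= -addrA -opprD.
by move/eqP; rewrite subr_eq0 => /eqP.
Qed.

Section PresentedTheory.
Variables (K : fieldType) (X : choiceType) (W : lmodType K).
Implicit Types (f : X -> W) (g : {malg K[X]}).

Lemma extEw f (d : {fset X}) g : (msupp g `<=` d)%fset ->
  ext f g = \sum_(k <- d) g@_k *: f k.
Proof.
move=> le; rewrite /ext (big_fset_incl _ le) //= => k _ /mcoeff_outdom ->.
by rewrite scale0r.
Qed.

Fact ext_linear f : linear (ext f).
Proof.
move=> a g h.
pose d := (msupp g `|` msupp h `|` msupp (a *: g + h))%fset.
rewrite !(@extEw f d) //; last 3 first.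
- by apply/fsubsetP=> x hx; rewrite !inE hx ?orbT.
- by apply/fsubsetP=> x hx; rewrite !inE hx ?orbT.
- by apply/fsubsetP=> x hx; rewrite !inE hx ?orbT.
rewrite scaler_sumr -big_split /=; apply: eq_bigr => k _.
by rewrite mcoeffD mcoeffZ scalerDl scalerA.
Qed.
HB.instance Definition _ f :=
  GRing.isLinear.Build K {malg K[X]} W _ (ext f) (ext_linear f).

Lemma ext_gen f x : ext f << x >> = f x.
Proof.
rewrite (@extEw _ [fset x]%fset) ?msuppU_le // big_seq_fset1.
by rewrite mcoeffUU scale1r.
Qed.

Lemma gen_ind (A : set {malg K[X]}) (P : pres A -> Prop) :
  P 0 -> (forall a x y, P y -> P (a *: gen A x + y)) -> forall x, P x.
Proof.
rewrite gen.unlock => P0 PD x; rewrite -(qreprK x) (monalgE (qrepr x)).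
elim: (X in \sum_(k <- X) _) => [|k s IH]; first by rewrite big_nil raddf0.
rewrite big_cons -[<< _ *g k >>](_ : (qrepr x)@_k *: << k >> = _).
  by rewrite linearP; apply: PD.
by apply/malgP => k'; rewrite mcoeffZ !mcoeffU mulrnAr mulr1.
Qed.

Variables (A : set {malg K[X]}) (f : X -> W).
Hypothesis fA : forall g, A g -> ext f g = 0.

Lemma ext_lspan g : lspan A g -> ext f g = 0.
Proof.
elim=> [|x /fA//|x y _ hx _ hy|a x _ hx]; rewrite ?raddf0 //.
- by rewrite raddfD /= hx hy addr0.
- by rewrite linearZZ /= hx scaler0.
Qed.

Lemma plift_qproj g : plift f (qproj A g : pres A) = ext f g.
Proof.
rewrite plift.unlock; apply/eqP; rewrite -subr_eq0 -raddfB; apply/eqP/ext_lspan.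
by apply/qprojP; rewrite qreprK.
Qed.

Lemma plift_gen x : plift f (gen A x) = f x.
Proof. by rewrite gen.unlock plift_qproj ext_gen. Qed.

Lemma plift_linear : linear (plift f : pres A -> W).
Proof.
by move=> a x y; rewrite -(qreprK x) -(qreprK y) -linearP !plift_qproj linearP.
Qed.
End PresentedTheory.

Section Lin.
Variables (K : fieldType) (U W : lmodType K) (f : U -> W).
Hypothesis fl : linear f.

Lemma lin0 : f 0 = 0.
Proof. by have := fl (-1) 0 0; rewrite scaler0 addr0 scaleN1r addNr. Qed.
Lemma linD x y : f (x + y) = f x + f y.
Proof. by rewrite -[x]scale1r fl !scale1r. Qed.
Lemma linZ c x : f (c *: x) = c *: f x.
Proof. by rewrite -[c *: x]addr0 fl lin0 addr0. Qed.
Lemma lin_sum I (r : seq I) (P : pred I) (F : I -> U) :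
  f (\sum_(i <- r | P i) F i) = \sum_(i <- r | P i) f (F i).
Proof. exact: (big_morph f linD lin0). Qed.

Lemma lin_scale c : linear (fun x => c *: f x).
Proof. by move=> d x y; rewrite fl scalerDr !scalerA mulrC. Qed.
Lemma lin_add (g : U -> W) : linear g -> linear (fun x => f x + g x).
Proof. by move=> gl d x y; rewrite fl gl scalerDr addrACA. Qed.
Lemma lin_comp (T : lmodType K) (g : T -> U) :
  linear g -> linear (fun x => f (g x)).
Proof. by move=> gl d x y; rewrite gl fl. Qed.
End Lin.

Lemma gen_ext (K : fieldType) (X : choiceType) (A : set {malg K[X]})
  (W : lmodType K) (f g : pres A -> W) :
  linear f -> linear g -> (forall x, f (gen A x) = g (gen A x)) -> f =1 g.
Proof.
move=> fl gl fg; apply: gen_ind => [|a x y e].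
  by rewrite (lin0 fl) (lin0 gl).
by rewrite fl gl fg e.
Qed.

(** * Tensor products *)
Section Tensor.
Variables (K : fieldType).

Inductive tensor_rel (A B : lmodType K) : set {malg K[(A * B)%type]} :=
| tensor_rell c a a' b :
    tensor_rel (<< (c *: a + a', b) >> - c *: << (a, b) >> - << (a', b) >>)
| tensor_relr c a b b' :
    tensor_rel (<< (a, c *: b + b') >> - c *: << (a, b) >> - << (a, b') >>).

Definition tensor (A B : lmodType K) : lmodType K := pres (@tensor_rel A B).

Definition tens (A B : lmodType K) (a : A) (b : B) : tensor A B :=
  gen (@tensor_rel A B) (a, b).

Definition tmap (A B A' B' : lmodType K) (f : A -> A') (g : B -> B') :
  tensor A B -> tensor A' B' := plift (fun p => tens (f p.1) (g p.2)).
End Tensor.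

Section TensorTheory.
Variable K : fieldType.
Implicit Types A B : lmodType K.

Lemma tens_linearl A B (b : B) : linear (fun a : A => tens a b).
Proof.
by move=> c a a'; exact/gen_rel3/tensor_rell.
Qed.

Lemma tens_linearr A B (a : A) : linear (fun b : B => tens a b).
Proof.
by move=> c b b'; exact/gen_rel3/tensor_relr.
Qed.

Lemma tensor_lift A B (W : lmodType K) (f : A -> B -> W) :
  (forall b, linear (f^~ b)) -> (forall a, linear (f a)) ->
  forall g, tensor_rel g -> ext (fun p : (A * B)%type => f p.1 p.2) g = 0.
Proof.
move=> fl fr _ [c a a' b|c a b b']; rewrite !linearB linearZZ /= !ext_gen /=.
- by rewrite fl (addrC (_ *: _)) addrK subrr.
- by rewrite fr (addrC (_ *: _)) addrK subrr.
Qed.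

Section Tmap.
Variables (A B A' B' : lmodType K) (f : A -> A') (g : B -> B').
Hypotheses (fl : linear f) (gl : linear g).

Let tmap_rel : forall r, tensor_rel r ->
  ext (fun p : (A * B)%type => tens (f p.1) (g p.2)) r = 0.
Proof.
apply: (tensor_lift (f := fun a b => tens (f a) (g b))) => [b|a] c x y.
- by rewrite fl tens_linearl.
- by rewrite gl tens_linearr.
Qed.

Lemma tmap_linear : linear (tmap f g).
Proof. exact: plift_linear tmap_rel. Qed.

Lemma tmap_tens a b : tmap f g (tens a b) = tens (f a) (g b).
Proof. exact: plift_gen tmap_rel _. Qed.
End Tmap.
End TensorTheory.

(** * Filtered graded vector spaces *)
Record fgspace (K : fieldType) := FGSpace {
  piece :> int -> lmodType K;
  fil : int -> forall i, set (piece i)   (* [fil k i] is F^k V^i *)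
}.
Arguments fil [K] f k i.

(** Completeness and the other conditions are imposed in each degree, as usual
    for graded vector spaces. *)
Record complete_filtration (K : fieldType) (V : fgspace K) : Prop := {
  fil_0 : forall k i, fil V k i 0;
  fil_lin : forall k i a (x y : V i),
    fil V k i x -> fil V k i y -> fil V k i (a *: x + y);
  fil_desc : forall k i, fil V (k + 1) i `<=` fil V k i;
  fil_exh : forall i (x : V i), exists k, fil V k i x;
  fil_sep : forall i (x : V i), (forall k, fil V k i x) -> x = 0;
  fil_compl : forall i (u : nat -> V i),
    (forall k, exists N, forall m n, (N <= m)%N -> (N <= n)%N ->
       fil V k i (u m - u n)) ->
    exists l, forall k, exists N, forall n, (N <= n)%N -> fil V k i (u n - l)
}.

Definition shift (K : fieldType) (V : fgspace K) (s : int) : fgspace K :=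
  FGSpace (fun k i => fil V k (s + i)).

(** * The graded symmetric coalgebra *)
Section Sym.
Variables (K : fieldType) (V : fgspace K).

(** words of homogeneous elements, each letter carrying its degree *)
Definition word := seq {i : int & V i}.
Definition letter (i : int) (v : V i) : {i : int & V i} := existT _ i v.
Definition wdeg (w : word) : int := \sum_(x <- w) tag x.
Definition ksgn (i j : int) : K := (-1) ^ (i * j).

Inductive sym_rel : set {malg K[word]} :=
| sym_rel_lin (u w : word) i c (x y : V i) :
    sym_rel (<< u ++ letter (c *: x + y) :: w >>
             - c *: << u ++ letter x :: w >> - << u ++ letter y :: w >>)
| sym_rel_comm (u w : word) x y :
    sym_rel (<< u ++ x :: y :: w >>
             - ksgn (tag x) (tag y) *: << u ++ y :: x :: w >>).

Definition Sym : lmodType K := pres sym_rel.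

Definition mon (w : word) : Sym := gen sym_rel w.
Definition sone : Sym := mon [::].
Definition iota (i : int) (v : V i) : Sym := mon [:: letter v].

Definition vee (x y : Sym) : Sym :=
  plift (fun u => plift (fun w => mon (u ++ w)) y) x.

(** [spr n] is pr_{Sym^n}; we identify V with Sym^1(V), so [spr 1] is pr_V. *)
Definition spr (n : nat) : Sym -> Sym :=
  plift (fun w => if size w == n then mon w else 0).

(** [sgnop p x] is (-1)^(p|x|) x. *)
Definition sgnop (p : int) : Sym -> Sym :=
  plift (fun w => ksgn p (wdeg w) *: mon w).

(** Koszul sign of moving the letters selected by the mask [m] to the left of
    the remaining ones, keeping the order in both groups. *)
Fixpoint unshuffle_sgn (m : seq bool) (w : word) : K :=
  match m, w with
  | b :: m', x :: w' =>
      (if b then 1 else ksgn (tag x) (wdeg (mask m' w'))) * unshuffle_sgn m' w'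
  | _, _ => 1
  end.

Definition wcop (w : word) : tensor Sym Sym :=
  \sum_(m : (size w).-tuple bool)
     unshuffle_sgn m w *: tens (mon (mask m w)) (mon (mask (map negb m) w)).

Definition cop : Sym -> tensor Sym Sym := plift wcop.

(** reduced coproduct, precomposed with the projection onto Sym^{>= 1} *)
Definition rcop (x : Sym) : tensor Sym Sym :=
  let y := x - spr 0 x in cop y - tens y sone - tens sone y.

Definition smul : tensor Sym Sym -> Sym := plift (fun p => vee p.1 p.2).

Definition sdeg (i : int) : set Sym := lspan [set mon w | w in [set w | wdeg w = i]].

(** V^i, as a subspace of Sym^1(V) *)
Definition gr1 (i : int) : set Sym := range (@iota i).

(** product filtration: generated by the v_1 v ... v v_n with
    v_j in F^{k_j} and k_1 + ... + k_n >= k; on the summand V of Sym(V) it is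
    the filtration of V *)
Fixpoint wfil (k : int) (w : word) : Prop :=
  match w with
  | [::] => k <= 0
  | x :: w' => exists j, fil V j (tag x) (tagged x) /\ wfil (k - j) w'
  end.

Definition sfil (k : int) : set Sym := lspan [set mon w | w in [set w | wfil k w]].

(** truncations of exp and of the reduced exponential *)
Definition vpow (x : Sym) (n : nat) : Sym := iter n (vee x) sone.
Definition sexp (N : nat) (x : Sym) : Sym :=
  \sum_(n < N) (n`!%:R : K)^-1 *: vpow x n.
Definition sexpbar (N : nat) (x : Sym) : Sym :=
  \sum_(1 <= n < N) (n`!%:R : K)^-1 *: vpow x n.

(** power series in t with coefficients in Sym(V): [a j] is the coefficient
    of t^j *)
Definition psmul (a b : nat -> Sym) : nat -> Sym :=
  fun m => \sum_(j < m.+1) vee (a j) (b (m - j)%N).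
Definition psone : nat -> Sym := fun m => if m is 0 then sone else 0.
Definition pspow (a : nat -> Sym) (n : nat) : nat -> Sym := iter n (psmul a) psone.
Definition psexp (N : nat) (a : nat -> Sym) : nat -> Sym :=
  fun m => \sum_(n < N) (n`!%:R : K)^-1 *: pspow a n m.
Definition psexpbar (N : nat) (a : nat -> Sym) : nat -> Sym :=
  fun m => \sum_(1 <= n < N) (n`!%:R : K)^-1 *: pspow a n m.
End Sym.

(** The operations above respect the relations defining Sym(V). *)
Section SymTheory.
Variables (K : fieldType) (V : fgspace K).
Implicit Types (u w : word V) (x y : Sym V).

Lemma mon_lin u w i c (a b : V i) :
  mon (u ++ letter (c *: a + b) :: w) =
  c *: mon (u ++ letter a :: w) + mon (u ++ letter b :: w).
Proof.
exact/gen_rel3/sym_rel_lin.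
Qed.

Lemma mon_comm u w a b :
  mon (u ++ a :: b :: w) = ksgn K (tag a) (tag b) *: mon (u ++ b :: a :: w).
Proof.
exact/gen_rel2/sym_rel_comm.
Qed.

Lemma sym_lift (W : lmodType K) (f : word V -> W) :
  (forall u w i c (a b : V i), f (u ++ letter (c *: a + b) :: w) =
     c *: f (u ++ letter a :: w) + f (u ++ letter b :: w)) ->
  (forall u w a b,
     f (u ++ a :: b :: w) = ksgn K (tag a) (tag b) *: f (u ++ b :: a :: w)) ->
  forall g, sym_rel g -> ext f g = 0.
Proof.
move=> fl fc _ [u w i c a b|u w a b]; rewrite !linearB linearZZ /= !ext_gen.
- by rewrite fl (addrC (_ *: _)) addrK subrr.
- by rewrite fc subrr.
Qed.

Lemma sym_ext (W : lmodType K) (f g : Sym V -> W) :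
  linear f -> linear g -> (forall w, f (mon w) = g (mon w)) -> f =1 g.
Proof. exact: gen_ext. Qed.

Let vee1_rel u : forall g, sym_rel g -> ext (fun w => mon (u ++ w)) g = 0.
Proof.
apply: sym_lift => [v w i c a b|v w a b]; rewrite !catA.
- exact: mon_lin.
- exact: mon_comm.
Qed.

Let vee1 u : Sym V -> Sym V := plift (fun w => mon (u ++ w)).
Let vee1_linear u : linear (vee1 u).
Proof. exact: plift_linear (vee1_rel u). Qed.
Let vee1_mon u w : vee1 u (mon w) = mon (u ++ w).
Proof. exact: plift_gen (vee1_rel u) w. Qed.

Let vee_rel y : forall g, sym_rel g -> ext (fun u => vee1 u y) g = 0.
Proof.
apply: sym_lift => [u v i c a b|u v a b]; move: y.
- apply: sym_ext => [||w]; first exact: vee1_linear.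
    exact (lin_add (lin_scale (vee1_linear _) c) (vee1_linear _)).
  by rewrite !vee1_mon -!catA; exact: mon_lin.
- apply: sym_ext => [||w]; first exact: vee1_linear.
    exact (lin_scale (vee1_linear _) _).
  by rewrite !vee1_mon -!catA; exact: mon_comm.
Qed.

Lemma vee_linearl y : linear (fun x => vee x y).
Proof. exact: plift_linear (vee_rel y). Qed.

Let vee_monl u y : vee (mon u) y = vee1 u y.
Proof. exact: plift_gen (vee_rel y) u. Qed.

Lemma vee_mon u w : vee (mon u) (mon w) = mon (u ++ w).
Proof. by rewrite vee_monl vee1_mon. Qed.

Lemma vee_linearr x : linear (vee x).
Proof.
move=> c y z; move: x; apply: sym_ext => [||u].
- exact: vee_linearl.
- exact (lin_add (lin_scale (vee_linearl _) c) (vee_linearl _)).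
- by rewrite !vee_monl vee1_linear.
Qed.

Lemma wdeg_cons a w : wdeg (a :: w) = tag a + wdeg w.
Proof. by rewrite /wdeg big_cons. Qed.

Lemma wdeg_cat u w : wdeg (u ++ w) = wdeg u + wdeg w.
Proof. by rewrite /wdeg big_cat. Qed.

Let spr_rel n : forall g, sym_rel g ->
  ext (fun w : word V => if size w == n then mon w else 0) g = 0.
Proof.
apply: sym_lift => [u w i c a b|u w a b]; rewrite !size_cat /=; case: ifP => _.
- exact: mon_lin.
- by rewrite scaler0 addr0.
- exact: mon_comm.
- by rewrite scaler0.
Qed.

Lemma spr_linear n : linear (@spr K V n).
Proof. exact: plift_linear (@spr_rel n). Qed.

Lemma spr_mon n w : spr n (mon w) = if size w == n then mon w else 0.
Proof. exact: plift_gen (@spr_rel n) _. Qed.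

Let sgnop_rel p : forall g, sym_rel g ->
  ext (fun w : word V => ksgn K p (wdeg w) *: mon w) g = 0.
Proof.
apply: sym_lift => [u w i c a b|u w a b]; rewrite !wdeg_cat !wdeg_cons.
- by rewrite mon_lin scalerDr !scalerA (mulrC c).
- by rewrite mon_comm !scalerA mulrC (addrCA (tag a)).
Qed.

Lemma sgnop_linear p : linear (@sgnop K V p).
Proof. exact: plift_linear (@sgnop_rel p). Qed.

Lemma sgnop_mon p w : sgnop p (mon w) = ksgn K p (wdeg w) *: mon w.
Proof. exact: plift_gen (@sgnop_rel p) _. Qed.

Let smul_rel : forall g, tensor_rel g ->
  ext (fun p : (Sym V * Sym V)%type => vee p.1 p.2) g = 0.
Proof.
exact: (tensor_lift (f := @vee K V)) vee_linearl vee_linearr. Qed.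

Lemma smul_linear : linear (@smul K V).
Proof. exact: plift_linear smul_rel. Qed.

Lemma smul_tens x y : smul (tens x y) = vee x y.
Proof. exact: plift_gen smul_rel _. Qed.

Let copL (a : {i : int & V i}) : tensor (Sym V) (Sym V) -> tensor (Sym V) (Sym V) :=
  tmap (vee (mon [:: a])) (@id (Sym V)).
Let copR (a : {i : int & V i}) : tensor (Sym V) (Sym V) -> tensor (Sym V) (Sym V) :=
  tmap (@sgnop K V (tag a)) (vee (mon [:: a])).

Let id_linear : linear (@id (Sym V)). Proof. by []. Qed.

Let copL_linear a : linear (copL a).
Proof. exact: tmap_linear (vee_linearr _) id_linear. Qed.
Let copR_linear a : linear (copR a).
Proof. exact: tmap_linear (sgnop_linear _) (vee_linearr _). Qed.

Lemma wcop_cons a w : wcop (a :: w) = copL a (wcop w) + copR a (wcop w).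
Proof.
rewrite /wcop (lin_sum (copL_linear a)) (lin_sum (copR_linear a)).
pose h (p : bool * (size w).-tuple bool) : (size w).+1.-tuple bool :=
  [tuple of p.1 :: p.2].
rewrite (reindex h) /=; last first.
  exists (fun t : (size w).+1.-tuple bool => (thead t, behead_tuple t)).
    by move=> [b t] _; congr pair; apply/val_inj.
  by move=> t _; rewrite [RHS]tuple_eta; apply/val_inj.
rewrite -(pair_big xpredT xpredT (fun b (t : (size w).-tuple bool) =>
  unshuffle_sgn (h (b, t)) (a :: w) *: tens (mon (mask (h (b, t)) (a :: w)))
    (mon (mask (map negb (h (b, t))) (a :: w))))) /=.
rewrite big_bool /=; congr (_ + _); apply: eq_bigr => t _ /=.
- rewrite mul1r (linZ (copL_linear a)) /= /copL.
  by rewrite (tmap_tens (vee_linearr _) id_linear) vee_mon.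
- rewrite (linZ (copR_linear a)) /= /copR.
  rewrite (tmap_tens (sgnop_linear _) (vee_linearr _)) vee_mon sgnop_mon.
  by rewrite (linZ (tens_linearl _)) scalerA (mulrC (ksgn _ _ _)).
Qed.

Lemma symtens_ext (W : lmodType K) (f g : tensor (Sym V) (Sym V) -> W) :
  linear f -> linear g ->
  (forall u w, f (tens (mon u) (mon w)) = g (tens (mon u) (mon w))) -> f =1 g.
Proof.
move=> fl gl fg; apply: gen_ext => // -[x y]; rewrite -/(tens x y).
move: x; apply: sym_ext => [||u].
- exact (lin_comp fl (tens_linearl y)).
- exact (lin_comp gl (tens_linearl y)).
- move: y; apply: sym_ext => [||w]; last exact: fg.
  + exact (lin_comp fl (tens_linearr (mon u))).
  + exact (lin_comp gl (tens_linearr (mon u))).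
Qed.

Lemma ksgnDr i j k : ksgn K i (j + k) = ksgn K i j * ksgn K i k.
Proof. by rewrite /ksgn mulrDr expfzDr // oppr_eq0 oner_eq0. Qed.
Lemma ksgnC i j : ksgn K i j = ksgn K j i.
Proof. by rewrite /ksgn mulrC. Qed.
Lemma ksgnK i j : ksgn K i j * ksgn K i j = 1.
Proof. by rewrite /ksgn -exprzMl ?unitrN1 // mulrNN mulr1 exp1rz. Qed.

Let copL_tens a u w : copL a (tens (mon u) (mon w)) = tens (mon (a :: u)) (mon w).
Proof. by rewrite /copL (tmap_tens (vee_linearr _) id_linear) vee_mon. Qed.

Let copR_tens a u w : copR a (tens (mon u) (mon w)) =
  ksgn K (tag a) (wdeg u) *: tens (mon u) (mon (a :: w)).
Proof.
rewrite /copR (tmap_tens (sgnop_linear _) (vee_linearr _)) vee_mon sgnop_mon.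
by rewrite (linZ (tens_linearl _)).
Qed.

Let cop1 (a : {i : int & V i}) (z : tensor (Sym V) (Sym V)) :
  tensor (Sym V) (Sym V) := copL a z + copR a z.
Let cop1_linear a : linear (cop1 a).
Proof. exact (lin_add (copL_linear a) (copR_linear a)). Qed.

Let cop_rel : forall g, sym_rel g -> ext (@wcop K V) g = 0.
Proof.
have wcop1 a w : wcop (a :: w) = cop1 a (wcop w) by exact: wcop_cons.
apply: sym_lift.
- move=> u w i c a b; elim: u => [|x u IH] /=; last first.
    by rewrite !wcop1 IH cop1_linear.
  rewrite !wcop1; move: (wcop w); apply: symtens_ext => [||u v].
  + exact: cop1_linear.
  + exact (lin_add (lin_scale (cop1_linear _) c) (cop1_linear _)).
  + rewrite /cop1 !copL_tens !copR_tens /= (mon_lin [::] u) (mon_lin [::] v) /=.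
    rewrite tens_linearl tens_linearr !scalerDr !scalerA (mulrC c).
    by rewrite addrACA.
- move=> u w a b; elim: u => [|x u IH] /=; last first.
    rewrite wcop1 IH (wcop1 x (u ++ b :: a :: w)).
    exact (linZ (cop1_linear x) _ _).
  rewrite !wcop1; move: (wcop w); apply: symtens_ext => [||u v].
  + exact (lin_comp (cop1_linear _) (cop1_linear _)).
  + exact (lin_scale (lin_comp (cop1_linear _) (cop1_linear _)) _).
  + rewrite /cop1 !copL_tens !copR_tens.
    rewrite !(linD (copL_linear _)) !(linD (copR_linear _)).
    rewrite !(linZ (copL_linear _)) !(linZ (copR_linear _)) !copL_tens !copR_tens.
    rewrite (mon_comm [::] u) (mon_comm [::] v) /= !wdeg_cons.
    rewrite (linZ (tens_linearl _)) (linZ (tens_linearr _)) !scalerDr !scalerA.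
    rewrite !ksgnDr (ksgnC (tag b) (tag a)).
    set s := ksgn K (tag a) (tag b); set x := ksgn K _ _; set y := ksgn K _ _.
    by rewrite (mulrA s s x) ksgnK mul1r (mulrC (x * y)) (mulrC x) mulrA addrACA.
Qed.

Lemma cop_linear : linear (@cop K V).
Proof. exact: plift_linear cop_rel. Qed.

Lemma cop_mon w : cop (mon w) = wcop w.
Proof. exact: plift_gen cop_rel _. Qed.
End SymTheory.

(** * Maurer-Cartan elements and homotopy equivalence

    [U] contains the graded pieces [gr i] of a filtered graded space, i being
    the degree in the shifted space L[1], so that L^1 is [gr 0] and L^0 is
    [gr (-1)]. [br [:: (i1, v1); ...; (in, vn)]] is Q^1_n(v1 v ... v vn) for
    v_j of degree i_j. *)
Section MaurerCartan.
Variables (K : fieldType) (U : lmodType K) (gr fil : int -> set U).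
Variable br : seq (int * U) -> U.

Definition flim (u : nat -> U) (l : U) : Prop :=
  forall k, exists N, forall n, (N <= n)%N -> fil k (u n - l).

Definition the_lim (A : set U) (u : nat -> U) : U :=
  xget 0 [set l | A l /\ flim u l].

Definition maurer_cartan (p : U) : Prop :=
  [/\ gr 0 p, fil 1 p &
      flim (fun N => \sum_(n < N) (n`!%:R : K)^-1 *: br (nseq n (0, p))) 0].

(** F^1 of the completion of L^i[t]: as L is complete, the completion of
    L (x) K[t] with respect to the F^k L (x) K[t] consists of the power series
    whose coefficients tend to 0. *)
Definition hat1 (i : int) (a : nat -> U) : Prop :=
  (forall j, gr i (a j) /\ fil 1 (a j)) /\
  (forall k, exists N, forall j, (N <= j)%N -> fil k (a j)).

(** coefficient of t^m in Q^1_{n+1}(lambda(t) v pi(t)^{v n}) *)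
Definition flow_coef (pt lt : nat -> U) (m n : nat) : U :=
  \sum_(j : n.+1.-tuple 'I_m.+1 | \sum_(x <- j) (x : nat) == m)
     br ((-1, lt (thead j)) :: [seq (0, pt x) | x : 'I_m.+1 <- behead j]).

Definition equivalent_via (p0 p1 : U) (pt lt : nat -> U) : Prop :=
  [/\ hat1 0 pt, hat1 (-1) lt,
      forall m, flim (fun N => \sum_(n < N) (n`!%:R : K)^-1 *: flow_coef pt lt m n)
                     (m.+1%:R *: pt m.+1),
      pt 0 = p0 &
      flim (fun N => \sum_(j < N) pt j) p1].
End MaurerCartan.

(** * L-infinity algebras and morphisms *)
Section Linfty.
Variable K : fieldType.

Record coalgebra_morphism (V W : fgspace K) (F : Sym V -> Sym W) : Prop := {
  cm_linear : linear F;
  cm_deg : forall i, F @` sdeg i `<=` sdeg i;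
  cm_one : F (sone V) = sone W;
  cm_cop : forall x, cop (F x) = tmap F F (cop x)
}.

Record flat_Linfty (L : fgspace K) (Q : Sym (shift L 1) -> Sym (shift L 1)) : Prop := {
  Linfty_complete : complete_filtration L;
  Linfty_linear : linear Q;
  Linfty_deg : forall i, Q @` sdeg i `<=` sdeg (i + 1);
  Linfty_coder : forall x,
    cop (Q x) = tmap Q id (cop x) + tmap (sgnop 1) Q (cop x);
  Linfty_sqr : forall x, Q (Q x) = 0;
  Linfty_flat : Q (sone _) = 0;
  Linfty_fil : forall k, Q @` sfil k `<=` sfil k
}.

Record Linfty_morphism (L L' : fgspace K)
    (Q : Sym (shift L 1) -> Sym (shift L 1))
    (Q' : Sym (shift L' 1) -> Sym (shift L' 1))
    (F : Sym (shift L 1) -> Sym (shift L' 1)) : Prop := {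
  mor_coalg : coalgebra_morphism F;
  mor_comm : forall x, F (Q x) = Q' (F x);
  mor_fil : forall k, F @` sfil k `<=` sfil k
}.
End Linfty.

(** * Maurer-Cartan elements and twisting in an L-infinity algebra *)
Section Twist.
Variables (K : fieldType) (L : fgspace K).
Let S := Sym (shift L 1).
Variable Q : S -> S.

Definition bracket (w : seq (int * S)) : S :=
  spr 1 (Q (foldr (@vee _ _) (sone _) [seq x.2 | x <- w])).

Definition MC : S -> Prop := maurer_cartan (@gr1 _ _) (@sfil _ _) bracket.
Definition MC_equiv_via : S -> S -> (nat -> S) -> (nat -> S) -> Prop :=
  equivalent_via (@gr1 _ _) (@sfil _ _) bracket.

(** N-th approximation of the series (Q^{pi(t)})^1(X(t)), i.e. of
    pr_{L[1]}(exp(-pi(t)) v Q(exp(pi(t)) v X(t))) *)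
Definition twisted_Q1 (pt : nat -> S) (X : nat -> S) (N : nat) : nat -> S :=
  fun m => spr 1 (psmul (psexp N (fun j => - pt j))
                        (fun j => Q (psmul (psexp N pt) X j)) m).

(** [Phi m] is the coefficient of t^m of Phi_t, a morphism of coalgebras
    Sym(L[1]) -> Sym(L[1])[[t]]; the equation in [flow_ode] is the one between
    the coefficients of t^m. *)
Record associated_flow (pt lt : nat -> S) (Phi : nat -> S -> S) : Prop := {
  flow_linear : forall m, linear (Phi m);
  flow_deg : forall m i, Phi m @` sdeg i `<=` sdeg i;
  flow_one : forall m, Phi m (sone _) = psone _ m;
  flow_cop : forall m x,
    cop (Phi m x) = \sum_(j < m.+1) tmap (Phi j) (Phi (m - j)%N) (cop x);
  (* the Taylor coefficients lie in the completion of L[1][t] *)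
  flow_null : forall x k, exists N, forall m, (N <= m)%N -> sfil k (spr 1 (Phi m x));
  flow_init : forall x, spr 1 (Phi 0 x) = spr 1 x;
  flow_ode : forall i a, spr i a = a -> forall m,
    flim (@sfil _ _)
      (fun N => \sum_(1 <= k < i.+1)
         twisted_Q1 pt (psmul lt (fun j => spr k (Phi j a))) N m)
      (m.+1%:R *: spr 1 (Phi m.+1 a))
}.

(** [Phi1] is Phi_t at t = 1: its Taylor coefficients are those of Phi_t
    evaluated at t = 1. *)
Definition associated_iso (pt lt : nat -> S) (Phi1 : S -> S) : Prop :=
  coalgebra_morphism Phi1 /\
  exists2 Phi, associated_flow pt lt Phi &
    forall x, flim (@sfil _ _) (fun N => \sum_(j < N) spr 1 (Phi j x)) (spr 1 (Phi1 x)).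
End Twist.

Section TwistMorphism.
Variables (K : fieldType) (L L' : fgspace K).
Let S := Sym (shift L 1).
Let S' := Sym (shift L' 1).
Variable F : S -> S'.

(** F^1(exp-bar(pi)) *)
Definition push_MC (p : S) : S' :=
  the_lim (@sfil _ _) (gr1 0) (fun N => spr 1 (F (sexpbar N p))).

(** F^1(exp-bar(pi(t))) *)
Definition push_path (pt : nat -> S) : nat -> S' := fun m =>
  the_lim (@sfil _ _) (gr1 0) (fun N => spr 1 (F (psexpbar N pt m))).

(** F^1(lambda(t) v exp(pi(t))) *)
Definition push_gauge (pt lt : nat -> S) : nat -> S' := fun m =>
  the_lim (@sfil _ _) (gr1 (-1)) (fun N => spr 1 (F (psmul lt (psexp N pt) m))).

(** [G] is F^pi, where F^pi(X) = exp(-S) v F(exp(pi) v X) *)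
Definition twisted_morphism (p : S) (G : S -> S') : Prop :=
  coalgebra_morphism G /\
  forall X, flim (@sfil _ _)
    (fun N => vee (sexp N (- push_MC p)) (F (vee (sexp N p) X))) (G X).
End TwistMorphism.

(** * The convolution L-infinity algebra and homotopies of morphisms

    H[1] = Hom(Sym^{>= 1}(L[1]), L'[1]): maps on Sym(L[1]) which vanish on
    Sym^0 and take values in Sym^1(L'[1]). *)
Section Convolution.
Variables (K : fieldType) (L L' : fgspace K).
Let S := Sym (shift L 1).
Let S' := Sym (shift L' 1).
Variables (Q : S -> S) (Q' : S' -> S').

(** degree-j part of H[1] *)
Definition conv_gr (j : int) : set (S -> S') := [set f |
  [/\ linear f /\ f (sone _) = 0,
      forall x, spr 1 (f x) = f x,
      forall i, f @` sdeg i `<=` sdeg (i + j) &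
      forall k, f @` sfil k `<=` sfil k]].

Definition conv_fil (k : int) : set (S -> S') := lspan [set f |
  exists j (n : nat) (m : int), [/\ n%:Z + m = k, conv_gr j f,
    forall i x, (i < n)%N -> spr i x = x -> f x = 0 &
    forall l, f @` sfil l `<=` sfil (l + m)]].

(** f * g for g of degree [d]; the Koszul rule is
    (f (x) g)(a (x) b) = (-1)^(|g||a|) f(a) (x) g(b). *)
Definition star (f : S -> S') (d : int) (g : S -> S') : S -> S' :=
  fun x => smul (tmap (fun a => f (sgnop d a)) g (rcop x)).

Fixpoint starl (s : seq (int * (S -> S'))) : S -> S' :=
  match s with
  | [::] => 0
  | [:: p] => p.2
  | p :: s' => star p.2 (\sum_(q <- s') q.1) (starl s')
  end.

Definition conv_bracket (s : seq (int * (S -> S'))) : S -> S' :=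
  match s with
  | [::] => 0
  | [:: p] => fun x => spr 1 (Q' (p.2 x)) - (-1) ^ p.1 *: p.2 (Q x)
  | _ => fun x => spr 1 (Q' (starl s x))
  end.

Definition homotopic (F G : S -> S') : Prop :=
  [/\ Linfty_morphism Q Q' F, Linfty_morphism Q Q' G &
      exists ft lt, equivalent_via conv_gr conv_fil conv_bracket
        (fun x => spr 1 (F x)) (fun x => spr 1 (G x)) ft lt].
End Convolution.

(* Main.v *)
Require Import Defs.
From HB Require Import structures.
From mathcomp Require Import all_boot all_order all_algebra.
From mathcomp Require Import boolp classical_sets functions.
From mathcomp Require Import zify.

Set Implicit Arguments.
Unset Strict Implicit.
Unset Printing Implicit Defensive.

Import Order.TTheory GRing.Theory Num.Theory.
Local Open Scope ring_scope.

(** Since pi(0) = 0, the exponential exp(pi(t)) is a power series in t whose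
    coefficients are finite sums, so everything up to the evaluation at t = 1 takes
    place in formal power series, without completing Sym(L[1]).

    Let Psi be the flow of the coderivation P = [Q, lambda(t) v -] with Psi_0 = id.
    It is comultiplicative and commutes with Q, and Psi(1) = exp(pi(t)), so that
    exp(pi(t)) v Phi_t = Psi_t by uniqueness of the associated flow. Let Psi' be the
    flow of P' = [Q', lambda'(t) v -] on L'. Then F Psi(1) and Psi'(1) solve the same
    equation, hence Psi'(1) = exp(pi'(t)), and
      F_t = Psi'_t^{-1} F Psi_t = Phi'_t^{-1} F^{pi(t)} Phi_t
    joins F to the twisted morphism. Its derivative is
      Psi'^{-1} (F P - P' F) Psi = Q' B + B Q,
      B = Psi'^{-1} (F (lambda v -) - (lambda' v -) F) Psi.
    Here B is a coderivation along F_t killing 1, so B = (pr B) * F_t for the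
    convolution product, and F_t' = Q' B + B Q is the gauge equation in the
    convolution algebra. All coefficients of P and P' raise the filtration by 1 and
    tend to 0, hence so do those of F_t and B, uniformly on Sym(L[1]); this gives
    convergence at t = 1. *)

(** * Cauchy products of formal power series *)

(** Only Sym^1 inherits separation and completeness from L; for the whole symmetric coalgebra
    neither is available, and exp(pi) is not one of its elements. This dictates the form of the
    argument. Identities are proved coefficient by coefficient in t, where uniqueness for linear
    differential equations replaces limits. No limit of maps is constructed: the values of the three
    factors at t = 1 are part of the data, and convergence to them is at first known only for Taylor
    coefficients or pointwise. Comultiplicativity, through a recursion that divides by n, carries it
    to all symmetric degrees, and uniform estimates on the coefficients make it uniform. Likewise a
    difference of maps is shown to vanish by recognising it as a coderivation whose Taylor
    coefficient vanishes, since only the latter takes values in a separated space. This is how the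
    end point is seen to commute with the codifferentials, by passing to the limit in F_t Q = Q'
    F_t. The choice of lambda' makes F (lambda v -) - (lambda' v -) F kill exp(pi(t)), which gives
    B(1) = 0. *)

Definition cau (A B : Type) (C : nmodType) (op : A -> B -> C)
  (a : nat -> A) (b : nat -> B) (m : nat) : C :=
  \sum_(j < m.+1) op (a j) (b (m - j)%N).

(** A symmetric constraint on three independent indices, instead of nested Cauchy products, turns
    every permutation of the arguments into an exchange of sums. *)
Definition cau3 (A B C : Type) (D : nmodType) (h : A -> B -> C -> D)
  (a : nat -> A) (b : nat -> B) (c : nat -> C) (m : nat) : D :=
  \sum_(i < m.+1) \sum_(j < m.+1) \sum_(k < m.+1 | (i + j + k == m)%N)
    h (a i) (b j) (c k).

Definition biadd (A B C : zmodType) (op : A -> B -> C) : Prop :=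
  (forall b, {morph op^~ b : x y / x + y}) /\
  (forall a, {morph op a : x y / x + y}).

Lemma additive0 (A B : zmodType) (f : A -> B) : {morph f : x y / x + y} -> f 0 = 0.
Proof. by move=> fD; apply: (addrI (f 0)); rewrite -fD !addr0. Qed.

Lemma additiveN (A B : zmodType) (f : A -> B) :
  {morph f : x y / x + y} -> {morph f : x / - x}.
Proof.
by move=> fD x; apply/eqP; rewrite -subr_eq0 opprK -fD addNr (additive0 fD).
Qed.

Lemma additive_sum (A B : zmodType) (f : A -> B) : {morph f : x y / x + y} ->
  forall I (r : seq I) (P : pred I) F,
    f (\sum_(i <- r | P i) F i) = \sum_(i <- r | P i) f (F i).
Proof. by move=> fD *; exact: (big_morph f fD (additive0 fD)). Qed.

Lemma additiveMn (A B : zmodType) (f : A -> B) : {morph f : x y / x + y} ->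
  forall x n, f (x *+ n) = f x *+ n.
Proof.
move=> fD x; elim=> [|n IH]; first by rewrite !mulr0n (additive0 fD).
by rewrite !mulrS fD IH.
Qed.

Section Biadditive.
Variables (A B C : zmodType) (op : A -> B -> C).
Hypothesis opD : biadd op.

Lemma biadd_suml I (r : seq I) (P : pred I) F b :
  op (\sum_(i <- r | P i) F i) b = \sum_(i <- r | P i) op (F i) b.
Proof. exact: (additive_sum (opD.1 b)). Qed.
Lemma biadd_sumr I (r : seq I) (P : pred I) F a :
  op a (\sum_(i <- r | P i) F i) = \sum_(i <- r | P i) op a (F i).
Proof. exact: (additive_sum (opD.2 a)). Qed.
Lemma biadd0l b : op 0 b = 0. Proof. exact: (additive0 (opD.1 b)). Qed.
Lemma biadd0r a : op a 0 = 0. Proof. exact: (additive0 (opD.2 a)). Qed.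
Lemma biaddNl a b : op (- a) b = - op a b. Proof. exact: (additiveN (opD.1 b)). Qed.
Lemma biaddNr a b : op a (- b) = - op a b. Proof. exact: (additiveN (opD.2 a)). Qed.
Lemma biaddBl a a' b : op (a - a') b = op a b - op a' b.
Proof. by rewrite (opD.1 b) biaddNl. Qed.
Lemma biaddBr a b b' : op a (b - b') = op a b - op a b'.
Proof. by rewrite (opD.2 a) biaddNr. Qed.
End Biadditive.

Lemma biadd_flip (A B C : zmodType) (op : A -> B -> C) :
  biadd op -> biadd (fun b a => op a b).
Proof. by move=> opD; split; [exact: opD.2 | exact: opD.1]. Qed.

Lemma sum_nat_eq (C : nmodType) (M n : nat) (F : nat -> C) : (n < M)%N ->
  \sum_(k < M | (k == n :> nat)%N) F k = F n.
Proof. by move=> lt; rewrite (big_pred1 (Ordinal lt)). Qed.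

Section Cauchy.
Implicit Types A B C : Type.

(** A common bound [M] lets coefficients of different orders be summed over one index set, so that
    sums can be exchanged. *)
Lemma cauE A B (C : nmodType) (op : A -> B -> C) a b m M : (m < M)%N ->
  cau op a b m = \sum_(i < M) \sum_(j < M | (i + j == m)%N) op (a i) (b j).
Proof.
move=> lt; rewrite /cau (big_ord_widen M (fun j => op (a j) (b (m - j)%N))) //.
rewrite big_mkcond; apply: eq_bigr => i _; case: ifP => im.
  rewrite -(@sum_nat_eq C M (m - i) (fun j => op (a i) (b j))); last by lia.
  by apply: eq_bigl => j; lia.
by rewrite big_pred0 // => j; lia.
Qed.

Lemma cauC A B (C : nmodType) (op : A -> B -> C) a b :
  cau op a b =1 cau (fun y x => op x y) b a.
Proof.
move=> m; rewrite (cauE _ _ _ (ltnSn m)) (exchange_big_dep xpredT) //=.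
rewrite (cauE _ _ _ (ltnSn m)); apply: eq_bigr => i _.
by apply: eq_bigl => j; rewrite addnC.
Qed.

Lemma eq_cau A B (C : nmodType) (op : A -> B -> C) a a' b b' m :
  (forall j, (j <= m)%N -> a j = a' j) -> (forall j, (j <= m)%N -> b j = b' j) ->
  cau op a b m = cau op a' b' m.
Proof.
move=> ea eb; apply: eq_bigr => j _; rewrite ea ?eb //; first exact: leq_subr.
by rewrite -ltnS.
Qed.

Lemma cauDop A B (C : nmodType) (op op' : A -> B -> C) a b m :
  cau (fun x y => op x y + op' x y) a b m = cau op a b m + cau op' a b m.
Proof. by rewrite /cau big_split. Qed.

Lemma cau3C12 A B C (D : nmodType) (h : A -> B -> C -> D) a b c :
  cau3 h a b c =1 cau3 (fun y x z => h x y z) b a c.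
Proof.
move=> m; rewrite /cau3 exchange_big; apply: eq_bigr => j _; apply: eq_bigr => i _.
by apply: eq_bigl => k; rewrite (addnC i).
Qed.

Lemma cau3C23 A B C (D : nmodType) (h : A -> B -> C -> D) a b c :
  cau3 h a b c =1 cau3 (fun x z y => h x y z) a c b.
Proof.
move=> m; rewrite /cau3; apply: eq_bigr => i _; rewrite (exchange_big_dep xpredT) //=.
by apply: eq_bigr => k _; apply: eq_bigl => j; rewrite addnAC.
Qed.

Lemma eq_cau3 A B C (D : nmodType) (h h' : A -> B -> C -> D) a b c :
  (forall i j k, h (a i) (b j) (c k) = h' (a i) (b j) (c k)) ->
  cau3 h a b c =1 cau3 h' a b c.
Proof.
by move=> e m; do 3!apply: eq_bigr => ? _.
Qed.

Lemma cau_caul A B C (D E : zmodType) (g : D -> C -> E) (f : A -> B -> D) a b c :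
  (forall c, {morph g^~ c : x y / x + y}) ->
  cau g (cau f a b) c =1 cau3 (fun x y z => g (f x y) z) a b c.
Proof.
move=> gD m; rewrite (cauE _ _ _ (ltnSn m)) /cau3.
pose G (l : 'I_m.+1) (i j k : nat) : E :=
  if (i + j == l)%N && (l + k == m)%N then g (f (a i) (b j)) (c k) else 0.
transitivity (\sum_(l < m.+1) \sum_(k < m.+1) \sum_(i < m.+1) \sum_(j < m.+1) G l i j k).
  apply: eq_bigr => l _; rewrite big_mkcond; apply: eq_bigr => k _ /=.
  case: ifP => lk; last by rewrite big1 // => i _; rewrite big1 // => j _; rewrite /G lk andbF.
  rewrite (cauE _ _ _ (ltn_ord l)) (additive_sum (gD _)); apply: eq_bigr => i _.
  rewrite (additive_sum (gD _)) big_mkcond; apply: eq_bigr => j _.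
  by rewrite /G lk andbT.
rewrite exchange_big /= (eq_bigr (fun k : 'I_m.+1 => \sum_(i < m.+1) \sum_(j < m.+1)
  \sum_(l < m.+1) G l i j k)); last first.
  move=> k _; rewrite exchange_big; apply: eq_bigr => i _.
  by rewrite exchange_big.
rewrite exchange_big; apply: eq_bigr => i _; rewrite exchange_big; apply: eq_bigr => j _.
rewrite [RHS]big_mkcond; apply: eq_bigr => k _ /=; case: ifP => ijk.
  have lt : (i + j < m.+1)%N by lia.
  rewrite (bigD1 (Ordinal lt)) //= /G /= ijk eqxx big1 ?addr0 //= => l.
  by rewrite -val_eqE /= eq_sym => /negbTE ->.
by rewrite big1 // => l _; rewrite /G; case: ifP => //; lia.
Qed.

Lemma cau_caur A B C (D E : zmodType) (g : A -> D -> E) (f : B -> C -> D) a b c :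
  (forall a, {morph g a : x y / x + y}) ->
  cau g a (cau f b c) =1 cau3 (fun x y z => g x (f y z)) a b c.
Proof.
move=> gD m; rewrite cauC (@cau_caul _ _ _ _ _ (fun d a => g a d)) //.
by rewrite cau3C23 cau3C12.
Qed.

(** The interchange law for series: both sides flatten to a sum over four indices of total m, and
    only the two middle indices trade places. *)
Lemma cau_interchange (A B A' B' E : zmodType) (X X' Y Y' : Type)
  (g : A -> B -> E) (f : X -> Y -> A) (f' : X' -> Y' -> B)
  (g' : A' -> B' -> E) (k : X -> X' -> A') (k' : Y -> Y' -> B') a b c d :
  biadd g -> biadd g' ->
  (forall x y x' y', g (f x y) (f' x' y') = g' (k x x') (k' y y')) ->
  cau g (cau f a b) (cau f' c d) =1 cau g' (cau k a c) (cau k' b d).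
Proof.
move=> gD gD' e m; rewrite (cau_caul _ _ _ _ gD.1) (cau_caul _ _ _ _ gD'.1).
rewrite cau3C12 [RHS]cau3C12.
(* The flattening is stated for arbitrary operations because it is applied to both sides. *)
have L (A0 B0 E0 : zmodType) (X0 X1 Y0 Y1 : Type) (g0 : A0 -> B0 -> E0)
  (f0 : X0 -> Y0 -> A0) (f1 : X1 -> Y1 -> B0) a0 b0 c0 d0 : biadd g0 ->
  cau3 (fun (y : Y0) (x : X0) z => g0 (f0 x y) z) b0 a0 (cau f1 c0 d0) m =
  \sum_(i < m.+1) \sum_(j < m.+1) \sum_(r < m.+1) \sum_(s < m.+1 | (i + j + r + s == m)%N)
    g0 (f0 (a0 i) (b0 j)) (f1 (c0 r) (d0 s)).
  move=> g0D; rewrite /cau3 exchange_big; apply: eq_bigr => i _; apply: eq_bigr => j _.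
  have [le|lt] := leqP (i + j)%N m; last first.
    rewrite big_pred0 => [|q]; last by lia.
    by rewrite big1 // => r _; rewrite big_pred0 // => s; lia.
  rewrite (eq_bigl (fun q : 'I_m.+1 => (q == m - (i + j) :> nat)%N)); last by move=> q; lia.
  rewrite (@sum_nat_eq _ _ _ (fun q => g0 _ (cau f1 c0 d0 q))); last by lia.
  have lt : (m - (i + j) < m.+1)%N by lia.
  rewrite (cauE _ _ _ lt) (additive_sum (g0D.2 _)); apply: eq_bigr => r _.
  rewrite (additive_sum (g0D.2 _)); apply: eq_bigl => s; lia.
rewrite !L //.
apply: eq_bigr => i _; rewrite exchange_big; apply: eq_bigr => r _ /=.
apply: eq_bigr => j _; apply: eq_big => [s|s _]; last exact: e.
by lia.
Qed.
End Cauchy.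

Definition pderiv (A : zmodType) (a : nat -> A) (m : nat) : A := a m.+1 *+ m.+1.

Lemma cau_deriv (A B C : zmodType) (op : A -> B -> C) a b m : biadd op ->
  pderiv (cau op a b) m = cau op (pderiv a) b m + cau op a (pderiv b) m.
Proof.
move=> opD; rewrite /pderiv /cau -sumrMnl.
pose f (j : nat) := op (a j) (b (m.+1 - j)%N).
(* The factor m+1 is split as j + (m+1-j), one part for each factor of the product. *)
transitivity (\sum_(j < m.+2) f j *+ j + \sum_(j < m.+2) f j *+ (m.+1 - j)).
  rewrite -big_split; apply: eq_bigr => j _ /=.
  by rewrite -mulrnDr; congr (_ *+ _); have := ltn_ord j; lia.
congr (_ + _).
  rewrite big_ord_recl mulr0n add0r; apply: eq_bigr => j _.
  by rewrite (additiveMn (opD.1 _)) /f lift0 subSS.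
rewrite big_ord_recr /= subnn mulr0n addr0; apply: eq_bigr => j _.
by rewrite (additiveMn (opD.2 _)) /f /= subSn // -ltnS.
Qed.

(** * Linear differential equations with power series coefficients *)

Section ODE.
Variables (K : fieldType) (B : zmodType) (A : lmodType K) (op : B -> A -> A).
Variable P : nat -> B.
Hypothesis charK : [pchar K] =i pred0.

(** The action [op] stays arbitrary: it will be composition of maps, evaluation of a map at a
    vector, right multiplication [rcomp], and a commutator. *)
Definition ode (X : nat -> A) : Prop := forall m, pderiv X m = cau op P X m.

Lemma nat_succ_neq0 n : n.+1%:R != 0 :> K.
Proof. by move/pcharf0P: charK => ->. Qed.

Lemma mulrSn_inj n : injective (fun x : A => x *+ n.+1).
Proof.
move=> x y /=; rewrite -!(scaler_nat n.+1).
by move/(congr1 (fun z => (n.+1%:R)^-1 *: z)); rewrite !scalerA mulVf ?nat_succ_neq0 // !scale1r.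
Qed.

Lemma ode_exists x0 : exists2 X, X 0%N = x0 & ode X.
Proof.
pose G (a : nat -> A) m := if m is m'.+1 then (m'.+1%:R)^-1 *: cau op P a m' else x0.
pose s n := iter n G (fun=> 0).
(* The n-th iterate of [G] already has its final coefficients in orders below n, so the diagonal of
   the iterates is a fixed point. *)
have st n k m : (m < n)%N -> s (n + k)%N m = s n m.
  elim: n m => // n IH [|m] //= lt; congr (_ *: _).
  by apply: eq_cau => // j jm; apply: IH; lia.
exists (fun m => s m.+1 m) => // m; rewrite /pderiv -scaler_nat /=.
rewrite scalerA mulfV ?nat_succ_neq0 // scale1r.
apply: eq_cau => // j jm.
by have := st j.+1 (m - j)%N j (ltnSn j); rewrite addSn subnKC.
Qed.

Lemma ode_unique X Y : X 0%N = Y 0%N -> ode X -> ode Y -> X =1 Y.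
Proof.
move=> e hX hY; elim/ltn_ind => -[|m] IH //; apply: (@mulrSn_inj m).
rewrite -[LHS]/(pderiv X m) -[RHS]/(pderiv Y m) hX hY.
by apply: eq_cau => // j jm; apply: IH.
Qed.

(** Each coefficient after the first is a linear combination of terms P_j X_i with smaller i, so a
    linear condition stable under all P_j propagates from X_0. *)
Lemma ode_ind (C : A -> Prop) X :
  C 0 -> (forall a x y, C x -> C y -> C (a *: x + y)) ->
  (forall j x, C x -> C (op (P j) x)) ->
  C (X 0%N) -> ode X -> forall m, C (X m).
Proof.
move=> C0 Clin CP CX0 hX; elim/ltn_ind => -[|m] IH //.
have -> : X m.+1 = (m.+1%:R)^-1 *: cau op P X m.
  by rewrite -hX /pderiv -scaler_nat scalerA mulVf ?nat_succ_neq0 // scale1r.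
rewrite -[_ *: _]addr0; apply: (Clin) => //; rewrite /cau.
apply: big_ind => // [x y Cx Cy|j _]; first by rewrite -[x]scale1r; apply: Clin.
by apply: (CP); apply: IH; lia.
Qed.
End ODE.

(** * Series in filtered modules *)

Record filtration (A : zmodType) (f : int -> A -> Prop) : Prop := {
  filt0 : forall k, f k 0;
  filtB : forall k x y, f k x -> f k y -> f k (x - y);
  filt_le : forall k l x, l <= k -> f k x -> f l x
}.

Section Filtration.
Variables (A : zmodType) (f : int -> A -> Prop).
Hypothesis ff : filtration f.

Lemma filtN k x : f k x -> f k (- x).
Proof. by move=> h; rewrite -[- x]add0r; apply: filtB => //; exact: filt0. Qed.
Lemma filtD k x y : f k x -> f k y -> f k (x + y).
Proof. by move=> hx hy; rewrite -[y]opprK; apply: filtB => //; exact: filtN. Qed.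
Lemma filt_sum k I (r : seq I) (P : pred I) F :
  (forall i, P i -> f k (F i)) -> f k (\sum_(i <- r | P i) F i).
Proof. by move=> h; apply: big_ind => //; [exact: filt0 | exact: filtD]. Qed.

(** Natural k suffice because the filtration is descending; they allow induction on k. *)
Definition tends0 (u : nat -> A) : Prop :=
  forall k : nat, exists N, forall n, (N <= n)%N -> f k (u n).

(** The bound by filtration degree 0 is what makes Cauchy products of null sequences null again. *)
Definition nulls (u : nat -> A) : Prop := (forall n, f 0 (u n)) /\ tends0 u.

Lemma tends0D u v : tends0 u -> tends0 v -> tends0 (fun n => u n + v n).
Proof.
move=> hu hv k; have [M hM] := hu k; have [N hN] := hv k.
exists (maxn M N) => n; rewrite geq_max => /andP[h1 h2].
by apply: filtD; [apply: hM | apply: hN].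
Qed.
Lemma tends0N u : tends0 u -> tends0 (fun n => - u n).
Proof. by move=> hu k; have [M hM] := hu k; exists M => n /hM /filtN. Qed.
Lemma tends0B u v : tends0 u -> tends0 v -> tends0 (fun n => u n - v n).
Proof. by move=> hu hv; apply: tends0D => //; apply: tends0N. Qed.
Lemma eq_tends0 u v : u =1 v -> tends0 u -> tends0 v.
Proof. by move=> e hu k; have [M hM] := hu k; exists M => n /hM; rewrite e. Qed.

Definition psum (u : nat -> A) (n : nat) : A := \sum_(j < n) u j.

Lemma psum_fil k u n : (forall j, f k (u j)) -> f k (psum u n).
Proof. by move=> h; apply: filt_sum. Qed.

(** As for an ultrametric, a sum of small terms is small, so null terms suffice. *)
Lemma psum_cauchy u : tends0 u -> forall k : nat, exists N, forall m n,
  (N <= m)%N -> (N <= n)%N -> f k (psum u m - psum u n).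
Proof.
move=> hu k; have [N hN] := hu k; exists N => m n.
have h p q : (N <= p)%N -> (p <= q)%N -> f k (psum u q - psum u p).
  move=> Np pq; rewrite /psum -!(big_mkord xpredT u).
  rewrite (big_cat_nat (leq0n p) pq) /= [X in f k X]addrC addKr big_nat.
  by apply: filt_sum => j /andP[pj _]; apply: hN; lia.
have [mn|/ltnW nm] := leqP m n => Nm Nn; last exact: h.
by rewrite -opprB; apply: filtN; apply: h.
Qed.
End Filtration.

Section FiltrationOp.
Variables (A B C : zmodType) (fA : int -> A -> Prop) (fB : int -> B -> Prop).
Variables (fC : int -> C -> Prop) (op : A -> B -> C).
Hypotheses (ffA : filtration fA) (ffB : filtration fB) (ffC : filtration fC).
Hypothesis opD : biadd op.
Hypothesis opf : forall k l a b, fA k a -> fB l b -> fC (k + l) (op a b).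

Lemma opf0l k a b : fA 0 a -> fB k b -> fC k (op a b).
Proof. by move=> ha hb; rewrite -[k]add0r; apply: (opf). Qed.
Lemma opf0r k a b : fA k a -> fB 0 b -> fC k (op a b).
Proof. by move=> ha hb; rewrite -[k]addr0; apply: (opf). Qed.

Lemma nulls_cau a b : nulls fA a -> nulls fB b -> nulls fC (cau op a b).
Proof.
move=> [a0 ha] [b0 hb]; split=> [n|k].
  by apply: filt_sum => // j _; apply: opf0l.
have [M hM] := ha k; have [N hN] := hb k; exists (M + N)%N => n le.
apply: filt_sum => // j _; have [Mj|jM] := leqP M j.
  by apply: opf0r => //; apply: hM.
by apply: opf0l => //; apply: hN; lia.
Qed.

(** The comparison sequences may vary with n: exp(pi) is not an element of Sym, so values at t = 1
    are compared with truncations that grow with n. *)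
Lemma psum_cau a b (al : nat -> A) (be : nat -> B) :
  nulls fA a -> nulls fB b -> (forall n, fA 0 (al n)) ->
  tends0 fA (fun n => psum a n - al n) -> tends0 fB (fun n => psum b n - be n) ->
  tends0 fC (fun n => psum (cau op a b) n - op (al n) (be n)).
Proof.
move=> [a0 ha] [b0 hb] al0 hal hbe.
(* The difference consists of the terms with i, j < n and i + j >= n, in which one of the two
   indices is large. *)
have h1 : tends0 fC (fun n => psum (cau op a b) n - op (psum a n) (psum b n)).
  move=> k; have [M hM] := ha k; have [N hN] := hb k; exists (M + N)%N => n le.
  rewrite /psum (eq_bigr (fun m : 'I_n => \sum_(i < n) \sum_(j < n | (i + j == m)%N)
      op (a i) (b j))); last by move=> m _; exact/cauE/ltn_ord.
  rewrite exchange_big (biadd_suml opD) -sumrB; apply: filt_sum => // i _.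
  rewrite (biadd_sumr opD).
  rewrite (eq_bigr (fun m : 'I_n => \sum_(j < n) if (i + j == m)%N then op (a i) (b j) else 0));
    last by move=> m _; rewrite big_mkcond.
  rewrite exchange_big -sumrB; apply: filt_sum => // j _.
  rewrite -big_mkcond /=; have [lt|ge] := ltnP (i + j)%N n.
    rewrite (eq_bigl (fun m : 'I_n => (m == (i + j)%N :> nat)%N)) => [|m]; last exact: eq_sym.
    by rewrite (@sum_nat_eq _ _ _ (fun=> op (a i) (b j))) // subrr; apply: filt0.
  rewrite big_pred0 => [|m]; last by have := ltn_ord m; lia.
  rewrite sub0r; apply: filtN => //; have [Mi|iM] := leqP M i.
    by apply: opf0r => //; apply: hM.
  by apply: opf0l => //; apply: hN; lia.
have h2 : tends0 fC (fun n => op (psum a n - al n) (psum b n)).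
  move=> k; have [N hN] := hal k; exists N => n le.
  by apply: opf0r; [exact: hN | apply: psum_fil].
have h3 : tends0 fC (fun n => op (al n) (psum b n - be n)).
  by move=> k; have [N hN] := hbe k; exists N => n le; apply: opf0l; [|exact: hN].
apply: eq_tends0 (tends0D ffC h1 (tends0D ffC h2 h3)) => n.
by rewrite (biaddBl opD) (biaddBr opD) !addrA !subrK.
Qed.
End FiltrationOp.

Section ODEFiltration.
Variables (K : fieldType) (B : zmodType) (A : lmodType K) (op : B -> A -> A).
Variable P : nat -> B.
Variables (fA : int -> A -> Prop) (fB : int -> B -> Prop).
Hypothesis charK : [pchar K] =i pred0.
Hypotheses (ffA : filtration fA) (fAZ : forall k c x, fA k x -> fA k (c *: x)).
Hypothesis opf : forall k l p a, fB k p -> fA l a -> fA (k + l) (op p a).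
Hypotheses (P1 : forall j, fB 1 (P j)) (Pnull : tends0 fB P).

Lemma ode_filS X k l m : ode op P X ->
  (forall j, (j <= m)%N -> fA l (op (P j) (X (m - j)%N)))  -> k = l -> fA k (X m.+1).
Proof.
move=> hX h ->.
have -> : X m.+1 = (m.+1%:R)^-1 *: cau op P X m.
  by rewrite -hX /pderiv -scaler_nat scalerA mulVf ?(nat_succ_neq0 charK) // scale1r.
by apply: fAZ; apply: filt_sum => // j _; apply: h; rewrite -ltnS.
Qed.

(** The basic estimate. If X_i lies in filtration k for i >= M and P_j in filtration k+1 for j >= J,
    then for m >= M+J each P_j X_{m-j} lies in filtration k+1: either j >= J, or m-j >= M and P_j
    contributes the missing 1. *)
Lemma ode_fil X : fA 0 (X 0%N) -> ode op P X ->
  nulls fA X /\ forall m, fA 1 (X m.+1).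
Proof.
move=> X0 hX.
have Xf m : fA 0 (X m).
  elim/ltn_ind: m => -[|m] IH //; apply: (ode_filS hX (l := 0)) => // j jm.
  apply: (filt_le ffA (k := 1)) => //; rewrite -[1]addr0.
  by apply: (opf) => //; apply: IH; lia.
split; last first.
  move=> m; apply: (ode_filS hX (l := 1)) => // j jm; rewrite -[1]addr0.
  exact: (opf).
split=> // k; elim: k => [|k [M hM]]; first by exists 0%N => n _; apply: Xf.
have [J hJ] := Pnull k.+1; exists (M + J).+1 => -[//|m]; rewrite ltnS => le.
apply: (ode_filS hX (l := k.+1%:Z)) => // j jm.
have [Jj|jJ] := leqP J j.
  by rewrite -[k.+1%:Z]addr0; apply: (opf) => //; apply: hJ.
by rewrite intS; apply: (opf) => //; apply: hM; lia.
Qed.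
End ODEFiltration.

(** * Spaces of linear maps *)

(** Linear maps are bundled so that they form a vector space and can serve as coefficients of power
    series. *)
Record lhom (K : fieldType) (U V : lmodType K) :=
  LHom {hom_fun :> U -> V; hom_linear : linear hom_fun}.

HB.instance Definition _ (K : fieldType) (U V : lmodType K) := gen_eqMixin (lhom U V).
HB.instance Definition _ (K : fieldType) (U V : lmodType K) := gen_choiceMixin (lhom U V).
HB.instance Definition _ (K : fieldType) (U V : lmodType K) (f : lhom U V) :=
  GRing.isLinear.Build K U V _ (hom_fun f) (hom_linear f).

Section LinearMaps.
Variables (K : fieldType) (U V : lmodType K).
Implicit Types f g : lhom U V.

Lemma hom_ext f g : f =1 g -> f = g.
Proof.
case: f g => [f fl] [g gl] /= /funext e; case: _ / e gl => gl.
by rewrite (Prop_irrelevance fl gl).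
Qed.

Fact hom0_linear : linear (fun _ : U => 0 : V).
Proof. by move=> a x y; rewrite scaler0 addr0. Qed.
Fact homD_linear f g : linear (fun x => f x + g x).
Proof. by move=> a x y; rewrite !linearP scalerDr addrACA. Qed.
Fact homN_linear f : linear (fun x => - f x).
Proof. by move=> a x y; rewrite linearP opprD scalerN. Qed.
Fact homZ_linear c f : linear (fun x => c *: f x).
Proof. by move=> a x y; rewrite linearP scalerDr !scalerA mulrC. Qed.

Definition hom0 := LHom hom0_linear.
Definition homD f g := LHom (homD_linear f g).
Definition homN f := LHom (homN_linear f).
Definition homZ c f := LHom (homZ_linear c f).

Fact homDA : associative homD.
Proof. by move=> f g h; apply: hom_ext => x /=; rewrite addrA. Qed.
Fact homDC : commutative homD.
Proof. by move=> f g; apply: hom_ext => x /=; rewrite addrC. Qed.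
Fact hom0D : left_id hom0 homD.
Proof. by move=> f; apply: hom_ext => x /=; rewrite add0r. Qed.
Fact homND : left_inverse hom0 homN homD.
Proof. by move=> f; apply: hom_ext => x /=; rewrite addNr. Qed.
HB.instance Definition _ := GRing.isZmodule.Build (lhom U V) homDA homDC hom0D homND.

Fact homZA a b f : homZ a (homZ b f) = homZ (a * b) f.
Proof. by apply: hom_ext => x /=; rewrite scalerA. Qed.
Fact homZ1 : left_id 1 homZ.
Proof. by move=> f; apply: hom_ext => x /=; rewrite scale1r. Qed.
Fact homZDr : right_distributive homZ +%R.
Proof. by move=> a f g; apply: hom_ext => x /=; rewrite scalerDr. Qed.
Fact homZDl f : {morph homZ^~ f : a b / a + b}.
Proof. by move=> a b; apply: hom_ext => x /=; rewrite scalerDl. Qed.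
HB.instance Definition _ :=
  GRing.Zmodule_isLmodule.Build K (lhom U V) homZA homZ1 homZDr homZDl.

Lemma hom_evalD x : {morph (fun f => f x) : f g / f + g}. Proof. by []. Qed.
Lemma homNE f x : (- f) x = - f x. Proof. by []. Qed.
Lemma homBE f g x : (f - g) x = f x - g x. Proof. by []. Qed.
Lemma homZE c f x : (c *: f) x = c *: f x. Proof. by []. Qed.
Lemma hom_sumE I (r : seq I) (P : pred I) (F : I -> lhom U V) x :
  (\sum_(i <- r | P i) F i) x = \sum_(i <- r | P i) F i x.
Proof. exact: (additive_sum (hom_evalD x)). Qed.
Lemma homMnE f n x : (f *+ n) x = f x *+ n.
Proof. exact: (additiveMn (hom_evalD x)). Qed.

Lemma hom_add f : {morph f : x y / x + y}. Proof. by move=> x y; rewrite linearD. Qed.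
Lemma hom_scale f c x : f (c *: x) = c *: f x. Proof. by rewrite linearZ. Qed.
Lemma hom_zero f : f 0 = 0. Proof. by rewrite linear0. Qed.
Lemma hom_sub f x y : f (x - y) = f x - f y. Proof. by rewrite linearB. Qed.
Lemma hom_sum f I (r : seq I) (P : pred I) (F : I -> U) :
  f (\sum_(i <- r | P i) F i) = \sum_(i <- r | P i) f (F i).
Proof. exact: (additive_sum (hom_add f)). Qed.
End LinearMaps.

Definition hid (K : fieldType) (U : lmodType K) : lhom U U :=
  LHom (fun a x y => erefl : id (a *: x + y) = a *: id x + id y).

Section Comp.
Variable K : fieldType.
Implicit Types U V W : lmodType K.

Definition hcomp U V W (f : lhom V W) (g : lhom U V) : lhom U W :=
  LHom (lin_comp (hom_linear f) (hom_linear g)).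
Local Notation "f ** g" := (hcomp f g) (at level 40, left associativity).

Lemma hcompE U V W (f : lhom V W) (g : lhom U V) x : (f ** g) x = f (g x).
Proof. by []. Qed.
Lemma hcompA U V W X (f : lhom W X) (g : lhom V W) (h : lhom U V) :
  f ** (g ** h) = f ** g ** h.
Proof. exact: hom_ext. Qed.
Lemma hcomp1l U V (f : lhom U V) : hid V ** f = f.
Proof. exact: hom_ext. Qed.
Lemma hcomp1r U V (f : lhom U V) : f ** hid U = f.
Proof. exact: hom_ext. Qed.

Lemma biadd_hcomp U V W : biadd (@hcomp U V W).
Proof. by split=> f g h; apply: hom_ext => x //=; rewrite hom_add. Qed.

Lemma hcompZl U V W c (f : lhom V W) (g : lhom U V) : (c *: f) ** g = c *: (f ** g).
Proof. exact: hom_ext. Qed.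
Lemma hcompZr U V W c (f : lhom V W) (g : lhom U V) : f ** (c *: g) = c *: (f ** g).
Proof. by apply: hom_ext => x /=; rewrite hom_scale. Qed.

Definition htens U V U' V' (f : lhom U U') (g : lhom V V') :
  lhom (tensor U V) (tensor U' V') :=
  locked (LHom (tmap_linear (hom_linear f) (hom_linear g))).

Lemma htens_tmap U V U' V' (f : lhom U U') (g : lhom V V') x :
  htens f g x = tmap f g x.
Proof. by rewrite /htens -lock. Qed.

Lemma htensE U V U' V' (f : lhom U U') (g : lhom V V') a b :
  htens f g (tens a b) = tens (f a) (g b).
Proof. by rewrite htens_tmap (tmap_tens (hom_linear f) (hom_linear g)). Qed.

Lemma tens_ext U V W (f g : lhom (tensor U V) W) :
  (forall a b, f (tens a b) = g (tens a b)) -> f = g.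
Proof.
move=> e; apply: hom_ext; apply: gen_ext; try exact: hom_linear.
by case=> a b; exact: e.
Qed.

Lemma htens_comp U V U' V' U2 V2 (f : lhom U' U2) (g : lhom V' V2) (f' : lhom U U')
  (g' : lhom V V') : htens f g ** htens f' g' = htens (f ** f') (g ** g').
Proof. by apply: tens_ext => a b /=; rewrite !htensE. Qed.

Lemma htens1 U V : htens (hid U) (hid V) = hid _.
Proof. by apply: tens_ext => a b; rewrite htensE. Qed.

Lemma biadd_htens U V U' V' : biadd (@htens U V U' V').
Proof.
split=> f g h; apply: tens_ext => a b; rewrite !(htensE, hom_evalD).
- exact: (linD (tens_linearl _)).
- exact: (linD (tens_linearr _)).
Qed.

Lemma biadd_tens U V : biadd (@tens K U V).
Proof.
by split=> [b|a] x y; [exact: (linD (tens_linearl b)) | exact: (linD (tens_linearr a))].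
Qed.
End Comp.

Notation "f ** g" := (hcomp f g) (at level 40, left associativity) : hom_scope.
Open Scope hom_scope.

Section LspanTheory.
Variables (K : fieldType).

Lemma lspan_sum (M : lmodType K) (A : set M) I (r : seq I) (P : pred I) (F : I -> M) :
  (forall i, P i -> lspan A (F i)) -> lspan A (\sum_(i <- r | P i) F i).
Proof. by move=> h; apply: big_ind => //; [exact: lspan0 | exact: lspanD]. Qed.

Lemma lspanB (M : lmodType K) (A : set M) x y :
  lspan A x -> lspan A y -> lspan A (x - y).
Proof. by move=> hx hy; rewrite -[- y]scaleN1r; apply: lspanD => //; apply: lspanZ. Qed.

Lemma lspan_hom (M N : lmodType K) (A : set M) (B : set N) (f : lhom M N) x :
  (forall y, A y -> lspan B (f y)) -> lspan A x -> lspan B (f x).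
Proof.
move=> h; elim=> [|y /h//|y z _ hy _ hz|a y _ hy].
- by rewrite hom_zero; apply: lspan0.
- by rewrite hom_add; apply: lspanD.
- by rewrite hom_scale; apply: lspanZ.
Qed.
End LspanTheory.

(** * Unshuffles *)

Section Unshuffle.
Variables (K : fieldType) (V : fgspace K).
Implicit Types (u v w : word V).
Local Notation sg := (ksgn K).

(** The unshuffle sum behind [wcop], by recursion on the first letter instead of bit masks, so that
    coproduct identities go by induction. The sign is that of moving the letter past [u] into the
    right-hand word. *)
Fixpoint unsh (W : lmodType K) w (h : word V -> word V -> W) : W :=
  if w is a :: w' then
    unsh w' (fun u v => h (a :: u) v) +
    unsh w' (fun u v => sg (tag a) (wdeg u) *: h u (a :: v))
  else h [::] [::].

(** Records which pairs occur in [unsh], so that size, degree and filtration of the two parts can be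
    controlled term by term. *)
Inductive shuf : word V -> word V -> word V -> Prop :=
| shuf_nil : shuf [::] [::] [::]
| shufl a w u v : shuf w u v -> shuf (a :: w) (a :: u) v
| shufr a w u v : shuf w u v -> shuf (a :: w) u (a :: v).

Lemma shuf_size w u v : shuf w u v -> (size u + size v = size w)%N.
Proof. by elim=> //= a w' u' v' _ e; rewrite -e ?addnS. Qed.

Lemma shuf_deg w u v : shuf w u v -> wdeg u + wdeg v = wdeg w.
Proof.
elim=> [|a w' u' v' _ e|a w' u' v' _ e]; first by rewrite /wdeg big_nil addr0.
- by rewrite !wdeg_cons -e addrA.
- by rewrite !wdeg_cons -e addrCA.
Qed.

Lemma wfil_le k l w : l <= k -> wfil k w -> wfil l w.
Proof.
elim: w k l => [|a w IH] k l /= le; first exact: le_trans.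
by case=> j [fj h]; exists j; split=> //; apply: IH h; rewrite lerB.
Qed.

Lemma shuf_fil k w u v : shuf w u v -> wfil k w ->
  exists i j, [/\ i + j = k, wfil i u & wfil j v].
Proof.
move=> s; elim: s k => [|a w' u' v' _ IH|a w' u' v' _ IH] k /=.
- by move=> k0; exists k, 0; split; rewrite ?addr0.
- case=> l [fl /IH[i [j [e hi hj]]]]; exists (l + i), j; split=> //.
    by rewrite -addrA e addrC subrK.
  by exists l; split=> //; rewrite addrAC subrr add0r.
- case=> l [fl /IH[i [j [e hi hj]]]]; exists i, (l + j); split=> //.
    by rewrite addrCA e addrC subrK.
  by exists l; split=> //; rewrite addrAC subrr add0r.
Qed.

Lemma eq_unsh (W : lmodType K) w (h h' : word V -> word V -> W) : (forall u v, shuf w u v -> h u v = h' u v) ->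
  unsh w h = unsh w h'.
Proof.
elim: w h h' => [|a w IH] h h' e /=; first by apply: e; exact: shuf_nil.
congr (_ + _); apply: IH => u v s; first by apply/e/shufl.
by rewrite e //; apply: shufr.
Qed.

Section UnshTheory.
Variable W : lmodType K.
Implicit Types h : word V -> word V -> W.

Lemma unsh_map (W' : lmodType K) (f : lhom W W') w h :
  f (unsh w h) = unsh w (fun u v => f (h u v)).
Proof.
elim: w h => [|a w IH] h //=; rewrite hom_add !IH; congr (_ + _).
by apply: eq_unsh => u v _; rewrite hom_scale.
Qed.

Lemma unshD w h h' : unsh w (fun u v => h u v + h' u v) = unsh w h + unsh w h'.
Proof.
elim: w h h' => [|a w IH] h h' //=; rewrite IH.
rewrite [X in _ + X = _](@eq_unsh W w _ (fun u v => sg (tag a) (wdeg u) *: h u (a :: v) +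
  sg (tag a) (wdeg u) *: h' u (a :: v))) => [|u v _]; last by rewrite scalerDr.
by rewrite IH addrACA.
Qed.

Lemma unshZ w c h : unsh w (fun u v => c *: h u v) = c *: unsh w h.
Proof.
elim: w h => [|a w IH] h //=; rewrite IH scalerDr; congr (_ + _); rewrite -IH.
by apply: eq_unsh => u v _; rewrite !scalerA mulrC.
Qed.

Lemma unsh_ind (C : W -> Prop) w h :
  (forall x y, C x -> C y -> C (x + y)) -> (forall a x, C x -> C (a *: x)) ->
  (forall u v, shuf w u v -> C (h u v)) -> C (unsh w h).
Proof.
move=> CD CZ; elim: w h => [|a w IH] h e /=; first by apply: e; exact: shuf_nil.
apply: (CD); apply: IH => u v s; first by apply/e/shufl.
by apply/(CZ)/e/shufr.
Qed.

Lemma unsh0 w h : (forall u v, shuf w u v -> h u v = 0) -> unsh w h = 0.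
Proof.
by move=> e; apply: (unsh_ind (C := fun x => x = 0)) => // [x y -> ->|a x ->];
  rewrite ?addr0 ?scaler0.
Qed.

Lemma ksgnDl i j k : sg (i + j) k = sg i k * sg j k.
Proof. by rewrite ksgnC ksgnDr ksgnC (ksgnC _ k j). Qed.
Lemma ksgn0r i : sg i 0 = 1. Proof. by rewrite /ksgn mulr0. Qed.
Lemma ksgn0l i : sg 0 i = 1. Proof. by rewrite /ksgn mul0r. Qed.
Lemma wdeg0 : wdeg ([::] : word V) = 0. Proof. by rewrite /wdeg big_nil. Qed.

Lemma unsh_counitl w h : (forall u v, u != [::] -> h u v = 0) -> unsh w h = h [::] w.
Proof.
elim: w h => [|a w IH] h h0 //=; rewrite (@unsh0 w) ?add0r; last first.
  by move=> u v _; rewrite h0.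
rewrite IH ?wdeg0 ?ksgn0r ?scale1r // => u v u0.
by rewrite h0 ?scaler0.
Qed.

Lemma unsh_counitr w h : (forall u v, v != [::] -> h u v = 0) -> unsh w h = h w [::].
Proof.
elim: w h => [|a w IH] h h0 //=; rewrite (@unsh0 w (fun u v => _ *: _)) ?addr0; last first.
  by move=> u v _; rewrite h0 ?scaler0.
by rewrite IH // => u v u0; rewrite h0.
Qed.

Lemma unsh3_cons a w (h : word V -> word V -> word V -> W) :
  unsh (a :: w) (fun u v => unsh v (h u)) =
  unsh w (fun u v => unsh v (h (a :: u))) +
  unsh w (fun u v => unsh v (fun u' v' => sg (tag a) (wdeg u) *: h u (a :: u') v')) +
  unsh w (fun u v => unsh v (fun u' v' =>
    (sg (tag a) (wdeg u) * sg (tag a) (wdeg u')) *: h u u' (a :: v'))).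
Proof.
rewrite /= -addrA; congr (_ + _); rewrite -unshD; apply: eq_unsh => u v _.
rewrite scalerDr -!unshZ; congr (_ + _); apply: eq_unsh => u' v' _.
by rewrite scalerA.
Qed.

Lemma unsh_swap w (h : word V -> word V -> word V -> W) :
  unsh w (fun u v => unsh v (h u)) =
  unsh w (fun u v => unsh v (fun u' v' => sg (wdeg u) (wdeg u') *: h u' u v')).
Proof.
elim: w h => [|a w IH] h; first by rewrite /= wdeg0 ksgn0r scale1r.
rewrite !unsh3_cons (IH (fun u => h (a :: u))).
rewrite (IH (fun u u' v' => sg (tag a) (wdeg u) *: h u (a :: u') v')).
rewrite (IH (fun u u' v' => (sg (tag a) (wdeg u) * sg (tag a) (wdeg u')) *: _)).
rewrite [X in X + _ = _]addrC.
congr (_ + _ + _); apply: eq_unsh => u v _; apply: eq_unsh => u' v' _;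
  rewrite ?wdeg_cons !scalerA; congr (_ *: _).
- by rewrite ksgnDl mulrC.
- by rewrite ksgnDr (ksgnC _ (wdeg u) (tag a)) mulrA ksgnK mul1r.
- by rewrite mulrC (mulrC (sg (tag a) (wdeg u'))).
Qed.
End UnshTheory.
End Unshuffle.

(** * Linear maps between symmetric coalgebras *)

Section SymHom.
Variables (K : fieldType) (V : fgspace K).
Local Notation S := (Sym V).
Implicit Types (u v w : word V) (x y z : S).

Definition hmul x : lhom S S := locked (LHom (vee_linearr x)).
Definition hspr n : lhom S S := LHom (@spr_linear K V n).
Definition hsgn p : lhom S S := LHom (@sgnop_linear K V p).
Definition hcop : lhom S (tensor S S) := LHom (@cop_linear K V).
Definition hsmul : lhom (tensor S S) S := LHom (@smul_linear K V).

Lemma hmulE x y : hmul x y = vee x y. Proof. by rewrite /hmul -lock. Qed.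

Lemma mon_ext (W : lmodType K) (f g : lhom S W) :
  (forall w, f (mon w) = g (mon w)) -> f = g.
Proof. by move=> e; apply/hom_ext/sym_ext => //; exact: hom_linear. Qed.

Lemma mon_ind (P : S -> Prop) : P 0 -> (forall a w y, P y -> P (a *: mon w + y)) ->
  forall x, P x.
Proof. exact: gen_ind. Qed.

Lemma biadd_vee : biadd (@vee K V).
Proof.
by split=> [b|a] x y; [exact: (linD (vee_linearl b)) | exact: (linD (vee_linearr a))].
Qed.
Lemma veeZl c x y : vee (c *: x) y = c *: vee x y.
Proof. exact: (linZ (vee_linearl y)). Qed.
Lemma veeZr c x y : vee x (c *: y) = c *: vee x y.
Proof. exact: (linZ (vee_linearr x)). Qed.
Lemma vee0l y : vee 0 y = 0. Proof. exact: (biadd0l biadd_vee). Qed.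
Lemma vee0r x : vee x 0 = 0. Proof. exact: (biadd0r biadd_vee). Qed.
Lemma veeDl x y z : vee (x + y) z = vee x z + vee y z.
Proof. exact: biadd_vee.1. Qed.
Lemma veeDr x y z : vee x (y + z) = vee x y + vee x z.
Proof. exact: biadd_vee.2. Qed.

Lemma vee_ext (W : lmodType K) (f g : S -> S -> W) :
  (forall y, linear (f^~ y)) -> (forall x, linear (f x)) ->
  (forall y, linear (g^~ y)) -> (forall x, linear (g x)) ->
  (forall u w, f (mon u) (mon w) = g (mon u) (mon w)) -> f =2 g.
Proof.
move=> fl fr gl gr e x y; move: x; apply: sym_ext => // u.
by move: y; apply: sym_ext.
Qed.

Lemma veeA : associative (@vee K V).
Proof.
move=> x y z; have h : forall u v, vee x (vee (mon u) (mon v)) = vee (vee x (mon u)) (mon v).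
  move=> u v; rewrite vee_mon; move: x; apply: sym_ext => [||w].
  - exact: vee_linearl.
  - exact: (lin_comp (vee_linearl (mon v)) (vee_linearl (mon u))).
  - by rewrite !vee_mon catA.
apply: (vee_ext (f := fun y z => vee x (vee y z)) (g := fun y z => vee (vee x y) z)) => //.
- by move=> t; exact: (lin_comp (vee_linearr x) (vee_linearl t)).
- by move=> t; exact: (lin_comp (vee_linearr x) (vee_linearr t)).
- by move=> t; exact: (lin_comp (vee_linearl t) (vee_linearr x)).
- by move=> t; exact: vee_linearr.
Qed.

Lemma vee1l x : vee (sone V) x = x.
Proof. by move: x; apply: sym_ext => [||w]; [exact: vee_linearr| |rewrite vee_mon]. Qed.
Lemma vee1r x : vee x (sone V) = x.
Proof. by move: x; apply: sym_ext => [||w]; [exact: vee_linearl| |rewrite vee_mon cats0]. Qed.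

Lemma hmul_vee x y : hmul (vee x y) = hmul x ** hmul y.
Proof. by apply: hom_ext => z /=; rewrite !hmulE veeA. Qed.
Lemma hmul_one : hmul (sone V) = hid _.
Proof. by apply: hom_ext => z /=; rewrite !hmulE vee1l. Qed.
Lemma hmulD : {morph hmul : x y / x + y}.
Proof. by move=> x y; apply: hom_ext => z; rewrite hom_evalD !hmulE veeDl. Qed.

(** ** Degree *)

Lemma sdeg_mon w : sdeg (wdeg w) (mon w).
Proof. by apply: lspan_gen; exists w. Qed.

Lemma sdeg_ind i (P : S -> Prop) : P 0 ->
  (forall a w y, wdeg w = i -> P y -> P (a *: mon w + y)) -> forall x, sdeg i x -> P x.
Proof.
move=> P0 PD x hx.
suff : forall a y, P y -> P (a *: x + y) by move=> /(_ 1 0 P0); rewrite scale1r addr0.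
elim: hx => [|_ [w /= e <-]|x1 x2 _ IH1 _ IH2|b x1 _ IH] a y Py.
- by rewrite scaler0 add0r.
- exact: PD.
- by rewrite scalerDr -addrA; apply: IH1; apply: IH2.
- by rewrite scalerA; apply: IH.
Qed.

Lemma vee_sdeg i j x y : sdeg i x -> sdeg j y -> sdeg (i + j) (vee x y).
Proof.
move=> hx hy; move: x hx; apply: sdeg_ind => [|a u x <- hx].
  by rewrite vee0l; apply: lspan0.
rewrite veeDl veeZl; apply: lspanD => //; apply: lspanZ.
move: y hy {hx}; apply: sdeg_ind => [|b v y <- hy].
  by rewrite vee0r; apply: lspan0.
rewrite veeDr veeZr; apply: lspanD => //; apply: lspanZ.
by rewrite vee_mon -wdeg_cat; apply: sdeg_mon.
Qed.

Lemma mon_consC a w : mon (rcons w a) = ksgn K (wdeg w) (tag a) *: mon (a :: w).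
Proof.
elim: w a => [|b w IH] a; first by rewrite wdeg0 ksgn0l scale1r.
rewrite rcons_cons -cat1s -vee_mon IH veeZr vee_mon /= (mon_comm [::]) scalerA /=.
by rewrite wdeg_cons ksgnDl mulrC.
Qed.

Lemma mon_catC u w : mon (u ++ w) = ksgn K (wdeg u) (wdeg w) *: mon (w ++ u).
Proof.
elim: w u => [|a w IH] u; first by rewrite cats0 wdeg0 ksgn0r scale1r.
rewrite -cat_rcons -vee_mon mon_consC veeZl vee_mon /= -cat1s -vee_mon IH veeZr vee_mon.
by rewrite scalerA wdeg_cons ksgnDr.
Qed.

Lemma veeC i j x y : sdeg i x -> sdeg j y -> vee x y = ksgn K i j *: vee y x.
Proof.
move=> hx hy; move: x hx; apply: sdeg_ind => [|a u x <- hx].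
  by rewrite vee0l vee0r scaler0.
rewrite veeDl veeDr veeZl veeZr hx scalerDr; congr (_ + _) => {hx}.
rewrite scalerA mulrC -scalerA; congr (_ *: _).
move: y hy; apply: sdeg_ind => [|b v y <- hy].
  by rewrite vee0l vee0r scaler0.
rewrite veeDl veeDr veeZl veeZr hy scalerDr; congr (_ + _) => {hy}.
by rewrite scalerA mulrC -scalerA !vee_mon mon_catC.
Qed.

Lemma sgnop_sdeg p i x : sdeg i x -> sgnop p x = ksgn K p i *: x.
Proof.
move: x; apply: sdeg_ind => [|a u x <- hx].
  by rewrite scaler0 (lin0 (@sgnop_linear K V p)).
by rewrite (sgnop_linear p) hx sgnop_mon scalerDr !scalerA mulrC.
Qed.

(** ** Homogeneous components *)

Lemma spr_zero n : spr n (0 : S) = 0. Proof. exact: (lin0 (@spr_linear K V n)). Qed.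

Lemma sprsone n : spr n (sone V) = if n == 0%N then sone V else 0.
Proof. by rewrite spr_mon eq_sym. Qed.

Lemma spr_spr m n x : spr m (spr n x) = if m == n then spr n x else 0.
Proof.
move: x; apply: sym_ext => [||w].
- exact: (lin_comp (@spr_linear K V m) (@spr_linear K V n)).
- case: (m == n); [exact: spr_linear | exact: hom0_linear].
- rewrite spr_mon; case: eqP => [<-|ne]; last first.
    by rewrite (lin0 (@spr_linear K V m)); case: ifP.
  by rewrite spr_mon eq_sym.
Qed.

(** The claim is made for all large N so that two elements can be given a common bound. *)
Lemma spr_sum x : exists n, forall N, (n <= N)%N ->
  x = \sum_(k < N) spr k x /\ forall k, (N <= k)%N -> spr k x = 0.
Proof.
move: x; apply: mon_ind => [|a w y [n hn]].
  exists 0%N => N _; split=> [|k _]; last exact: spr_zero.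
  by rewrite big1 // => k _; exact: spr_zero.
exists (maxn n (size w).+1) => N; rewrite geq_max => /andP[/hn[hN hN'] lt].
split; last first.
  move=> k Nk; rewrite spr_linear hN' // spr_mon; case: eqP => [e|]; first by lia.
  by rewrite scaler0 addr0.
rewrite (eq_bigr (fun k : 'I_N => a *: (if (k == size w :> nat)%N then mon w else 0) + spr k y)).
  rewrite big_split -hN /= -scaler_sumr -big_mkcond.
  by rewrite (@sum_nat_eq _ _ _ (fun=> mon w)).
by move=> k _; rewrite spr_linear spr_mon eq_sym.
Qed.

Lemma spr_ext x y : (forall n, spr n x = spr n y) -> x = y.
Proof.
move=> e; have [m hm] := spr_sum x; have [n hn] := spr_sum y.
rewrite (hm (maxn m n) _).1 ?leq_maxl // [RHS](hn (maxn m n) _).1 ?leq_maxr //.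
by apply: eq_bigr => k _; rewrite e.
Qed.

Lemma spr0E x : exists c, spr 0 x = c *: sone V.
Proof.
move: x; apply: mon_ind => [|a w y [c hc]].
  by exists 0; rewrite scale0r; exact: spr_zero.
rewrite spr_linear hc spr_mon; case: w => [|b w] /=; last by exists c; rewrite scaler0 add0r.
by exists (a + c); rewrite scalerDl.
Qed.

Lemma spr_vee1 n x y : spr n.+1 (vee (spr 1 x) y) = vee (spr 1 x) (spr n y).
Proof.
apply: (vee_ext (f := fun x y => spr n.+1 (vee (spr 1 x) y))
  (g := fun x y => vee (spr 1 x) (spr n y))) => [t|t|t|t|u v].
- exact: (lin_comp (spr_linear _) (lin_comp (vee_linearl t) (spr_linear _))).
- exact: (lin_comp (spr_linear _) (vee_linearr _)).
- exact: (lin_comp (vee_linearl _) (spr_linear _)).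
- exact: (lin_comp (vee_linearr _) (spr_linear _)).
- rewrite !spr_mon; case: eqP => [e|]; last by rewrite !vee0l spr_zero.
  rewrite vee_mon spr_mon size_cat e add1n eqSS; case: ifP => _.
    by rewrite vee_mon.
  by rewrite vee0r.
Qed.

Lemma spr0_vee x y : spr 0 (vee x y) = vee (spr 0 x) (spr 0 y).
Proof.
apply: (vee_ext (f := fun x y => spr 0 (vee x y))
  (g := fun x y => vee (spr 0 x) (spr 0 y))) => [t|t|t|t|u v].
- exact: (lin_comp (spr_linear _) (vee_linearl t)).
- exact: (lin_comp (spr_linear _) (vee_linearr _)).
- exact: (lin_comp (vee_linearl _) (spr_linear _)).
- exact: (lin_comp (vee_linearr _) (spr_linear _)).
- rewrite vee_mon !spr_mon size_cat addn_eq0; case: eqP => _; last by rewrite vee0l.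
  by case: eqP => _; rewrite ?vee0r ?vee_mon.
Qed.

Lemma spr1_vee x y : spr 1 (vee x y) = vee (spr 0 x) (spr 1 y) + vee (spr 1 x) (spr 0 y).
Proof.
apply: (vee_ext (f := fun x y => spr 1 (vee x y))
  (g := fun x y => vee (spr 0 x) (spr 1 y) + vee (spr 1 x) (spr 0 y))) => [t|t|t|t|u v].
- exact: (lin_comp (spr_linear _) (vee_linearl t)).
- exact: (lin_comp (spr_linear _) (vee_linearr _)).
- by apply: lin_add; exact: (lin_comp (vee_linearl _) (spr_linear _)).
- by apply: lin_add; exact: (lin_comp (vee_linearr _) (spr_linear _)).
- rewrite vee_mon !spr_mon size_cat.
  by case: u v => [|a [|b u]] [|c [|d v]]; rewrite /= ?vee0l ?vee0r ?vee_mon ?addr0 ?add0r.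
Qed.

Lemma spr_deg n i x : sdeg i x -> sdeg i (spr n x).
Proof.
move: x; apply: sdeg_ind => [|a u x <- hx].
  by rewrite spr_zero; exact: lspan0.
rewrite spr_linear; apply: lspanD => //; apply: lspanZ; rewrite spr_mon.
by case: ifP => _; [exact: sdeg_mon | exact: lspan0].
Qed.

Lemma iota_linear i : linear (@Defs.iota K V i).
Proof. by move=> c a b; rewrite /Defs.iota (mon_lin [::]). Qed.

Lemma gr1P i x : gr1 i x <-> spr 1 x = x /\ sdeg i x.
Proof.
split=> [[v _ <-]|[ex hx]]; last rewrite -ex.
  split; first by rewrite spr_mon.
  by have := sdeg_mon [:: letter v]; rewrite wdeg_cons wdeg0 addr0.
move: x hx {ex}; apply: (sdeg_ind (P := fun x => gr1 i (spr 1 x))) => [|a w y e [v _ ev]].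
  by rewrite spr_zero; exists 0 => //; exact: (lin0 (@iota_linear i)).
rewrite spr_linear -ev spr_mon; case: w e => [|[j c] [|b w]] e /=; last 2 first.
- move: e; rewrite wdeg_cons wdeg0 addr0 /= => e; subst j.
  by exists (a *: c + v) => //; rewrite iota_linear.
- by exists v => //; rewrite scaler0 add0r.
- by exists v => //; rewrite scaler0 add0r.
Qed.

(** ** Filtration *)

Lemma sfil_filtration : filtration (@sfil K V).
Proof.
split=> [k|k x y|k l x le]; [exact: lspan0 | exact: lspanB |].
move=> hx; apply: (lspan_hom (f := hid _) _ hx) => _ [w hw <-].
by apply: lspan_gen; exists w => //; exact: wfil_le le hw.
Qed.

Lemma sfilZ k c x : sfil k x -> sfil k (c *: x). Proof. exact: lspanZ. Qed.

Lemma sfil_mon k w : wfil k w -> sfil k (mon w).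
Proof. by move=> h; apply: lspan_gen; exists w. Qed.

Lemma wfil_cat k l u w : wfil k u -> wfil l w -> wfil (k + l) (u ++ w).
Proof.
elim: u k => [|a u IH] k /=.
  by move=> k0 h; apply: wfil_le h; rewrite gerDr.
by case=> j [fj h] hw; exists j; split=> //; rewrite addrAC; apply: IH.
Qed.

Lemma sfil_ind i (P : S -> Prop) : P 0 ->
  (forall a w y, wfil i w -> P y -> P (a *: mon w + y)) -> forall x, sfil i x -> P x.
Proof.
move=> P0 PD x hx.
suff : forall a y, P y -> P (a *: x + y) by move=> /(_ 1 0 P0); rewrite scale1r addr0.
elim: hx => [|_ [w /= e <-]|x1 x2 _ IH1 _ IH2|b x1 _ IH] a y Py.
- by rewrite scaler0 add0r.
- exact: PD.
- by rewrite scalerDr -addrA; apply: IH1; apply: IH2.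
- by rewrite scalerA; apply: IH.
Qed.

Lemma vee_sfil k l x y : sfil k x -> sfil l y -> sfil (k + l) (vee x y).
Proof.
move=> hx hy; move: x hx; apply: sfil_ind => [|a u x hu hx].
  by rewrite vee0l; apply: lspan0.
rewrite veeDl veeZl; apply: lspanD => //; apply: lspanZ.
move: y hy {hx}; apply: sfil_ind => [|b v y hv hy].
  by rewrite vee0r; apply: lspan0.
rewrite veeDr veeZr; apply: lspanD => //; apply: lspanZ.
by rewrite vee_mon; apply: sfil_mon; apply: wfil_cat.
Qed.

Lemma sfil_exh : complete_filtration V -> forall x, exists k, sfil k x.
Proof.
move=> hV; apply: mon_ind => [|a w y [k hk]]; first by exists 0; exact: lspan0.
have [l hl] : exists l, wfil l w.
  elim: w => [|b w [l hl]]; first by exists 0.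
  have [j hj] := fil_exh hV (tagged b).
  by exists (j + l), j; split=> //; rewrite addrC addKr.
exists (Num.min k l); apply: lspanD.
  by apply: lspanZ; apply: (filt_le sfil_filtration) (sfil_mon hl); rewrite ge_min lexx orbT.
by apply: (filt_le sfil_filtration) hk; rewrite ge_min lexx.
Qed.

(** ** Separation of Sym^1 *)

Let comp_word i (w : word V) : V i :=
  if w is [:: a] then
    if tag a =P i is ReflectT e then ecast j (V j) e (tagged a) else 0
  else 0.

Let comp_wordE i (a : V i) : comp_word i [:: letter a] = a.
Proof. by rewrite /comp_word /=; case: eqP => // e; rewrite (eq_irrelevance e erefl). Qed.

Let comp_rel i g : sym_rel g -> ext (comp_word i) g = 0.
Proof.
apply: sym_lift => {g} [u w j c a b|u w a b].
  case: u => [|? [|? ?]]; case: w => [|? ?]; rewrite /= ?scaler0 ?addr0 //.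
  by case: eqP => [e|]; [subst j | rewrite scaler0 addr0].
by case: u => [|? [|? ?]]; rewrite /= scaler0.
Qed.

(** A retraction of [iota]. Separation and completeness are axioms about the graded pieces, and this
    map carries questions in Sym^1 back to them. *)
Definition hpiece i : lhom S (V i) := locked (LHom (plift_linear (@comp_rel i))).

Lemma hpiece_mon i w : hpiece i (mon w) =
  if w is [:: a] then
    if tag a =P i is ReflectT e then ecast j (V j) e (tagged a) else 0
  else 0.
Proof. by rewrite /hpiece -lock; exact: plift_gen (@comp_rel i) w. Qed.

Lemma hpiece_iota i (a : V i) : hpiece i (Defs.iota a) = a.
Proof. by rewrite hpiece_mon; exact: comp_wordE. Qed.

Lemma hpiece_fil i k x : complete_filtration V -> sfil k x -> fil V k i (hpiece i x).
Proof.
move=> hV; move: x; apply: sfil_ind => [|c w y hw hy].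
  by rewrite hom_zero; apply: fil_0.
rewrite hom_linear; apply: fil_lin => //.
rewrite hpiece_mon; case: w hw => [|a [|b w]] //=; try by move=> *; apply: fil_0.
case=> j [fj jk]; case: eqP => [e|_]; last exact: fil_0.
case: a e fj => [i' a] /= e; subst i' => /=.
have {jk} jk : k <= j by rewrite -subr_le0.
have [n ->] : exists n : nat, j = k + n%:Z.
  by exists `|j - k|%N; lia.
elim: n => [|n IH]; first by rewrite addr0.
by rewrite intS addrA (addrAC _ 1) => /(fil_desc hV).
Qed.

Lemma spr1_eq0 x : (forall i, hpiece i x = 0) -> spr 1 x = 0.
Proof.
(* An element has finitely many homogeneous parts, so the degrees j - n, which run from -n to n,
   cover them all once n is large. *)
have [s ->] : exists n, spr 1 x = \sum_(j < n.*2.+1) Defs.iota (hpiece (j%:Z - n%:Z) x).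
  suff [n hn] : exists n, forall N, (n <= N)%N ->
    spr 1 x = \sum_(j < N.*2.+1) Defs.iota (hpiece (j%:Z - N%:Z) x) by exists n; apply: hn.
  move: x; apply: mon_ind => [|c w y [n hn]].
    exists 0%N => N _; rewrite spr_zero big1 // => j _.
    by rewrite hom_zero; exact: (lin0 (@iota_linear _)).
  have e N : \sum_(j < N.*2.+1) Defs.iota (hpiece (j%:Z - N%:Z) (c *: mon w + y)) =
    c *: (\sum_(j < N.*2.+1) Defs.iota (hpiece (j%:Z - N%:Z) (mon w))) +
    \sum_(j < N.*2.+1) Defs.iota (hpiece (j%:Z - N%:Z) y).
    rewrite scaler_sumr -big_split; apply: eq_bigr => j _.
    by rewrite hom_linear iota_linear.
  case: w e => [|a [|b w]] e.
  - exists n => N /hn h; rewrite spr_linear h spr_mon e [in RHS]big1 // => j _.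
    by rewrite hpiece_mon; exact: (lin0 (@iota_linear _)).
  - exists (maxn n `|tag a|) => N; rewrite geq_max => /andP[/hn h le].
    rewrite spr_linear h spr_mon e; congr (_ *: _ + _) => /=.
    have lt : (`|(tag a + N%:Z)%R|%N < N.*2.+1)%N by lia.
    rewrite (bigD1 (Ordinal lt)) //= big1 ?addr0 => [|j]; last first.
      rewrite -val_eqE /= => ne; rewrite hpiece_mon; case: eqP => [e0|_].
        by exfalso; move: ne le e0; case: a e lt => i a /=; lia.
      exact: (lin0 (@iota_linear _)).
    have -> : (`|(tag a + N%:Z)%R|%N)%:Z - N%:Z = tag a by lia.
    by case: a {e le lt} => i a /=; rewrite -[mon _]/(Defs.iota a) hpiece_iota.
  - exists n => N /hn h; rewrite spr_linear h spr_mon e [in RHS]big1 // => j _.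
    by rewrite hpiece_mon; exact: (lin0 (@iota_linear _)).
move=> h; rewrite big1 // => j _; rewrite h; exact: (lin0 (@iota_linear _)).
Qed.

(** Uniqueness of limits rests on this lemma and is therefore available in Sym^1 alone. *)
Lemma spr1_sep x : complete_filtration V -> spr 1 x = x ->
  (forall k : nat, sfil k x) -> x = 0.
Proof.
move=> hV e hx; rewrite -e; apply: spr1_eq0 => i; apply: (fil_sep hV) => k.
apply: hpiece_fil => //; apply: (filt_le sfil_filtration) (hx `|k|%N); lia.
Qed.

Lemma iota_fil k i (a : V i) : fil V k i a -> sfil k (Defs.iota a).
Proof. by move=> h; apply: sfil_mon; exists k; rewrite subrr. Qed.

Lemma flimE (u : nat -> S) l : flim (@sfil K V) u l <-> tends0 (@sfil K V) (fun n => u n - l).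
Proof.
split=> h k; first exact: h.
have [N hN] := h `|k|%N; exists N => n /hN; apply: (filt_le sfil_filtration); lia.
Qed.

(** Completeness is assumed degree by degree, so the degree is fixed before the sequence is moved to
    V^i and its limit moved back. *)
Lemma gr1_limit (u : nat -> S) i : complete_filtration V -> (forall n, gr1 i (u n)) ->
  (forall k : nat, exists N, forall m n, (N <= m)%N -> (N <= n)%N -> sfil k (u m - u n)) ->
  exists2 l, gr1 i l & tends0 (@sfil K V) (fun n => u n - l).
Proof.
move=> hV hu hc.
have e n : u n = Defs.iota (hpiece i (u n)).
  by have [v _ <-] := hu n; rewrite hpiece_iota.
have [k|l hl] := fil_compl hV (u := fun n => hpiece i (u n)).
  have [N hN] := hc `|k|%N; exists N => m n Nm Nn; rewrite -hom_sub.
  apply: hpiece_fil => //; apply: (filt_le sfil_filtration) (hN m n Nm Nn); lia.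
exists (Defs.iota l); first by exists l.
move=> k; have [N hN] := hl k; exists N => n /hN; rewrite e hpiece_iota.
move/iota_fil; congr sfil.
have -> : Defs.iota (hpiece i (u n)) - Defs.iota l =
  -1 *: Defs.iota l + Defs.iota (hpiece i (u n)) by rewrite scaleN1r addrC.
by rewrite -iota_linear scaleN1r addrC.
Qed.
End SymHom.

(** * Degree and filtration of linear maps *)

Section FilteredMaps.
Variable K : fieldType.
Implicit Types U V W : fgspace K.

(** Uniform over the source: this is the filtration on maps in which the operator series are
    estimated and converge. *)
Definition hfil V W (k : int) (f : lhom (Sym V) (Sym W)) : Prop :=
  forall l x, sfil l x -> sfil (k + l) (f x).

Definition hdeg V W (d : int) (f : lhom (Sym V) (Sym W)) : Prop :=
  forall i x, sdeg i x -> sdeg (d + i) (f x).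

Lemma hfil_filtration V W : filtration (@hfil V W).
Proof.
split=> [k l x _|k f g hf hg l x hx|k l f le hf m x hx]; first exact: lspan0.
  by apply: lspanB; [apply: hf | apply: hg].
by apply: (filt_le (@sfil_filtration K W)) (hf m x hx); rewrite lerD2r.
Qed.

Lemma hfilZ V W k c (f : lhom (Sym V) (Sym W)) : hfil k f -> hfil k (c *: f).
Proof. by move=> hf l x hx; apply: lspanZ; apply: hf. Qed.

Lemma hfil_mon V W k (f : lhom (Sym V) (Sym W)) :
  (forall l w, wfil l w -> sfil (k + l) (f (mon w))) -> hfil k f.
Proof. by move=> h l x; apply: lspan_hom => _ [w hw <-]; apply: h. Qed.

Lemma hdeg_mon V W k (f : lhom (Sym V) (Sym W)) :
  (forall w, sdeg (k + wdeg w) (f (mon w))) -> hdeg k f.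
Proof. by move=> h l x; apply: lspan_hom => _ [w <- <-]; apply: h. Qed.

Lemma hfil_comp U V W k l (f : lhom (Sym V) (Sym W)) (g : lhom (Sym U) (Sym V)) :
  hfil k f -> hfil l g -> hfil (k + l) (f ** g).
Proof. by move=> hf hg m x hx; rewrite -addrA; apply: hf; apply: hg. Qed.

Lemma hdeg_comp U V W k l (f : lhom (Sym V) (Sym W)) (g : lhom (Sym U) (Sym V)) :
  hdeg k f -> hdeg l g -> hdeg (k + l) (f ** g).
Proof. by move=> hf hg m x hx; rewrite -addrA; apply: hf; apply: hg. Qed.

Lemma hdeg_comp0l U V W l (f : lhom (Sym V) (Sym W)) (g : lhom (Sym U) (Sym V)) :
  hdeg 0 f -> hdeg l g -> hdeg l (f ** g).
Proof. by move=> hf hg; rewrite -[l]add0r; apply: hdeg_comp. Qed.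

Lemma hdeg_comp0r U V W l (f : lhom (Sym V) (Sym W)) (g : lhom (Sym U) (Sym V)) :
  hdeg l f -> hdeg 0 g -> hdeg l (f ** g).
Proof. by move=> hf hg; rewrite -[l]addr0; apply: hdeg_comp. Qed.

Lemma hfil_comp0l U V W l (f : lhom (Sym V) (Sym W)) (g : lhom (Sym U) (Sym V)) :
  hfil 0 f -> hfil l g -> hfil l (f ** g).
Proof. by move=> hf hg; rewrite -[l]add0r; apply: hfil_comp. Qed.

Lemma hfil_comp0r U V W l (f : lhom (Sym V) (Sym W)) (g : lhom (Sym U) (Sym V)) :
  hfil l f -> hfil 0 g -> hfil l (f ** g).
Proof. by move=> hf hg; rewrite -[l]addr0; apply: hfil_comp. Qed.

Lemma hdegP V W d : forall a (f g : lhom (Sym V) (Sym W)),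
  hdeg d f -> hdeg d g -> hdeg d (a *: f + g).
Proof. by move=> a f g hf hg i x hx; apply: lspanD; [apply/lspanZ/hf | apply: hg]. Qed.

Lemma hdeg0 V W d : hdeg d (0 : lhom (Sym V) (Sym W)).
Proof. by move=> i x _; exact: lspan0. Qed.

Lemma hdegD V W d (f g : lhom (Sym V) (Sym W)) : hdeg d f -> hdeg d g -> hdeg d (f + g).
Proof. by move=> hf hg; rewrite -[f]scale1r; apply: hdegP. Qed.

Lemma hdegN V W d (f : lhom (Sym V) (Sym W)) : hdeg d f -> hdeg d (- f).
Proof. by move=> hf; rewrite -scaleN1r -[_ *: f]addr0; apply: hdegP => //; apply: hdeg0. Qed.

Lemma hdeg_sum V W d I (r : seq I) (P : pred I) (F : I -> lhom (Sym V) (Sym W)) :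
  (forall i, P i -> hdeg d (F i)) -> hdeg d (\sum_(i <- r | P i) F i).
Proof. by move=> h; apply: big_ind => //; [exact: hdeg0 | exact: hdegD]. Qed.

Lemma hfil_id V : hfil 0 (hid (Sym V)). Proof. by move=> l x; rewrite add0r. Qed.
Lemma hdeg_id V : hdeg 0 (hid (Sym V)). Proof. by move=> l x; rewrite add0r. Qed.

Lemma hfil_mul V k (x : Sym V) : sfil k x -> hfil k (hmul x).
Proof. by move=> hx l y hy; rewrite hmulE; apply: vee_sfil. Qed.

Lemma hdeg_mul V k (x : Sym V) : sdeg k x -> hdeg k (hmul x).
Proof. by move=> hx l y hy; rewrite hmulE; apply: vee_sdeg. Qed.

Lemma hfil_spr V n : hfil 0 (hspr V n).
Proof.
apply: hfil_mon => l w hw /=; rewrite add0r spr_mon.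
by case: ifP => _; [exact: sfil_mon | exact: lspan0].
Qed.

Lemma hdeg_spr V n : hdeg 0 (hspr V n).
Proof. by move=> i x hx; rewrite add0r; apply: spr_deg. Qed.

Lemma hsgnK V p : hsgn V p ** hsgn V p = hid _.
Proof.
apply: mon_ext => w /=; rewrite sgnop_mon (linZ (@sgnop_linear K V p)) sgnop_mon.
by rewrite scalerA ksgnK scale1r.
Qed.

Lemma ksgn_opp i j : ksgn K (- i) j = ksgn K i j.
Proof. by rewrite /ksgn mulNr -exprz_inv invrN invr1. Qed.

Lemma hsgnN V p : hsgn V (- p) = hsgn V p.
Proof. by apply: mon_ext => w /=; rewrite !sgnop_mon ksgn_opp. Qed.

Lemma hsgn_comm V W d p (f : lhom (Sym V) (Sym W)) : hdeg d f ->
  hsgn W p ** f = ksgn K p d *: (f ** hsgn V p).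
Proof.
move=> hf; apply: mon_ext => w /=; rewrite (sgnop_sdeg p (hf _ _ (sdeg_mon w))).
by rewrite sgnop_mon hom_scale scalerA ksgnDr.
Qed.

End FilteredMaps.

(** * Comultiplication and convolution *)

Section Convolution.
Variable K : fieldType.
Implicit Types U V W : fgspace K.

Lemma cop_unsh V (w : word V) :
  cop (mon w) = unsh w (fun u v => tens (mon u) (mon v)).
Proof.
rewrite cop_mon; elim: w => [|a w IH] /=.
  rewrite /wcop (big_pred1 [tuple]) => [|t]; last by apply/esym/eqP; exact: tuple0.
  by rewrite scale1r.
rewrite wcop_cons IH -(htens_tmap (LHom (vee_linearr (mon [:: a]))) (hid _)).
rewrite -(htens_tmap (hsgn V (tag a)) (LHom (vee_linearr (mon [:: a])))).
rewrite !unsh_map; congr (_ + _); apply: eq_unsh => u v _; rewrite htensE /= vee_mon //.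
by rewrite sgnop_mon (linZ (tens_linearl _)).
Qed.

(** Convolution for the full coproduct and without Koszul sign. It agrees with [star] on maps that
    kill 1 when the right-hand factor has degree 0. *)
Definition hstar V W (f g : lhom (Sym V) (Sym W)) : lhom (Sym V) (Sym W) :=
  hsmul W ** htens f g ** hcop V.

Lemma hstar_eval V W (f g : lhom (Sym V) (Sym W)) x :
  hstar f g x = hsmul W (htens f g (cop x)).
Proof. by []. Qed.

Lemma hstarE V W (f g : lhom (Sym V) (Sym W)) w :
  hstar f g (mon w) = unsh w (fun u v => vee (f (mon u)) (g (mon v))).
Proof.
rewrite hstar_eval cop_unsh !unsh_map.
by apply: eq_unsh => u v _; rewrite htensE /= smul_tens.
Qed.

Lemma biadd_hstar V W : biadd (@hstar V W).
Proof.
split=> f g h; apply: mon_ext => w; rewrite hom_evalD !hstarE -unshD;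
  apply: eq_unsh => u v _.
  by rewrite hom_evalD veeDl.
by rewrite hom_evalD veeDr.
Qed.

Lemma hfil_star V W k l (f g : lhom (Sym V) (Sym W)) :
  hfil k f -> hfil l g -> hfil (k + l) (hstar f g).
Proof.
move=> hf hg; apply: hfil_mon => m w hw; rewrite hstarE.
apply: (unsh_ind (C := sfil (k + l + m))); [exact: lspanD|exact: lspanZ|].
move=> u v /shuf_fil /(_ hw)[i [j [<- hi hj]]]; rewrite addrACA.
by apply: vee_sfil; [apply/hf/sfil_mon | apply/hg/sfil_mon].
Qed.

Lemma hdeg_star V W k l (f g : lhom (Sym V) (Sym W)) :
  hdeg k f -> hdeg l g -> hdeg (k + l) (hstar f g).
Proof.
move=> hf hg; apply: hdeg_mon => w; rewrite hstarE.
apply: (unsh_ind (C := sdeg (k + l + wdeg w))); [exact: lspanD|exact: lspanZ|].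
move=> u v /shuf_deg <-; rewrite addrACA.
by apply: vee_sdeg; [apply/hf/sdeg_mon | apply/hg/sdeg_mon].
Qed.

Definition hvan V W (n : nat) (f : lhom (Sym V) (Sym W)) : Prop :=
  forall w, (size w < n)%N -> f (mon w) = 0.

Lemma hvan_star V W m n (f g : lhom (Sym V) (Sym W)) :
  hvan m f -> hvan n g -> hvan (m + n) (hstar f g).
Proof.
move=> hf hg w lt; rewrite hstarE; apply: unsh0 => u v /shuf_size e.
have [/hf ->|mu] := ltnP (size u) m; first by rewrite vee0l.
by rewrite hg ?vee0r //; lia.
Qed.

Lemma hvanP V W n (f : lhom (Sym V) (Sym W)) i x : hvan n f -> (i < n)%N ->
  spr i x = x -> f x = 0.
Proof.
move=> hf lt <-; suff /(congr1 (fun h => hom_fun h x)) : f ** hspr V i = 0 by [].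
apply: mon_ext => w /=; rewrite spr_mon; case: eqP => [e|_]; last by rewrite hom_zero.
by rewrite hf ?e.
Qed.

Lemma hvan_all V W (f : lhom (Sym V) (Sym W)) : (forall n, hvan n f) -> f = 0.
Proof. by move=> h; apply: mon_ext => w; rewrite (h (size w).+1). Qed.

(** the counit, followed by the unit *)
Definition eps_word V W (w : word V) : Sym W := if w is [::] then sone W else 0.

Fact eps_rel V W g : sym_rel g -> ext (@eps_word V W) g = 0.
Proof.
apply: sym_lift => {g} [u w i c a b|u w a b]; case: u => //=; rewrite ?scaler0 ?addr0 //.
Qed.

Definition heps V W : lhom (Sym V) (Sym W) := locked (LHom (plift_linear (@eps_rel V W))).

Lemma hepsE V W w : heps V W (mon w) = if w is [::] then sone W else 0.
Proof. by rewrite /heps -lock; exact: plift_gen (@eps_rel V W) w. Qed.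

Lemma heps_spr V : heps V V = hspr V 0.
Proof. by apply: mon_ext => w; rewrite hepsE /= spr_mon; case: w. Qed.

Lemma hstar_epsl V W (f : lhom (Sym V) (Sym W)) : hstar (heps V W) f = f.
Proof.
apply: mon_ext => w; rewrite hstarE unsh_counitl ?hepsE ?vee1l // => -[//|a u] v _.
by rewrite hepsE vee0l.
Qed.

Lemma hstar_epsr V W (f : lhom (Sym V) (Sym W)) : hstar f (heps V W) = f.
Proof.
apply: mon_ext => w; rewrite hstarE unsh_counitr ?hepsE ?vee1r // => u -[//|a v] _.
by rewrite hepsE vee0r.
Qed.

(** Cocommutativity of the coproduct gives the sign of (|u|, |u'|), commutativity of the product
    that of (|u'|, d + |u|), and the inserted [hsgn] cancels what remains. *)
Lemma hstar_swap V W d (f g h : lhom (Sym V) (Sym W)) : hdeg 0 f -> hdeg d g ->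
  hstar (f ** hsgn V d) (hstar g h) = hstar g (hstar f h).
Proof.
move=> hf hg; apply: mon_ext => w; rewrite !hstarE.
pose H (f g : lhom (Sym V) (Sym W)) (u u' v : word V) :=
  vee (f (mon u)) (vee (g (mon u')) (h (mon v))).
transitivity (unsh w (fun u v => unsh v (H (f ** hsgn V d) g u))).
  apply: eq_unsh => u v _; rewrite hstarE -hmulE unsh_map; apply: eq_unsh => u' v' _.
  by rewrite hmulE.
transitivity (unsh w (fun u v => unsh v (H g f u))); last first.
  apply: eq_unsh => u v _; rewrite hstarE -[RHS]hmulE unsh_map; apply: eq_unsh => u' v' _.
  by rewrite hmulE.
rewrite unsh_swap; apply: eq_unsh => u v _; apply: eq_unsh => u' v' _.
rewrite /H /= sgnop_mon hom_scale veeZl scalerA !veeA.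
rewrite (veeC (hf _ _ (sdeg_mon u')) (hg _ _ (sdeg_mon u))) veeZl scalerA.
rewrite -[RHS]scale1r; congr (_ *: _).
rewrite add0r ksgnDr (ksgnC _ (wdeg u') d) (ksgnC _ (wdeg u') (wdeg u)).
by rewrite mulrA -(mulrA (ksgn K (wdeg u) _)) ksgnK mulr1 ksgnK.
Qed.

(** Convolution with the projection to Sym^1 is the Euler operator. *)
Lemma euler V (w : word V) : hstar (hspr V 1) (hid _) (mon w) = (size w)%:R *: mon w.
Proof.
elim: w => [|a w IH]; rewrite hstarE.
  by rewrite /= spr_mon vee0l scale0r.
rewrite /= mulrS scalerDl scale1r; congr (_ + _).
  rewrite unsh_counitl ?spr_mon ?vee_mon // => u v u0.
  by rewrite spr_mon; case: u u0 => // b u _; rewrite vee0l.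
transitivity (hmul (mon [:: a]) (hstar (hspr V 1) (hid _) (mon w))).
  rewrite hstarE unsh_map; apply: eq_unsh => u v _; rewrite hmulE /= !spr_mon.
  case: ifP => _; last by rewrite !vee0l vee0r scaler0.
  rewrite !vee_mon -cat_rcons -[mon (_ ++ v)]vee_mon mon_consC veeZl scalerA.
  by rewrite ksgnC ksgnK scale1r vee_mon.
by rewrite IH hmulE veeZr vee_mon.
Qed.

Lemma spr_euler V n x : spr n (hstar (hspr V 1) (hid _) x) = n%:R *: spr n x.
Proof.
suff /(congr1 (fun h => hom_fun h x)) :
    hspr V n ** hstar (hspr V 1) (hid _) = n%:R *: hspr V n by [].
apply: mon_ext => w; rewrite hcompE euler hom_scale /=.
by rewrite spr_mon; case: eqP => [->|]; rewrite ?scaler0.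
Qed.

Lemma hstar_spr1 V W n (f g : lhom (Sym V) (Sym W)) :
  hspr W n.+1 ** hstar (hspr W 1 ** f) g = hstar (hspr W 1 ** f) (hspr W n ** g).
Proof.
apply: mon_ext => w; rewrite hcompE !hstarE unsh_map.
by apply: eq_unsh => u v _; rewrite /= spr_vee1.
Qed.

Lemma hstar_spr0 V W (f g : lhom (Sym V) (Sym W)) :
  hspr W 0 ** hstar f g = hstar (hspr W 0 ** f) (hspr W 0 ** g).
Proof.
apply: mon_ext => w; rewrite hcompE !hstarE unsh_map.
by apply: eq_unsh => u v _; rewrite /= spr0_vee.
Qed.

(** An element of Sym^1 is primitive and the coproduct is multiplicative, so multiplication by it is
    a coderivation. *)
Lemma hcop_mul V i (x : Sym V) : gr1 i x ->
  hcop V ** hmul x = htens (hmul x) (hid _) ** hcop V + htens (hsgn V i) (hmul x) ** hcop V.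
Proof.
case=> v _ <-; apply: mon_ext => w.
rewrite hom_evalD !hcompE hmulE vee_mon /= !cop_unsh /= !unsh_map.
congr (_ + _); apply: eq_unsh => u u' _; rewrite htensE !hmulE vee_mon //=.
by rewrite sgnop_mon (linZ (tens_linearl _)).
Qed.
End Convolution.

(** * Power series of coalgebra morphisms and coderivations *)

Section Series.
Variable K : fieldType.
Hypothesis charK : [pchar K] =i pred0.
Implicit Types U V W : fgspace K.

(** Constant series let the results below serve for single maps too, such as [F] and the limits at t
    = 1. *)
Definition consts (A : zmodType) (a : A) (m : nat) : A := if m is 0%N then a else 0.

Lemma cau_constsl (A B C : zmodType) (op : A -> B -> C) a b m : biadd op ->
  cau op (consts a) b m = op a (b m).
Proof.
move=> opD; rewrite /cau big_ord_recl subn0 big1 ?addr0 // => j _.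
by rewrite /= (biadd0l opD).
Qed.

Lemma cau_constsr (A B C : zmodType) (op : A -> B -> C) a b m : biadd op ->
  cau op b (consts a) m = op (b m) a.
Proof. by move=> opD; rewrite cauC cau_constsl //; apply: biadd_flip. Qed.

Definition comults V W (F : nat -> lhom (Sym V) (Sym W)) : Prop :=
  forall m, hcop W ** F m = cau (@htens K _ _ _ _) F F m ** hcop V.

(** Coderivations along F: the precomposition with [hsgn V d] is the Koszul sign
    of F (x) B for B of degree d. *)
Definition coders V W d (F B : nat -> lhom (Sym V) (Sym W)) : Prop :=
  forall m, hcop W ** B m = cau (@htens K _ _ _ _) B F m ** hcop V +
    cau (fun f b => htens (f ** hsgn V d) b) F B m ** hcop V.

Section CompSum.
Variables (A B C : lmodType K) (I : Type) (r : seq I) (P : pred I).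
Lemma comp_sumr (f : lhom B C) (F : I -> lhom A B) :
  f ** (\sum_(i <- r | P i) F i) = \sum_(i <- r | P i) (f ** F i).
Proof. exact: (biadd_sumr (@biadd_hcomp K A B C)). Qed.
Lemma comp_suml (f : lhom A B) (F : I -> lhom B C) :
  (\sum_(i <- r | P i) F i) ** f = \sum_(i <- r | P i) (F i ** f).
Proof. exact: (biadd_suml (@biadd_hcomp K A B C)). Qed.
End CompSum.

Lemma comults_consts V W (g : lhom (Sym V) (Sym W)) :
  hcop W ** g = htens g g ** hcop V -> comults (consts g).
Proof.
move=> h m; rewrite (cau_constsl _ _ _ (biadd_htens _ _ _ _)); case: m => [|m] //=.
by rewrite (biadd0r (biadd_htens _ _ _ _)) (biadd0l (biadd_hcomp _ _ _))
  (biadd0r (biadd_hcomp _ _ _)).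
Qed.

Lemma consts_one V W (g : lhom (Sym V) (Sym W)) : g (sone V) = sone W ->
  forall m, consts g m (sone V) = psone W m.
Proof. by move=> g1 []. Qed.

Lemma coders_consts U W d (F0 : lhom (Sym U) (Sym W))
    (B : nat -> lhom (Sym U) (Sym W)) :
  (forall m, hcop W ** B m = htens (B m) F0 ** hcop U + htens (F0 ** hsgn U d) (B m) ** hcop U) ->
  coders d (consts F0) B.
Proof.
move=> h m; rewrite (cau_constsr _ _ _ (biadd_htens _ _ _ _)) h.
have bi : biadd (fun f b : lhom (Sym U) (Sym W) => htens (f ** hsgn U d) b).
  split=> [b f0 f'|f0 b b']; last exact: (biadd_htens _ _ _ _).2.
  by rewrite (biadd_hcomp _ _ _).1 (biadd_htens _ _ _ _).1.
by rewrite (cau_constsl _ _ _ bi).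
Qed.

Lemma coders_const U W d (F B : lhom (Sym U) (Sym W)) :
  hcop W ** B = htens B F ** hcop U + htens (F ** hsgn U d) B ** hcop U ->
  coders d (consts F) (consts B).
Proof.
move=> h; apply: coders_consts => -[|m] //=.
by rewrite (biadd0l (biadd_htens _ _ _ _)) (biadd0r (biadd_htens _ _ _ _))
  !(biadd0l (biadd_hcomp _ _ _)) (biadd0r (biadd_hcomp _ _ _)) addr0.
Qed.

Lemma star_tens V W (F : lhom (tensor (Sym V) (Sym V)) (tensor (Sym W) (Sym W)))
  (B : lhom (Sym V) (Sym W)) (f g : lhom (Sym W) (Sym W)) :
  hcop W ** B = F ** hcop V -> hstar f g ** B = hsmul W ** htens f g ** F ** hcop V.
Proof. by move=> e; rewrite /hstar -hcompA e !hcompA. Qed.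

Lemma star_comults V W (F : nat -> lhom (Sym V) (Sym W))
  (f g : lhom (Sym W) (Sym W)) m : comults F ->
  hstar f g ** F m = cau (fun a b => hstar (f ** a) (g ** b)) F F m.
Proof.
move=> hF; rewrite (star_tens _ _ (hF m)) /cau comp_sumr comp_suml.
by apply: eq_bigr => j _; rewrite /hstar -!hcompA (hcompA (htens f g)) htens_comp !hcompA.
Qed.

Lemma star_coders V W d (F B : nat -> lhom (Sym V) (Sym W))
  (f g : lhom (Sym W) (Sym W)) m : coders d F B ->
  hstar f g ** B m = cau (fun b a => hstar (f ** b) (g ** a)) B F m +
    cau (fun a b => hstar (f ** a ** hsgn V d) (g ** b)) F B m.
Proof.
move=> hB; move: (hB m); rewrite -(biadd_hcomp _ _ _).1 => e.
rewrite (star_tens _ _ e) (biadd_hcomp _ _ _).2 (biadd_hcomp _ _ _).1.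
congr (_ + _); rewrite /cau comp_sumr comp_suml; apply: eq_bigr => j _;
  by rewrite /hstar -!hcompA (hcompA (htens f g)) htens_comp !hcompA.
Qed.

Lemma hspr_ext V W (f g : lhom (Sym V) (Sym W)) :
  (forall n, hspr W n ** f = hspr W n ** g) -> f = g.
Proof.
move=> e; apply: hom_ext => x; apply: spr_ext => n.
exact: (congr1 (fun h => hom_fun h x) (e n)).
Qed.

Lemma hspr_euler V n : hspr V n ** hstar (hspr V 1) (hid _) = n%:R *: hspr V n.
Proof. by apply: hom_ext => x; rewrite hcompE [LHS]spr_euler. Qed.

Lemma spr0_star V : hstar (hspr V 0) (hspr V 0) = hspr V 0.
Proof. by rewrite -{1}heps_spr hstar_epsl. Qed.

(** The Euler operator is a convolution, hence can be moved through a comultiplicative series. In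
    characteristic zero this recursion expresses all symmetric components through the Taylor
    coefficient. *)
Lemma comults_spr V W (F : nat -> lhom (Sym V) (Sym W)) n m : comults F ->
  n.+1%:R *: (hspr W n.+1 ** F m) =
  cau (fun a b => hstar (hspr W 1 ** a) (hspr W n ** b)) F F m.
Proof.
move=> hF; rewrite -hcompZl -hspr_euler -hcompA (star_comults _ _ _ hF) /cau comp_sumr.
by apply: eq_bigr => j _; rewrite hcomp1l hstar_spr1.
Qed.

(** The Sym^0 part is idempotent for convolution, so its difference psi from the counit satisfies
    psi = - psi * psi. As psi vanishes at 1, each use of this identity raises its order of
    vanishing, hence psi = 0. *)
Lemma comults_counit V W (F : nat -> lhom (Sym V) (Sym W)) :
  comults F -> (forall m, F m (sone V) = psone W m) ->
  forall m, hspr W 0 ** F m = consts (heps V W) m.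
Proof.
move=> hF F1 m; apply/eqP; rewrite -subr_eq0; apply/eqP.
pose psi m := hspr W 0 ** F m - consts (heps V W) m.
have psiE k : psi k = - cau (@hstar K V W) psi psi k.
  have e : cau (@hstar K V W) psi psi k =
      cau (@hstar K V W) (fun m => hspr W 0 ** F m) psi k -
      cau (@hstar K V W) (consts (heps V W)) psi k.
    by rewrite -sumrB; apply: eq_bigr => j _; rewrite (biaddBl (biadd_hstar _ _)).
  rewrite e (cau_constsl _ _ _ (biadd_hstar _ _)) hstar_epsl {e}.
  have -> : cau (@hstar K V W) (fun m => hspr W 0 ** F m) psi k = hspr W 0 ** F k -
      cau (@hstar K V W) (fun m => hspr W 0 ** F m) (consts (heps V W)) k.
    rewrite -{2}spr0_star (star_comults _ _ _ hF) -sumrB; apply: eq_bigr => j _.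
    by rewrite (biaddBr (biadd_hstar _ _)).
  by rewrite (cau_constsr _ _ _ (biadd_hstar _ _)) hstar_epsr subrr sub0r opprK.
rewrite -/(psi m); apply: hvan_all => n; elim: n m => [|n IH] m w // lt.
case: n IH lt => [|n] IH lt.
  case: w lt => // _; rewrite /psi homBE hcompE F1.
  case: m => [|m] /=; last by rewrite spr_zero subr0.
  by rewrite hepsE spr_mon subrr.
rewrite psiE homNE hom_sumE big1 ?oppr0 // => j _.
by apply: (hvan_star (IH j) (IH (m - j)%N)); lia.
Qed.

Lemma scale_natf_inj (A : lmodType K) n : injective (fun x : A => n.+1%:R *: x).
Proof. by move=> x y; rewrite !scaler_nat; apply: mulrSn_inj. Qed.

(** The bound m on the order in t makes this usable inside an induction on that order. *)
Lemma comults_unique V W (F G : nat -> lhom (Sym V) (Sym W)) m :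
  comults F -> comults G -> (forall j, hspr W 0 ** F j = hspr W 0 ** G j) ->
  (forall j, (j <= m)%N -> hspr W 1 ** F j = hspr W 1 ** G j) ->
  forall j, (j <= m)%N -> F j = G j.
Proof.
move=> hF hG e0 e1 j jm; apply: hspr_ext => n; elim: n j jm => [|n IH] j jm //.
apply: (@scale_natf_inj _ n); rewrite /= !comults_spr //.
by apply: eq_bigr => i _; rewrite e1 ?IH //; have := ltn_ord i; lia.
Qed.

(** The projection to Sym^0 is its own convolution square; passing B through it gives the Sym^0 part
    of B twice. *)
Lemma coders_spr0 V W d (F B : nat -> lhom (Sym V) (Sym W)) m : coders d F B ->
  (forall j, hspr W 0 ** F j = consts (heps V W) j) -> hspr W 0 ** B m = 0.
Proof.
move=> hB F0; suff : hspr W 0 ** B m = hspr W 0 ** B m + hspr W 0 ** B m.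
  by move/eqP; rewrite addrC -subr_eq subrr eq_sym => /eqP.
rewrite -{1}spr0_star (star_coders _ _ _ hB); congr (_ + _).
  transitivity (cau (@hstar K V W) (fun j => hspr W 0 ** B j) (consts (heps V W)) m).
    by apply: eq_bigr => j _; rewrite F0.
  by rewrite (cau_constsr _ _ _ (biadd_hstar _ _)) hstar_epsr.
transitivity (cau (@hstar K V W) (consts (heps V W)) (fun j => hspr W 0 ** B j) m).
  apply: eq_bigr => j _; congr hstar; rewrite F0; case: (nat_of_ord j) => [|i] /=.
    apply: mon_ext => w; rewrite hcompE /= sgnop_mon hom_scale hepsE.
    by case: w => [|a w]; rewrite ?scaler0 // wdeg0 ksgn0r scale1r.
  by rewrite (biadd0l (biadd_hcomp _ _ _)).
by rewrite (cau_constsl _ _ _ (biadd_hstar _ _)) hstar_epsl.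
Qed.

(** Composing with the Euler operator gives (n+1) B_{n+1} = B_1 * F_n + F_1 * B_n
    in symmetric degree n+1; by induction B_n = B_1 * F_{n-1}, and [hstar_swap]
    turns F_1 * (B_1 * F_{n-1}) into B_1 * (F_1 * F_{n-1}) = n (B_1 * F_n). *)
Lemma coders_spr V W d (F B : nat -> lhom (Sym V) (Sym W)) :
  comults F -> coders d F B -> (forall j, hdeg 0 (F j)) -> (forall j, hdeg d (B j)) ->
  (forall j, hspr W 0 ** F j = consts (heps V W) j) ->
  forall n m, hspr W n.+1 ** B m =
    cau (fun b f => hstar (hspr W 1 ** b) (hspr W n ** f)) B F m.
Proof.
move=> hF hB F0 Bd Fc n m.
have E k i : k.+1%:R *: (hspr W k.+1 ** B i) =
    cau (fun b f => hstar (hspr W 1 ** b) (hspr W k ** f)) B F i +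
    cau (fun f b => hstar (hspr W 1 ** f ** hsgn V d) (hspr W k ** b)) F B i.
  rewrite -hcompZl -hspr_euler -hcompA (star_coders _ _ _ hB) (biadd_hcomp _ _ _).2.
  congr (_ + _); rewrite /cau comp_sumr; apply: eq_bigr => j _;
    by rewrite ?hcomp1l -?hcompA hstar_spr1 ?hcomp1l.
elim: n m => [|n IH] m.
  move: (E 0%N m); rewrite mulr1n scale1r => ->; rewrite [X in _ + X]big1 ?addr0 // => j _.
  by rewrite (coders_spr0 _ hB Fc) (biadd0r (biadd_hstar _ _)).
apply: (@scale_natf_inj _ n.+1); rewrite /= E [RHS]scaler_nat mulrS -scaler_nat; congr (_ + _).
set op := fun f q => hstar (hspr W 1 ** f ** hsgn V d) q.
transitivity (cau op F (cau (fun b f => hstar (hspr W 1 ** b) (hspr W n ** f)) B F) m).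
  by apply: eq_bigr => j _; rewrite IH.
rewrite cau_caur; last by move=> f; exact: (biadd_hstar _ _).2.
transitivity (cau3 (fun f b g => hstar (hspr W 1 ** b) (hstar (hspr W 1 ** f) (hspr W n ** g)))
    F B F m).
  apply: eq_cau3 => i j k; rewrite /op; apply: hstar_swap.
    by apply: hdeg_comp0l => //; apply: hdeg_spr.
  by apply: hdeg_comp0l => //; apply: hdeg_spr.
rewrite cau3C12 -(@cau_caur _ _ _ _ _ (fun b q => hstar (hspr W 1 ** b) q)
  (fun f g => hstar (hspr W 1 ** f) (hspr W n ** g))); last first.
  by move=> b; exact: (biadd_hstar _ _).2.
rewrite /cau scaler_sumr; apply: eq_bigr => j _; rewrite -[X in hstar _ X]comults_spr //.
by rewrite scaler_nat (additiveMn ((biadd_hstar _ _).2 _)) -scaler_nat.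
Qed.

(** A coderivation is thus determined by its Taylor coefficient. This formula turns B into a gauge
    parameter in the convolution algebra and also serves to prove that coderivations vanish. *)
Lemma coders_taylor V W d (F B : nat -> lhom (Sym V) (Sym W)) :
  comults F -> coders d F B -> (forall j, hdeg 0 (F j)) -> (forall j, hdeg d (B j)) ->
  (forall j, hspr W 0 ** F j = consts (heps V W) j) ->
  forall m, B m = cau (fun b f => hstar (hspr W 1 ** b) f) B F m.
Proof.
move=> hF hB F0 Bd Fc m; apply: hspr_ext => -[|n].
  rewrite (coders_spr0 _ hB Fc) /cau comp_sumr big1 // => j _.
  rewrite hstar_spr0 hcompA (_ : hspr W 0 ** hspr W 1 = 0).
    by rewrite (biadd0l (biadd_hcomp _ _ _)) (biadd0l (biadd_hstar _ _)).
  by apply: hom_ext => x; rewrite hcompE /= spr_spr.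
rewrite (coders_spr hF hB) // /cau comp_sumr; apply: eq_bigr => j _.
by rewrite hstar_spr1.
Qed.
End Series.

(** * Composition of series and flows of coderivations *)

Section Composition.
Variable K : fieldType.
Hypothesis charK : [pchar K] =i pred0.
Implicit Types U V W : fgspace K.

Lemma cau_compr (A B : Type) (X Y Z : lmodType K) (op : A -> B -> lhom Y Z)
    a b (g : lhom X Y) m :
  cau op a b m ** g = cau (fun x y => op x y ** g) a b m.
Proof. exact: comp_suml. Qed.

Lemma cau_compl (A B : Type) (X Y Z : lmodType K) (op : A -> B -> lhom X Y)
    a b (g : lhom Y Z) m :
  g ** cau op a b m = cau (fun x y => g ** op x y) a b m.
Proof. exact: comp_sumr. Qed.

Lemma tens_interchange (X X1 X2 Y Y1 Y2 : lmodType K) (f : nat -> lhom X1 X2)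
    (g : nat -> lhom Y1 Y2) (f' : nat -> lhom X X1) (g' : nat -> lhom Y Y1) m :
  cau (@hcomp K _ _ _) (cau (@htens K _ _ _ _) f g) (cau (@htens K _ _ _ _) f' g') m =
  cau (@htens K _ _ _ _) (cau (@hcomp K _ _ _) f f') (cau (@hcomp K _ _ _) g g') m.
Proof.
apply: (@cau_interchange (lhom (tensor X1 Y1) (tensor X2 Y2))
  (lhom (tensor X Y) (tensor X1 Y1)) (lhom X X2) (lhom Y Y2));
  [exact: biadd_hcomp|exact: biadd_htens|].
by move=> *; rewrite htens_comp.
Qed.

Lemma comults_comp U V W (X : nat -> lhom (Sym V) (Sym W)) (Y : nat -> lhom (Sym U) (Sym V)) :
  comults X -> comults Y -> comults (cau (@hcomp K _ _ _) X Y).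
Proof.
move=> hX hY m; rewrite -tens_interchange cau_compl cau_compr.
by apply: eq_bigr => j _; rewrite hcompA hX -hcompA hY hcompA.
Qed.

Lemma coders_compl U V W d (X : nat -> lhom (Sym V) (Sym W))
    (F B : nat -> lhom (Sym U) (Sym V)) :
  comults X -> coders d F B ->
  coders d (cau (@hcomp K _ _ _) X F) (cau (@hcomp K _ _ _) X B).
Proof.
move=> hX hB m; rewrite -tens_interchange cau_compl.
have -> : cau (fun f b => htens (f ** hsgn U d) b) (cau (@hcomp K _ _ _) X F)
    (cau (@hcomp K _ _ _) X B) m =
  cau (@hcomp K _ _ _) (cau (@htens K _ _ _ _) X X)
    (cau (fun f b => htens (f ** hsgn U d) b) F B) m.
  rewrite (tens_interchange X X (fun j => F j ** hsgn U d) B).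
  by apply: eq_bigr => j _; rewrite cau_compr; congr htens; apply: eq_bigr => i _; rewrite hcompA.
rewrite !cau_compr -big_split; apply: eq_bigr => j _ /=.
by rewrite hcompA hX -hcompA hB (biadd_hcomp _ _ _).2 !hcompA.
Qed.

(** Degree 0 of Y is needed to commute it past the sign operator in the coderivation rule. *)
Lemma coders_compr U V W d (Y : nat -> lhom (Sym U) (Sym V))
    (F B : nat -> lhom (Sym V) (Sym W)) :
  comults Y -> (forall j, hdeg 0 (Y j)) -> coders d F B ->
  coders d (cau (@hcomp K _ _ _) F Y) (cau (@hcomp K _ _ _) B Y).
Proof.
move=> hY Y0 hB m; rewrite -tens_interchange cau_compl.
have -> : cau (fun f b => htens (f ** hsgn U d) b) (cau (@hcomp K _ _ _) F Y)
    (cau (@hcomp K _ _ _) B Y) m =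
  cau (@hcomp K _ _ _) (cau (fun f b => htens (f ** hsgn V d) b) F B)
    (cau (@htens K _ _ _ _) Y Y) m.
  rewrite (tens_interchange (fun j => F j ** hsgn V d) B Y Y).
  apply: eq_bigr => j _; rewrite cau_compr; congr htens; apply: eq_bigr => i _.
  by rewrite -!hcompA (hsgn_comm _ (Y0 _)) ksgn0r scale1r.
rewrite !cau_compr -big_split; apply: eq_bigr => j _ /=.
by rewrite hcompA hB (biadd_hcomp _ _ _).1 -!hcompA !hY.
Qed.

Definition evcoder V (P : lhom (Sym V) (Sym V)) : Prop :=
  hcop V ** P = (htens P (hid _) + htens (hid _) P) ** hcop V.

(** [ode rcomp P X] is the equation X' = - X P of the inverse of a solution of
    X' = P X. *)
Definition rcomp (X Y : lmodType K) (p : lhom X X) (x : lhom X Y) : lhom X Y := - (x ** p).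

Lemma biadd_rcomp X Y : biadd (@rcomp X Y).
Proof.
split=> [x p p'|p x x']; rewrite /rcomp.
  by rewrite (biadd_hcomp _ _ _).2 opprD.
by rewrite (biadd_hcomp _ _ _).1 opprD.
Qed.

Lemma pderiv_map (X Y : zmodType) (f : X -> Y) a m : {morph f : x y / x + y} ->
  pderiv (fun m => f (a m)) m = f (pderiv a m).
Proof. by move=> fD; rewrite /pderiv (additiveMn fD). Qed.

(** Delta X and (X tensor X) Delta solve the same linear equation, with coefficients P tensor 1 + 1
    tensor P acting on the left, and agree at t = 0. *)
Lemma ode_comults V (P X : nat -> lhom (Sym V) (Sym V)) :
  (forall j, evcoder (P j)) -> X 0%N = hid _ -> ode (@hcomp K _ _ _) P X -> comults X.
Proof.
move=> hP X0 hX; pose P' j := htens (P j) (hid _) + htens (hid _) (P j).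
apply: (@ode_unique _ _ _ (@hcomp K _ _ _) P' charK
  (fun m => hcop V ** X m) (fun m => cau (@htens K _ _ _ _) X X m ** hcop V)).
- by rewrite X0 /cau big_ord1 /= X0 htens1 hcomp1l hcomp1r.
- move=> m; rewrite (@pderiv_map _ _ (fun f => hcop V ** f)); last exact: (biadd_hcomp _ _ _).2.
  rewrite hX cau_compl; apply: eq_bigr => j _.
  by rewrite hcompA hP -hcompA.
- move=> m; rewrite (@pderiv_map _ _ (fun f => f ** hcop V)); last exact: (biadd_hcomp _ _ _).1.
  rewrite (cau_deriv _ _ _ (biadd_htens _ _ _ _)).
  rewrite (eq_cau _ (a' := cau (@hcomp K _ _ _) P X) (b' := X)) //.
  rewrite [X in _ + X](eq_cau _ (a' := X) (b' := cau (@hcomp K _ _ _) P X)) //.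
  rewrite cau_caul; last exact: (biadd_htens _ _ _ _).1.
  rewrite cau_caur; last exact: (biadd_htens _ _ _ _).2.
  rewrite (@eq_cau3 _ _ _ _ _ (fun p x y => htens p (hid _) ** htens x y)); last first.
    by move=> *; rewrite htens_comp hcomp1l.
  rewrite [X in _ + X]cau3C12 [X in _ + X](@eq_cau3 _ _ _ _ _ (fun p x y => htens (hid _) p ** htens x y) P); last first.
    by move=> *; rewrite htens_comp hcomp1l.
  rewrite -(@cau_caur _ _ _ _ _ (fun p z => htens p (hid _) ** z)); last first.
    by move=> *; exact: (biadd_hcomp _ _ _).2.
  rewrite -(@cau_caur _ _ _ _ _ (fun p z => htens (hid _) p ** z)); last first.
    by move=> *; exact: (biadd_hcomp _ _ _).2.
  rewrite -cauDop cau_compr; apply: eq_bigr => j _.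
  by rewrite -(biadd_hcomp _ _ _).1 -hcompA.
Qed.

(** Here P acts on the source, so the common equation of Delta X and (X tensor X) Delta is Z' = - Z
    P itself, and the coderivation rule enters when P is moved past Delta. *)
Lemma rode_comults V (P X : nat -> lhom (Sym V) (Sym V)) :
  (forall j, evcoder (P j)) -> X 0%N = hid _ -> ode (@rcomp _ _) P X -> comults X.
Proof.
move=> hP X0 hX.
apply: (@ode_unique _ _ _ (@rcomp _ _) P charK
  (fun m => hcop V ** X m) (fun m => cau (@htens K _ _ _ _) X X m ** hcop V)).
- by rewrite X0 /cau big_ord1 /= X0 htens1 hcomp1l hcomp1r.
- move=> m; rewrite (@pderiv_map _ _ (fun f => hcop V ** f)); last exact: (biadd_hcomp _ _ _).2.
  rewrite hX cau_compl; apply: eq_bigr => j _.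
  by rewrite /rcomp (biaddNr (biadd_hcomp _ _ _)) hcompA.
- move=> m; rewrite (@pderiv_map _ _ (fun f => f ** hcop V)); last exact: (biadd_hcomp _ _ _).1.
  rewrite (cau_deriv _ _ _ (biadd_htens _ _ _ _)).
  rewrite (eq_cau _ (a' := cau (@rcomp _ _) P X) (b' := X)) //.
  rewrite [X in _ + X](eq_cau _ (a' := X) (b' := cau (@rcomp _ _) P X)) //.
  rewrite cau_caul; last exact: (biadd_htens _ _ _ _).1.
  rewrite cau_caur; last exact: (biadd_htens _ _ _ _).2.
  rewrite (@eq_cau3 _ _ _ _ _ (fun p x y => - (htens x y ** htens p (hid _)))); last first.
    by move=> *; rewrite htens_comp hcomp1r (biaddNl (biadd_htens _ _ _ _)).
  rewrite [X in _ + X]cau3C12 [X in _ + X](@eq_cau3 _ _ _ _ _ (fun p x y => - (htens x y ** htens (hid _) p)) P); last first.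
    by move=> *; rewrite htens_comp hcomp1r (biaddNr (biadd_htens _ _ _ _)).
  rewrite -(@cau_caur _ _ _ _ _ (fun p z => - (z ** htens p (hid _)))); last first.
    by move=> * x y; rewrite (biadd_hcomp _ _ _).1 opprD.
  rewrite -(@cau_caur _ _ _ _ _ (fun p z => - (z ** htens (hid _) p))); last first.
    by move=> * x y; rewrite (biadd_hcomp _ _ _).1 opprD.
  rewrite -cauDop cau_compr; apply: eq_bigr => j _.
  rewrite /rcomp -hcompA hP -opprD -(biadd_hcomp _ _ _).2.
  by rewrite (biaddNl (biadd_hcomp _ _ _)) hcompA.
Qed.

Lemma pderiv0_const (A : lmodType K) (X : nat -> A) m :
  (forall m, pderiv X m = 0) -> X m = consts (X 0%N) m.
Proof.
by case: m => [//|m] /(_ m) h; apply: (mulrSn_inj charK (n := m)); rewrite /= mul0rn.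
Qed.

(** In (Y X)' the terms - Y P X and Y P X cancel. *)
Lemma ode_rode_inv (A : lmodType K) (P X Y : nat -> lhom A A) m :
  X 0%N = hid _ -> ode (@hcomp K _ _ _) P X -> Y 0%N = hid _ -> ode (@rcomp _ _) P Y ->
  cau (@hcomp K _ _ _) Y X m = consts (hid _) m.
Proof.
move=> X0 hX Y0 hY; rewrite pderiv0_const ?/cau ?big_ord1 ?X0 ?Y0 ?hcomp1l // => {}m.
rewrite (cau_deriv _ _ _ (biadd_hcomp _ _ _)).
rewrite (eq_cau _ (a' := cau (@rcomp _ _) P Y) (b' := X)) //.
rewrite [X in _ + X](eq_cau _ (a' := Y) (b' := cau (@hcomp K _ _ _) P X)) //.
rewrite cau_caul; last exact: (biadd_hcomp _ _ _).1.
rewrite cau_caur; last exact: (biadd_hcomp _ _ _).2.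
rewrite cau3C12 /cau3 -!big_split big1 // => i _; rewrite -big_split big1 // => j _.
rewrite -big_split big1 // => k _ /=.
by rewrite /rcomp (biaddNl (biadd_hcomp _ _ _)) hcompA addNr.
Qed.

(** In this order the product satisfies Z' = P Z - Z P, an equation that the constant series id
    solves as well. *)
Lemma rode_ode_inv (A : lmodType K) (P X Y : nat -> lhom A A) m :
  X 0%N = hid _ -> ode (@hcomp K _ _ _) P X -> Y 0%N = hid _ -> ode (@rcomp _ _) P Y ->
  cau (@hcomp K _ _ _) X Y m = consts (hid _) m.
Proof.
move=> X0 hX Y0 hY; move: m.
apply: (@ode_unique _ _ _ (fun p x => hcomp p x + rcomp p x) P charK).
- by rewrite /cau big_ord1 X0 Y0 hcomp1l.
- move=> m; rewrite (cau_deriv _ _ _ (biadd_hcomp _ _ _)).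
  rewrite (eq_cau _ (a' := cau (@hcomp K _ _ _) P X) (b' := Y)) //.
  rewrite [X in _ + X](eq_cau _ (a' := X) (b' := cau (@rcomp _ _) P Y)) //.
  rewrite cauDop; congr (_ + _).
    rewrite cau_caul; last exact: (biadd_hcomp _ _ _).1.
    rewrite cau_caur; last exact: (biadd_hcomp _ _ _).2.
    by apply: eq_cau3 => *; rewrite hcompA.
  rewrite cau_caur; last exact: (biadd_hcomp _ _ _).2.
  rewrite cau_caur; last exact: (biadd_rcomp _ _).2.
  rewrite cau3C12; apply: eq_cau3 => *.
  by rewrite /rcomp (biaddNr (biadd_hcomp _ _ _)) hcompA.
- move=> m; rewrite /pderiv mul0rn /cau big1 // => j _.
  case: (m - j)%N => [|i] /=; first by rewrite /rcomp hcomp1l hcomp1r subrr.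
  by rewrite (biadd0r (biadd_hcomp _ _ _)) (biadd0r (biadd_rcomp _ _)) addr0.
Qed.
End Composition.

(** * Exponentials *)

Section Exponential.
Variables (K : fieldType) (V : fgspace K).
Hypothesis charK : [pchar K] =i pred0.
Local Notation S := (Sym V).
Implicit Types (z : nat -> S) (P E : nat -> lhom S S).

Lemma psmulE (a b : nat -> S) : psmul a b =1 cau (@vee K V) a b. Proof. by []. Qed.

Definition grouplike z : Prop :=
  (forall m, hcop V (z m) = cau (@tens K S S) z z m) /\
  (forall m, spr 0 (z m) = psone V m).

Lemma grouplike_spr z n m : grouplike z ->
  n.+1%:R *: spr n.+1 (z m) = cau (@vee K V) (fun j => spr 1 (z j)) (fun j => spr n (z j)) m.
Proof.
case=> zcop z0; rewrite -spr_euler hstar_eval -[cop _]/(hcop V (z m)) zcop.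
rewrite /cau hom_sum hom_sum -[LHS]/(hspr V n.+1 _) hom_sum; apply: eq_bigr => j _.
by rewrite htensE /= smul_tens spr_vee1.
Qed.

(** Applying the Euler operator to a group-like series gives (n+1) z_{n+1} = z_1 v z_n in symmetric
    degrees: group-like series are exponentials of their Sym^1 part. *)
Lemma grouplike_pow z n m : grouplike z ->
  spr n (z m) = (n`!%:R)^-1 *: pspow (fun j => spr 1 (z j)) n m.
Proof.
move=> hz; elim: n m => [|n IH] m; first by rewrite (hz.2 m) fact0 invr1 scale1r.
apply: (@scale_natf_inj _ charK _ n); rewrite /= grouplike_spr // scalerA.
have -> : n.+1%:R * (n.+1`!%:R)^-1 = (n`!%:R)^-1 :> K.
  by rewrite factS natrM invfM mulrA mulfV ?mul1r // (nat_succ_neq0 charK).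
rewrite /= /psmul scaler_sumr.
by apply: eq_bigr => j _; rewrite IH veeZr.
Qed.

Lemma eq_pspow (a b : nat -> S) n m : (forall j, (j <= m)%N -> a j = b j) ->
  pspow a n m = pspow b n m.
Proof.
elim: n m => //= n IH m e; rewrite !psmulE; apply: eq_cau => // j jm.
by apply: IH => i ij; apply: e; lia.
Qed.

Lemma pspow_gt (a : nat -> S) n m : a 0%N = 0 -> (m < n)%N -> pspow a n m = 0.
Proof.
move=> a0; elim: n m => // n IH m lt /=; rewrite /psmul big1 // => j _.
case: (unliftP ord0 j) => [i ->|->]; last by rewrite a0 vee0l.
by rewrite lift0 IH ?vee0r //; have := ltn_ord i; lia.
Qed.

Lemma psexp_stable (a : nat -> S) N m : a 0%N = 0 -> (m < N)%N ->
  psexp N a m = psexp m.+1 a m.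
Proof.
move=> a0 lt; rewrite /psexp.
rewrite [RHS](big_ord_widen N (fun n => (n`!%:R)^-1 *: pspow a n m)) //.
rewrite [RHS]big_mkcond; apply: eq_bigr => n _; case: ifP => // h.
by rewrite pspow_gt ?scaler0 //; lia.
Qed.

Lemma eq_psexp N (a b : nat -> S) m : (forall j, (j <= m)%N -> a j = b j) ->
  psexp N a m = psexp N b m.
Proof. by move=> e; apply: eq_bigr => n _; rewrite (eq_pspow n e). Qed.

Lemma grouplike_psexp z N m : grouplike z -> spr 1 (z 0%N) = 0 -> (m < N)%N ->
  psexp N (fun j => spr 1 (z j)) m = z m.
Proof.
move=> hz z0 lt; have [n hn] := spr_sum (z m).
(* The truncation is pushed far enough to contain every symmetric component of this coefficient. *)
rewrite (psexp_stable _ lt) // -(@psexp_stable _ (maxn n m.+1)) // ?leq_maxr //.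
rewrite [RHS](hn (maxn n m.+1) _).1 ?leq_maxl //.
by apply: eq_bigr => k _; rewrite grouplike_pow.
Qed.

Lemma comults_grouplike (X : nat -> lhom S S) : comults X ->
  (forall m, spr 0 (X m (sone V)) = psone V m) -> grouplike (fun m => X m (sone V)).
Proof.
move=> hX X0; split=> // m; rewrite -hcompE hX hcompE.
rewrite hom_sumE; apply: eq_bigr => j _.
by rewrite /= cop_unsh htensE.
Qed.

Lemma evcoder_mul (x : S) : gr1 0 x -> evcoder (hmul x).
Proof.
move=> hx; rewrite /evcoder (hcop_mul hx) (biadd_hcomp _ _ _).1; congr (_ + _ ** _).
by congr htens; apply: mon_ext => w; rewrite /= sgnop_mon ksgn0l scale1r.
Qed.

Lemma gr1Mn i (x : S) n : gr1 i x -> gr1 i (x *+ n).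
Proof.
move=> /gr1P[e d]; apply/gr1P; split.
  by rewrite -scaler_nat (linZ (@spr_linear K V 1)) e.
by rewrite -scaler_nat; apply: lspanZ.
Qed.

Lemma gr1N i (x : S) : gr1 i x -> gr1 i (- x).
Proof.
move=> /gr1P[e d]; apply/gr1P; rewrite -scaleN1r; split; last exact: lspanZ.
by rewrite (linZ (@spr_linear K V 1)) e.
Qed.

Lemma spr0_gr1 i (x : S) : gr1 i x -> spr 0 x = 0.
Proof. by move=> /gr1P[<- _]; rewrite spr_spr. Qed.
Lemma spr1_gr1 i (x : S) : gr1 i x -> spr 1 x = x.
Proof. by move=> /gr1P[]. Qed.

Section Exp.
Variables (p : nat -> S) (E : nat -> lhom S S).
Hypotheses (pg : forall j, gr1 0 (p j)) (p0 : p 0%N = 0).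
Hypotheses (E0 : E 0%N = hid _) (hE : ode (@hcomp K _ _ _) (fun j => hmul (pderiv p j)) E).

Lemma pderiv_gr1 j : gr1 0 (pderiv p j). Proof. exact: gr1Mn. Qed.

(** Obtaining exp(p) as the flow of multiplication by p' makes it comultiplicative, hence group-like
    at 1, without expanding powers. *)
Lemma exp_comults : comults E.
Proof. by apply: (ode_comults charK _ E0 hE) => j; apply/evcoder_mul/pderiv_gr1. Qed.

Lemma exp_eval m x : pderiv (fun m => E m x) m = cau (@vee K V) (pderiv p) (fun m => E m x) m.
Proof.
rewrite /pderiv -homMnE -[_ *+ _]/(pderiv E m) hE hom_sumE.
by apply: eq_bigr => j _; rewrite hcompE hmulE.
Qed.

Lemma exp_spr0 m : spr 0 (E m (sone V)) = psone V m.
Proof.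
case: m => [|m]; first by rewrite E0 sprsone.
apply: (mulrSn_inj charK (n := m)); rewrite /= mul0rn -(homMnE (hspr V 0)).
rewrite [LHS](_ : _ = spr 0 (pderiv (fun m => E m (sone V)) m)); last first.
  by rewrite /pderiv -!scaler_nat (linZ (@spr_linear K V 0)).
rewrite exp_eval -[LHS]/(hspr V 0 _) hom_sum big1 // => j _ /=.
by rewrite spr0_vee (spr0_gr1 (pderiv_gr1 j)) vee0l.
Qed.

Lemma exp_grouplike : grouplike (fun m => E m (sone V)).
Proof. exact: comults_grouplike exp_comults exp_spr0. Qed.

Lemma exp_spr1 m : spr 1 (E m (sone V)) = p m.
Proof.
case: m => [|m]; first by rewrite E0 sprsone p0.
apply: (mulrSn_inj charK (n := m)) => /=.
rewrite [LHS](_ : _ = spr 1 (pderiv (fun m => E m (sone V)) m)); last first.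
  by rewrite /pderiv -!scaler_nat (linZ (@spr_linear K V 1)).
rewrite exp_eval -[LHS]/(hspr V 1 _) hom_sum.
transitivity (cau (@vee K V) (pderiv p) (consts (sone V)) m).
  apply: eq_bigr => j _ /=; rewrite spr1_vee (spr0_gr1 (pderiv_gr1 j)) vee0l add0r.
  by rewrite (spr1_gr1 (pderiv_gr1 j)) exp_spr0.
by rewrite (cau_constsr _ _ _ (biadd_vee V)) vee1r.
Qed.

Lemma exp_psexp N m : (m < N)%N -> psexp N p m = E m (sone V).
Proof.
move=> lt; rewrite -(grouplike_psexp exp_grouplike _ lt); last by rewrite exp_spr1 p0.
by apply: eq_psexp => j _; rewrite exp_spr1.
Qed.

Lemma exp_mul m : E m = hmul (E m (sone V)).
Proof.
move: m; apply: (@ode_unique _ _ _ (@hcomp K _ _ _) _ charK) hE _.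
  by rewrite E0 hmul_one.
move=> m; rewrite (@pderiv_map _ _ (@hmul K V)); last exact: hmulD.
rewrite exp_eval (additive_sum (@hmulD K V)); apply: eq_bigr => j _.
by rewrite hmul_vee.
Qed.

Lemma exp_deg m : hdeg 0 (E m).
Proof.
apply: (ode_ind charK (C := hdeg 0)) hE m; [exact: hdeg0|exact: hdegP| |by rewrite E0; apply: hdeg_id].
by move=> j x hx; apply: hdeg_comp0l => //; apply: hdeg_mul; case/gr1P: (pderiv_gr1 j).
Qed.

Lemma exp_comm m i x : sdeg i x -> E m ** hmul x = hmul x ** E m.
Proof.
move=> hx; rewrite exp_mul -!hmul_vee; congr hmul.
have h : sdeg 0 (E m (sone V)).
  by have := exp_deg m (sdeg_mon [::]); rewrite wdeg0 addr0.
by rewrite (veeC h hx) ksgn0l scale1r.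
Qed.
End Exp.

(** Multiplications by elements of degree 0 commute with E', so the left equation with -p' is also
    the right equation [rcomp] with p'. *)
Lemma exp_inv p E E' m : (forall j, gr1 0 (p j)) ->
  E 0%N = hid _ -> ode (@hcomp K _ _ _) (fun j => hmul (pderiv p j)) E ->
  E' 0%N = hid _ -> ode (@hcomp K _ _ _) (fun j => hmul (pderiv (fun j => - p j) j)) E' ->
  cau (@hcomp K _ _ _) E' E m = consts (hid _) m.
Proof.
move=> pg E0 hE E'0 hE'; apply: (@ode_rode_inv _ charK _ _ E E' m E0 hE E'0) => {}m; rewrite hE' cauC.
rewrite [RHS]cauC; apply: eq_bigr => j _ /=.
have pg' i : gr1 0 (- p i) by apply: gr1N.
rewrite /rcomp; have [_ d] := (gr1P _ _).1 (pderiv_gr1 pg (m - j)).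
rewrite (exp_comm pg' E'0 hE' _ d).
by rewrite /pderiv mulNrn (additiveN (@hmulD K V)) (biaddNl (biadd_hcomp _ _ _)).
Qed.
End Exponential.

(** * The flow of a gauge parameter *)

Lemma complete_shift (K : fieldType) (L : fgspace K) s :
  complete_filtration L -> complete_filtration (shift L s).
Proof.
case=> h1 h2 h3 h4 h5 h6; split.
- by move=> k i; apply: h1.
- by move=> k i; apply: h2.
- by move=> k i; apply: h3.
- by move=> i; apply: h4.
- by move=> i; apply: h5.
- by move=> i; apply: h6.
Qed.

(** * Sums over tuples of indices with prescribed total *)

Section TupleSums.
Variables (A : Type) (C : nmodType) (M : nat).

Lemma sum_tuple_cons n m (G : 'I_M -> n.-tuple 'I_M -> C) :
  \sum_(j : n.+1.-tuple 'I_M | (\sum_(x <- j) (x : nat) == m)%N) G (thead j) (behead_tuple j) =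
  \sum_(i < M) \sum_(t : n.-tuple 'I_M | (i + \sum_(x <- t) (x : nat) == m)%N) G i t.
Proof.
pose h (p : 'I_M * n.-tuple 'I_M) : n.+1.-tuple 'I_M := [tuple of p.1 :: p.2].
rewrite (reindex h) /=; last first.
  exists (fun t : n.+1.-tuple 'I_M => (thead t, behead_tuple t)).
    by move=> [b t] _; congr pair; apply/val_inj.
  by move=> t _; rewrite [RHS]tuple_eta; apply/val_inj.
rewrite pair_big_dep /=; apply: eq_big => [[i t]|[i t] _] /=; first by rewrite big_cons.
by rewrite theadE; congr (G _ _); apply/val_inj.
Qed.
End TupleSums.

(** Translates the tuple sums of [flow_coef] into iterated Cauchy products. *)
Lemma sum_tuple_cau (A : Type) (C : zmodType) M n m (a : nat -> A) (op : A -> C -> C) (e : C) :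
  (forall x, {morph op x : y z / y + z}) -> (m < M)%N ->
  \sum_(t : n.-tuple 'I_M | (\sum_(x <- t) (x : nat) == m)%N)
     foldr op e [seq a (x : 'I_M) | x <- t] = iter n (cau op a) (consts e) m.
Proof.
move=> opD; elim: n m => [|n IH] m mM.
  rewrite (eq_bigl (fun t : 0.-tuple 'I_M => (m == 0%N) && (t == [tuple]))) => [|t].
    case: m mM => [|m] mM; first by rewrite /= (big_pred1 [tuple]).
    by rewrite big_pred0.
  by rewrite [t]tuple0 big_nil eqxx andbT eq_sym.
rewrite (eq_bigr (fun j : n.+1.-tuple 'I_M =>
  op (a (thead j)) (foldr op e [seq a (x : 'I_M) | x <- behead_tuple j]))); last first.
  by move=> j _; rewrite {1}(tuple_eta j).
rewrite (sum_tuple_cons _ (fun i (t : n.-tuple 'I_M) => op (a i) (foldr op e [seq a (x : 'I_M) | x <- t]))).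
rewrite /= (cauE _ _ _ mM); apply: eq_bigr => i _.
rewrite -(additive_sum (opD _)).
have [le|lt] := leqP i m; last first.
  rewrite big_pred0 ?(additive0 (opD _)) ?big_pred0 // => [j|t]; lia.
rewrite (eq_bigl (fun t : n.-tuple 'I_M => (\sum_(x <- t) (x : nat) == m - i)%N)); last first.
  by move=> t; lia.
rewrite IH; last by lia.
rewrite -(@sum_nat_eq _ M (m - i) (fun j => op (a i) (iter n (cau op a) (consts e) j))); last by lia.
by apply: eq_bigl => j; lia.
Qed.

Section Flow.
Variables (K : fieldType) (L : fgspace K) (Q : Sym (shift L 1) -> Sym (shift L 1)).
Hypotheses (charK : [pchar K] =i pred0) (hQ : flat_Linfty Q).
Local Notation V := (shift L 1).
Local Notation S := (Sym V).

Definition codiff : lhom S S := LHom (Linfty_linear hQ).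
Local Notation q := codiff.

Lemma hVc : complete_filtration V.
Proof. exact/complete_shift/(Linfty_complete hQ). Qed.

Lemma codiff_cop : hcop V ** q = htens q (hid _) ** hcop V + htens (hsgn V 1) q ** hcop V.
Proof.
apply: hom_ext => x; rewrite hom_evalD !hcompE !htens_tmap.
exact: (Linfty_coder hQ).
Qed.

Lemma codiff_deg : hdeg 1 q.
Proof. by move=> i x hx; rewrite addrC; apply: (Linfty_deg hQ); exists x. Qed.

Lemma codiff_fil : hfil 0 q.
Proof. by move=> k x hx; rewrite add0r; apply: (Linfty_fil hQ); exists x. Qed.

Lemma codiffK : q ** q = 0.
Proof. by apply: hom_ext => x; exact: (Linfty_sqr hQ). Qed.

Lemma codiff_spr0 : hspr V 0 ** q = 0.
Proof.
apply: (@coders_spr0 K V V 1 (consts (hid S)) (consts q) 0).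
  by apply: coders_const; rewrite codiff_cop hcomp1l.
by case=> [|j] /=; rewrite ?hcomp1r ?heps_spr ?(biadd0r (biadd_hcomp _ _ _)).
Qed.

Variable l : nat -> S.
Hypothesis lg : forall j, gr1 (-1) (l j).

(** [Q, lambda v -]: a coderivation, since lambda v - is one up to its value
    lambda at 1. *)
Definition gauge_op (j : nat) : lhom S S := q ** hmul (l j) + hmul (l j) ** q.
Local Notation P := gauge_op.

(** The anticommutator of two odd coderivations is an even one: q has degree 1, multiplication by
    lambda degree -1, and both obey the rule with the sign operator [hsgn V 1]. *)
Lemma gauge_evcoder j : evcoder (P j).
Proof.
have hl := hcop_mul (lg j); rewrite hsgnN in hl.
have ld : hdeg (-1) (hmul (l j)) by case/gr1P: (lg j) => _; apply: hdeg_mul.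
have s1 : ksgn K 1 1 = -1 by rewrite /ksgn mulr1 expr1z.
have s2 : ksgn K 1 (-1) = -1 by rewrite ksgnC ksgn_opp.
have sq : hsgn V 1 ** q = - (q ** hsgn V 1).
  by rewrite (hsgn_comm _ codiff_deg) s1 scaleN1r.
have sl : hsgn V 1 ** hmul (l j) = - (hmul (l j) ** hsgn V 1).
  by rewrite (hsgn_comm _ ld) s2 scaleN1r.
have [cD1 cD2] := (biadd_hcomp S (tensor S S) (tensor S S)).
have E (f g : lhom S S) :
  hcop V ** f = htens f (hid _) ** hcop V + htens (hsgn V 1) f ** hcop V ->
  hcop V ** g = htens g (hid _) ** hcop V + htens (hsgn V 1) g ** hcop V ->
  hcop V ** (f ** g) = (htens (f ** g) (hid _) + htens (f ** hsgn V 1) g +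
    htens (hsgn V 1 ** g) f + htens (hid _) (f ** g)) ** hcop V.
  move=> hf hg; rewrite hcompA hf -(biadd_hcomp _ _ _).1 -hcompA hg.
  rewrite -(biadd_hcomp _ _ _).1 hcompA; congr (_ ** _).
  rewrite (biadd_hcomp _ _ _).1 !(biadd_hcomp _ _ _).2 !htens_comp !hcomp1l !hcomp1r hsgnK.
  by rewrite !addrA.
rewrite /evcoder /P (biadd_hcomp _ _ _).2 (E _ _ codiff_cop hl) (E _ _ hl codiff_cop).
rewrite -(biadd_hcomp _ _ _).1; congr (_ ** _).
rewrite sq sl !(biaddNl (biadd_htens _ _ _ _)) (biadd_htens _ _ _ _).1 (biadd_htens _ _ _ _).2.
(* The two mixed terms occur with opposite signs in the two orders of composition and cancel. *)
set b := htens (q ** hsgn V 1) _; set c := htens _ q.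
rewrite [LHS]addrACA; congr (_ + _); rewrite -(addrA _ b) -(addrA _ c) [LHS]addrACA.
by rewrite -(opprB c b) addNr addr0.
Qed.

Lemma gauge_comm j : P j ** q = q ** P j.
Proof.
rewrite /P (biadd_hcomp _ _ _).1 (biadd_hcomp _ _ _).2 -!hcompA codiffK.
by rewrite (hcompA q q) codiffK !(biadd0r (biadd_hcomp _ _ _)) (biadd0l (biadd_hcomp _ _ _)) addrC.
Qed.

Lemma gauge_deg j : hdeg 0 (P j).
Proof.
have ld : hdeg (-1) (hmul (l j)) by case/gr1P: (lg j) => _; apply: hdeg_mul.
by apply: hdegD; [exact: (hdeg_comp codiff_deg ld) | exact: (hdeg_comp ld codiff_deg)].
Qed.

Lemma gauge_fil k j : sfil k (l j) -> hfil k (P j).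
Proof.
move=> hl; have hf := hfil_mul hl; apply: (filtD (hfil_filtration _ _)).
  exact: (hfil_comp0l codiff_fil hf).
exact: (hfil_comp0r hf codiff_fil).
Qed.

Lemma gauge_spr0 j : hspr V 0 ** P j = 0.
Proof.
rewrite /P (biadd_hcomp _ _ _).2 hcompA codiff_spr0 (biadd0l (biadd_hcomp _ _ _)) add0r.
apply: hom_ext => x; rewrite hcompE hcompE hmulE /= spr0_vee (spr0_gr1 (lg j)).
by rewrite vee0l.
Qed.

Section FlowOf.
Variable Psi : nat -> lhom S S.
Hypotheses (Psi0 : Psi 0%N = hid _) (hPsi : ode (@hcomp K _ _ _) P Psi).

Lemma gflow_comults : comults Psi.
Proof. by apply: (ode_comults charK _ Psi0 hPsi) => j; apply: gauge_evcoder. Qed.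

Lemma gflow_comm m : Psi m ** q = q ** Psi m.
Proof.
apply: (ode_ind charK (C := fun f => f ** q = q ** f)) hPsi m.
- by rewrite (biadd0r (biadd_hcomp _ _ _)) (biadd0l (biadd_hcomp _ _ _)).
- move=> a x y hx hy; rewrite (biadd_hcomp _ _ _).1 (biadd_hcomp _ _ _).2.
  by rewrite hcompZl hcompZr hx hy.
- by move=> j x hx; rewrite -hcompA hx hcompA gauge_comm hcompA.
- by rewrite Psi0 hcomp1l hcomp1r.
Qed.

Lemma gflow_deg m : hdeg 0 (Psi m).
Proof.
apply: (ode_ind charK (C := hdeg 0)) hPsi m; [exact: hdeg0|exact: hdegP| |].
  by move=> j x hx; apply: hdeg_comp0l => //; apply: gauge_deg.
by rewrite Psi0; apply: hdeg_id.
Qed.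

Lemma gflow_spr0 m : hspr V 0 ** Psi m = consts (hspr V 0) m.
Proof.
case: m => [|m]; first by rewrite Psi0 hcomp1r.
apply: (mulrSn_inj charK (n := m)); rewrite /= mul0rn.
rewrite -(additiveMn ((biadd_hcomp _ _ _).2 (hspr V 0))) -[_ *+ _]/(pderiv Psi m) hPsi.
rewrite cau_compl /cau big1 // => j _.
by rewrite hcompA gauge_spr0 (biadd0l (biadd_hcomp _ _ _)).
Qed.

Local Notation y := (fun m => Psi m (sone V)).

Lemma gflow_grouplike : grouplike y.
Proof.
apply: (comults_grouplike gflow_comults) => m.
rewrite -[LHS]/((hspr V 0 ** Psi m) (sone V)) gflow_spr0.
by case: m => [|m] //=; rewrite sprsone.
Qed.

Lemma gflow_one_closed m : Q (y m) = 0.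
Proof.
rewrite -[LHS]/((q ** Psi m) (sone V)) -gflow_comm hcompE /= (Linfty_flat hQ).
exact: hom_zero.
Qed.

(** The summand lambda v Q(y) vanishes since y is closed. What is left is the gauge equation with y
    in the place of exp(pi). *)
Lemma gflow_one_ode m : pderiv y m = Q (cau (@vee K V) l y m).
Proof.
rewrite /pderiv -homMnE -[_ *+ _]/(pderiv Psi m) hPsi hom_sumE.
rewrite -[RHS]/(q (cau _ _ _ _)) hom_sum; apply: eq_bigr => j _.
rewrite hcompE hom_evalD !hcompE !hmulE [q (Psi _ _)]gflow_one_closed vee0r addr0 //.
Qed.

Variable pt : nat -> S.
Hypotheses (pt0 : pt 0%N = 0).
Hypothesis ptE : forall m, pderiv pt m = spr 1 (Q (cau (@vee K V) l (psexp m.+1 pt) m)).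

(** Since y is the exponential of its Sym^1 part, that part satisfies the same recursion as pi:
    coefficient m+1 is determined by those up to m. *)
Lemma gflow_one_spr1 m : spr 1 (y m) = pt m.
Proof.
elim/ltn_ind: m => -[|m] IH; first by rewrite Psi0 sprsone.
apply: (mulrSn_inj charK (n := m)); rewrite /= -[RHS]/(pderiv pt m) ptE.
rewrite -scaler_nat -(linZ (@spr_linear K V 1)) scaler_nat -[_ *+ _]/(pderiv y m).
rewrite gflow_one_ode; congr (spr 1 (Q _)); apply: eq_cau => // j jm.
rewrite -(@grouplike_psexp _ _ charK _ m.+1 j gflow_grouplike) //.
  by apply: eq_psexp => i ij; apply: IH; lia.
by rewrite Psi0 sprsone.
Qed.

Lemma gflow_one_exp N m : (m < N)%N -> psexp N pt m = y m.
Proof.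
move=> lt; rewrite /= -(@grouplike_psexp _ _ charK _ N m gflow_grouplike) //.
  refine (@eq_psexp K V N _ _ m _); by move=> i ij; rewrite gflow_one_spr1.
by rewrite Psi0 sprsone.
Qed.
End FlowOf.

(** ** The path of Maurer-Cartan elements *)

Lemma flow_coefE (pt lt : nat -> S) m n :
  flow_coef (bracket Q) pt lt m n = spr 1 (Q (cau (@vee K V) lt (pspow pt n) m)).
Proof.
rewrite /flow_coef /bracket.
transitivity (hspr V 1 (q (\sum_(j : n.+1.-tuple 'I_m.+1 | (\sum_(x <- j) (x : nat) == m)%N)
    vee (lt (thead j)) (foldr (@vee _ _) (sone _) [seq pt (x : 'I_m.+1) | x <- behead_tuple j])))).
  rewrite !hom_sum; apply: eq_bigr => j _ /=; congr (spr 1 (Q (vee _ _))).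
  by rewrite -map_comp.
congr (spr 1 (Q _)).
rewrite (sum_tuple_cons _ (fun i (t : n.-tuple 'I_m.+1) =>
  vee (lt i) (foldr (@vee _ _) (sone _) [seq pt (x : 'I_m.+1) | x <- t]))).
rewrite /cau; apply: eq_bigr => i _; rewrite -(additive_sum ((biadd_vee V).2 _)).
congr vee; rewrite -[RHS](@sum_tuple_cau _ _ m.+1 n (m - i)%N pt (@vee K V) (sone V)).
- by apply: eq_bigl => t; have := ltn_ord i; lia.
- exact: (biadd_vee V).2.
- by lia.
Qed.

Lemma cau_psexp (lt pt : nat -> S) N m :
  cau (@vee K V) lt (psexp N pt) m =
  \sum_(n < N) (n`!%:R)^-1 *: cau (@vee K V) lt (pspow pt n) m.
Proof.
rewrite /cau; under [RHS]eq_bigr => n _ do rewrite scaler_sumr.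
rewrite exchange_big; apply: eq_bigr => j _; rewrite /psexp (biadd_sumr (biadd_vee V)).
by apply: eq_bigr => n _; rewrite veeZr.
Qed.

Lemma spr1_flim (u : nat -> S) a b m : spr 1 a = a -> spr 1 b = b ->
  flim (@sfil K V) u b -> (forall N, (m < N)%N -> u N = a) -> a = b.
Proof.
move=> ea eb /flimE h e; apply/eqP; rewrite -subr_eq0; apply/eqP.
apply: (spr1_sep hVc) => [|k].
  by rewrite -[LHS]/(hspr V 1 _) hom_sub /= ea eb.
have [N hN] := h k; rewrite -(e (maxn N m.+1)) ?leq_maxr //; apply: hN.
exact: leq_maxl.
Qed.

Lemma spr1K (x : S) : spr 1 (spr 1 x) = spr 1 x. Proof. by rewrite spr_spr. Qed.

(** As pi(0) = 0, the partial sums in the coefficient of t^m are constant from N = m+1 on, and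
    separation of Sym^1 turns the limit into an exact equality. *)
Lemma MC_equiv_ode p0 p1 pt lt : MC_equiv_via Q p0 p1 pt lt -> p0 = 0 ->
  [/\ pt 0%N = 0, forall j, gr1 0 (pt j), forall j, gr1 (-1) (lt j) &
    forall m, pderiv pt m = spr 1 (Q (cau (@vee K V) lt (psexp m.+1 pt) m))].
Proof.
move=> [[hp _] [hl _] h <- _] p00; split=> // [j|j|m]; [by have [] := hp j|by have [] := hl j|].
rewrite /pderiv -scaler_nat; apply/esym; apply: (@spr1_flim _ _ _ m _ _ (h m)).
- exact: spr1K.
- by rewrite (linZ (@spr_linear K V 1)) (spr1_gr1 (hp _).1).
move=> N lt'; transitivity (spr 1 (Q (cau (@vee K V) lt (psexp N pt) m))).
  rewrite cau_psexp -[RHS]/(hspr V 1 (q _)) !hom_sum; apply: eq_bigr => n _.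
  by rewrite !hom_scale /= flow_coefE.
congr (spr 1 (Q _)); apply: eq_cau => // j jm.
by rewrite [LHS]psexp_stable ?[RHS]psexp_stable //; lia.
Qed.
End Flow.

(** The Taylor coefficient kills 1, so by the Euler recursion each further symmetric degree in the
    target needs one more letter in the source. *)
Lemma comults_van (K : fieldType) (V W : fgspace K) (F : nat -> lhom (Sym V) (Sym W)) :
  [pchar K] =i pred0 -> comults F -> (forall m, F m (sone V) = psone W m) ->
  forall n m, hvan n (hspr W n ** F m).
Proof.
move=> charK hF F1 n; elim: n => [|n IH] m w // lt.
have e := congr1 (fun f => hom_fun f (mon w)) (comults_spr n m hF).
apply: (@scale_natf_inj _ charK _ n); rewrite scaler0; apply: etrans e _.
rewrite hom_sumE big1 // => j _; apply: (@hvan_star _ _ _ 1 n) (lt); last exact: IH.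
case=> // _; rewrite hcompE F1; case: (nat_of_ord j) => [|i] /=; last exact: spr_zero.
by rewrite sprsone.
Qed.

(** Brings the values on words to the range 1 <= k <= i in which the defining equation of the
    associated flow is summed. *)
Lemma comults_split (K : fieldType) (V W : fgspace K) (F : nat -> lhom (Sym V) (Sym W)) :
  [pchar K] =i pred0 -> comults F -> (forall m, F m (sone V) = psone W m) ->
  forall m w, w != [::] ->
  F m (mon w) = \sum_(1 <= k < (size w).+1) spr k (F m (mon w)).
Proof.
move=> charK hF F1 m w w0; have [n hn] := spr_sum (F m (mon w)).
have [e _] := hn (maxn n (size w).+1) (leq_maxl _ _).
rewrite {1}e -(big_mkord xpredT (fun k => spr k (F m (mon w)))).
rewrite (@big_cat_nat _ _ _ 1) ?leq_max ?orbT //= big_nat1.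
have -> : spr 0 (F m (mon w)) = 0.
  rewrite -[LHS]/((hspr W 0 ** F m) (mon w)) (comults_counit hF F1).
  by case: m {e hn} => [|m] //=; rewrite hepsE; case: w w0.
rewrite add0r (@big_cat_nat _ _ _ (size w).+1) ?leq_maxr //= [X in _ + X]big_nat.
rewrite [X in _ + X]big1 ?addr0 // => k /andP[lt _].
exact: (comults_van charK hF F1) lt.
Qed.

(** * Identification of the associated flow with exp(-pi(t)) v Psi_t *)

Section AssociatedFlow.
Variables (K : fieldType) (L : fgspace K) (Q : Sym (shift L 1) -> Sym (shift L 1)).
Hypotheses (charK : [pchar K] =i pred0) (hQ : flat_Linfty Q).
Local Notation V := (shift L 1).
Local Notation S := (Sym V).
Local Notation q := (codiff hQ).
Variables (l : nat -> S) (lg : forall j, gr1 (-1) (l j)).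
Local Notation P := (gauge_op hQ l).
Variable Psi : nat -> lhom S S.
Hypotheses (Psi0 : Psi 0%N = hid _) (hPsi : ode (@hcomp K _ _ _) P Psi).
Variables (pt : nat -> S) (E E' : nat -> lhom S S).
Hypotheses (ptg : forall j, gr1 0 (pt j)) (pt0 : pt 0%N = 0).
Hypothesis Psi1 : forall m, spr 1 (Psi m (sone V)) = pt m.
Hypotheses (E0 : E 0%N = hid _) (hE : ode (@hcomp K _ _ _) (fun j => hmul (pderiv pt j)) E).
Hypotheses (E'0 : E' 0%N = hid _)
  (hE' : ode (@hcomp K _ _ _) (fun j => hmul (pderiv (fun j => - pt j) j)) E').

Definition twisted_flow : nat -> lhom S S := cau (@hcomp K _ _ _) E' Psi.
Local Notation phi := twisted_flow.

Let ptg' j : gr1 0 (- pt j). Proof. exact: gr1N. Qed.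

Lemma exp_inv' m : cau (@hcomp K _ _ _) E E' m = consts (hid _) m.
Proof.
apply: (exp_inv charK m ptg' E'0 hE' E0) => {}m; rewrite hE; apply: eq_bigr => j _.
by rewrite /pderiv opprK.
Qed.

(** Two group-like series with the same Sym^1 part are the same exponential. *)
Lemma flow_one_exp m : Psi m (sone V) = E m (sone V).
Proof.
rewrite -(exp_psexp charK ptg pt0 E0 hE (ltnSn m)).
rewrite -(@grouplike_psexp _ _ charK _ _ _ (gflow_grouplike charK lg Psi0 hPsi) _ (ltnSn m)).
  by refine (@eq_psexp K V _ _ _ m _); move=> i ij; rewrite Psi1.
by rewrite Psi1.
Qed.

Lemma twisted_flow_comults : comults phi.
Proof.
by apply: comults_comp; [exact: (exp_comults charK ptg' E'0 hE') |
  exact: (gflow_comults charK lg Psi0 hPsi)].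
Qed.

Lemma twisted_flow_one m : phi m (sone V) = psone V m.
Proof.
transitivity (cau (@hcomp K _ _ _) E' E m (sone V)).
  by rewrite !hom_sumE; apply: eq_bigr => j _; rewrite !hcompE flow_one_exp.
by rewrite (exp_inv charK m ptg E0 hE E'0 hE'); case: m.
Qed.

Lemma twisted_flow_spr0 m : hspr V 0 ** phi m = consts (heps V V) m.
Proof. exact: (comults_counit twisted_flow_comults twisted_flow_one). Qed.

Lemma exp_twisted_flow m : cau (@hcomp K _ _ _) E phi m = Psi m.
Proof.
rewrite cau_caur; last exact: (biadd_hcomp _ _ _).2.
rewrite (@eq_cau3 _ _ _ _ _ (fun x y z => x ** y ** z)) => [|*]; last by rewrite hcompA.
rewrite -(@cau_caul _ _ _ _ _ (@hcomp K _ _ _)); last exact: (biadd_hcomp _ _ _).1.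
rewrite (eq_cau _ (a' := consts (hid _)) (b' := Psi)) // => [|j _]; last exact: exp_inv'.
by rewrite (cau_constsl _ _ _ (biadd_hcomp _ _ _)) hcomp1l.
Qed.

Lemma codiff_spr0E x : spr 0 (q x) = 0.
Proof. by have /(congr1 (fun f => hom_fun f x)) := codiff_spr0 hQ. Qed.

Lemma spr0_twisted_flow m x : spr 0 (phi m x) = consts (heps V V) m x.
Proof. by rewrite -twisted_flow_spr0. Qed.

(** Coefficient of t^m in the twisted codifferential (Q^{pi(t)})^1 applied to lambda v z, with the
    exponentials written as the operators [E] and [E']. *)
Definition flow_rhs (z : nat -> S) (m : nat) : S :=
  spr 1 (cau (fun (f : lhom S S) x => f x) E'
    (fun j => q (cau (fun (f : lhom S S) x => f x) E (cau (@vee K V) l z) j)) m).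

(** Differentiating exp(-pi) Psi gives -pi' v phi plus exp(-pi) (q lambda + lambda q) Psi. On a
    nonempty word only exp(-pi) q lambda Psi contributes to Sym^1. *)
Lemma twisted_flow_ode w m : w != [::] ->
  spr 1 (pderiv phi m (mon w)) = flow_rhs (fun j => phi j (mon w)) m.
Proof.
move=> w0; have phw j : spr 0 (phi j (mon w)) = 0.
  by rewrite spr0_twisted_flow; case: j => [|j] //=; rewrite hepsE; case: w w0.
rewrite (cau_deriv _ _ _ (biadd_hcomp _ _ _)).
rewrite (eq_cau _ (a' := cau (@hcomp K _ _ _) (fun j => hmul (pderiv (fun j => - pt j) j)) E')
  (b' := Psi)) //.
rewrite [X in _ + X](eq_cau _ (a' := E') (b' := cau (@hcomp K _ _ _) P Psi)) //.
have -> : cau (@hcomp K _ _ _) (cau (@hcomp K _ _ _)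
    (fun j => hmul (pderiv (fun j => - pt j) j)) E') Psi m =
    cau (@hcomp K _ _ _) (fun j => hmul (pderiv (fun j => - pt j) j)) phi m.
  rewrite cau_caul; last exact: (biadd_hcomp _ _ _).1.
  rewrite cau_caur; last exact: (biadd_hcomp _ _ _).2.
  by apply: eq_cau3 => *; rewrite hcompA.
(* The term -pi' v phi(w) has no part in Sym^1 because phi(w) has none in Sym^0. *)
rewrite hom_evalD -[LHS]/(hspr V 1 _) hom_add hom_sumE hom_sum big1 ?add0r => [|j _]; last first.
  rewrite hcompE hmulE /= spr1_vee phw vee0r addr0.
  by rewrite (spr0_gr1 (pderiv_gr1 ptg' j)) vee0l.
rewrite cau_caur; last exact: (biadd_hcomp _ _ _).2.
have -> : cau3 (fun x y z => x ** (y ** z)) E' P Psi m =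
  cau3 (fun x y z => x ** q ** (hmul y ** z)) E' l Psi m +
  cau3 (fun x y z => x ** hmul y ** q ** z) E' l Psi m.
  rewrite -big_split; apply: eq_bigr => i _; rewrite -big_split; apply: eq_bigr => j _.
  rewrite -big_split; apply: eq_bigr => k _ /=.
  by rewrite (biadd_hcomp _ _ _).1 (biadd_hcomp _ _ _).2 !hcompA.
(* Since exp(-pi) commutes with lambda and Psi with q, this term is lambda v phi(q w); its Sym^1
   part needs the Sym^0 part of phi(q w), which is zero. *)
rewrite hom_evalD hom_add [X in _ + X](_ : _ = 0) ?addr0; last first.
  rewrite (@eq_cau3 _ _ _ _ _ (fun x y z => hmul y ** (x ** z) ** q)) => [|i j k]; last first.
    rewrite (exp_comm charK ptg' E'0 hE' i (proj2 ((gr1P _ _).1 (lg j)))).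
    by rewrite -!hcompA (gflow_comm charK Psi0 hPsi).
  rewrite cau3C12 -(@cau_caur _ _ _ _ _ (fun y t => hmul y ** t ** q) (@hcomp K _ _ _)).
    rewrite hom_sumE hom_sum big1 // => j _.
    rewrite !hcompE hmulE /= spr1_vee (spr0_gr1 (lg j)) vee0l add0r.
    rewrite -/phi spr0_twisted_flow.
    case: (m - j)%N => [|i] /=; last by rewrite vee0r.
    by rewrite heps_spr [hspr _ _ _]codiff_spr0E vee0r.
  by move=> y f g /=; rewrite (biadd_hcomp _ _ _).2 (biadd_hcomp _ _ _).1.
congr (spr 1 _).
pose ap (f : lhom S S) (x : S) := f x.
(* It remains to replace Psi by exp(pi) phi and to move exp(pi) past lambda. *)
transitivity (cau ap E' (fun j => q (cau (@vee K V) l (fun j => Psi j (mon w)) j)) m).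
  have -> : cau ap E' (fun j => q (cau (@vee K V) l (fun j => Psi j (mon w)) j)) m =
    cau (fun (f : lhom S S) x => f (q x)) E' (cau (@vee K V) l (fun j => Psi j (mon w))) m by [].
  rewrite cau_caur => [|f x y]; last by rewrite !hom_add.
  rewrite /cau3 hom_sumE; apply: eq_bigr => i _; rewrite hom_sumE; apply: eq_bigr => j _.
  by rewrite hom_sumE; apply: eq_bigr => k _; rewrite !hcompE hmulE.
apply: eq_cau => // j _; congr (q _).
rewrite [RHS](@cau_caur _ _ _ _ _ (fun (f : lhom S S) x => f x)); last by move=> f; exact: hom_add.
transitivity (cau (@vee K V) l (cau ap E (fun j => phi j (mon w))) j).
  apply: eq_cau => // i _; rewrite -exp_twisted_flow hom_sumE.
  by apply: eq_bigr => k _.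
rewrite cau_caur; last exact: (biadd_vee V).2.
rewrite cau3C12; apply: eq_cau3 => a b c.
by rewrite -!hmulE -!hcompE (exp_comm charK ptg E0 hE a (proj2 ((gr1P _ _).1 (lg b)))).
Qed.

Lemma flow_rhs_sum I (r : seq I) (z : I -> nat -> S) m :
  flow_rhs (fun j => \sum_(k <- r) z k j) m = \sum_(k <- r) flow_rhs (z k) m.
Proof.
pose T (z : nat -> S) := flow_rhs z m.
have TD (x y : nat -> S) : T (fun j => x j + y j) = T x + T y.
  rewrite /T /flow_rhs -[RHS](hom_add (hspr V 1)); congr (spr 1 _).
  rewrite -big_split; apply: eq_bigr => i _ /=.
  rewrite -[RHS](hom_add (E' i)); congr (E' i _); rewrite -[RHS](hom_add q); congr (Q _).
  rewrite -big_split; apply: eq_bigr => k _ /=.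
  rewrite -[RHS](hom_add (E k)); congr (E k _).
  by rewrite -big_split; apply: eq_bigr => b _ /=; rewrite veeDr.
have T0 : T (fun=> 0) = 0.
  by apply: (addrI (T (fun=> 0))); rewrite [RHS]addr0 -TD; congr T; apply/funext => j; rewrite addr0.
rewrite -/(T _); elim: r => [|a r IH].
  by rewrite big_nil -[RHS]T0; congr T; apply/funext => j; rewrite big_nil.
rewrite big_cons -[flow_rhs _ _]/(T (z a)) -IH -TD; congr T; apply/funext => j.
by rewrite big_cons.
Qed.

Lemma twisted_Q1E (X : nat -> S) N m : (m < N)%N ->
  twisted_Q1 Q pt X N m = spr 1 (cau (fun (f : lhom S S) x => f x) E'
    (fun j => q (cau (fun (f : lhom S S) x => f x) E X j)) m).
Proof.
move=> lt; rewrite /twisted_Q1; congr (spr 1 _).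
rewrite /psmul /cau; apply: eq_bigr => i _.
rewrite (exp_psexp charK ptg' _ E'0 hE'); [|by rewrite pt0 oppr0|by have := ltn_ord i; lia].
rewrite -hmulE -(exp_mul charK E'0 hE'); congr (E' i (q _)).
apply: eq_bigr => k _; rewrite (exp_psexp charK ptg pt0 E0 hE); last by have := ltn_ord k; lia.
by rewrite -hmulE -(exp_mul charK E0 hE).
Qed.

(** Induction on the order in t: agreement of all Taylor coefficients up to order m gives agreement
    of the full maps up to order m, and these fix the Taylor coefficient of order m+1. *)
Theorem associated_flowE Phi : associated_flow Q pt l Phi -> forall m x, Phi m x = phi m x.
Proof.
move=> h; pose fl m : lhom S S := LHom (flow_linear h m).
have fl_cop : comults fl.
  move=> m; apply: hom_ext => x; rewrite hcompE /= (flow_cop h) hom_sumE.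
  by apply: eq_bigr => j _; rewrite htens_tmap.
have fl_one m : fl m (sone V) = psone V m by exact: (flow_one h).
suff e m : hspr V 1 ** fl m = hspr V 1 ** phi m.
  move=> m x; rewrite -[LHS]/(fl m x); congr (hom_fun _ x).
  apply: (comults_unique charK fl_cop twisted_flow_comults) (leqnn m) => // j.
  by rewrite (comults_counit fl_cop fl_one) twisted_flow_spr0.
elim/ltn_ind: m => -[|m] IH; apply: mon_ext => w.
  rewrite !hcompE /= (flow_init h) /phi /twisted_flow /cau big_ord1 subnn E'0 Psi0.
  by rewrite hcomp1l.
have eq_j j : (j <= m)%N -> fl j = phi j.
  apply: (comults_unique charK fl_cop twisted_flow_comults) => // i.
    by rewrite (comults_counit fl_cop fl_one) twisted_flow_spr0.
(* The equation treats nonempty words; at 1 both series are normalised. *)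
case: (boolP (w == [::])) => [/eqP ->|w0].
  by rewrite !hcompE -[mon [::]]/(sone V) fl_one twisted_flow_one.
apply: (mulrSn_inj charK (n := m)) => /=.
have -> : spr 1 (phi m.+1 (mon w)) *+ m.+1 = spr 1 (pderiv phi m (mon w)).
  by rewrite /pderiv homMnE -!scaler_nat (linZ (@spr_linear K V 1)).
rewrite twisted_flow_ode //.
have fo := flow_ode h (i := size w) (a := mon w) _ m.
rewrite -scaler_nat; apply/esym; apply: (@spr1_flim _ _ _ hQ _ _ _ m _ _ (fo _)).
- exact: spr1K.
- by rewrite (linZ (@spr_linear K V 1)) spr1K.
- by rewrite spr_mon eqxx.
move=> N lt; transitivity (\sum_(1 <= k < (size w).+1) flow_rhs (fun j => spr k (fl j (mon w))) m).
  by apply: eq_bigr => k _; rewrite twisted_Q1E.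
rewrite -flow_rhs_sum /flow_rhs; congr (spr 1 _).
apply: eq_cau => // j jm; congr (q _); apply: eq_cau => // i im; apply: eq_cau => // k km.
by rewrite -comults_split // eq_j //; lia.
Qed.
End AssociatedFlow.

(** * The path of morphisms *)

Section Pushforward.
Variables (K : fieldType) (L L' : fgspace K).
Local Notation V := (shift L 1).
Local Notation V' := (shift L' 1).
Local Notation S := (Sym V).
Local Notation S' := (Sym V').
Variables (Q : S -> S) (Q' : S' -> S') (F : S -> S').
Hypotheses (charK : [pchar K] =i pred0) (hQ : flat_Linfty Q) (hQ' : flat_Linfty Q').
Hypothesis hF : Linfty_morphism Q Q' F.
Local Notation q := (codiff hQ).
Local Notation q' := (codiff hQ').

Definition mor_hom : lhom S S' := LHom (cm_linear (mor_coalg hF)).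
Local Notation f := mor_hom.

Lemma mor_hom_cop : hcop V' ** f = htens f f ** hcop V.
Proof.
by apply: hom_ext => x; rewrite !hcompE htens_tmap; exact: (cm_cop (mor_coalg hF)).
Qed.

Lemma mor_hom_comults : comults (consts f).
Proof. exact: comults_consts mor_hom_cop. Qed.

Lemma mor_hom_one m : consts f m (sone V) = psone V' m.
Proof. by case: m => //=; exact: (cm_one (mor_coalg hF)). Qed.

Lemma mor_hom_deg : hdeg 0 f.
Proof. by move=> i x hx; rewrite add0r; apply: (cm_deg (mor_coalg hF)); exists x. Qed.

Lemma mor_hom_fil : hfil 0 f.
Proof. by move=> i x hx; rewrite add0r; apply: (mor_fil hF); exists x. Qed.

Lemma mor_hom_comm : f ** q = q' ** f.
Proof. by apply: hom_ext => x; exact: (mor_comm hF). Qed.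

Variables (lt : nat -> S) (Psi : nat -> lhom S S).
Hypothesis (ltg : forall j, gr1 (-1) (lt j)).
Local Notation P := (gauge_op hQ lt).
Hypotheses (Psi0 : Psi 0%N = hid _) (hPsi : ode (@hcomp K _ _ _) P Psi).
Local Notation y := (fun m => Psi m (sone V)).

Definition push_gauge_coef (m : nat) : S' := spr 1 (F (cau (@vee K V) lt y m)).
Local Notation lt' := push_gauge_coef.

Lemma push_gauge_gr1 m : gr1 (-1) (lt' m).
Proof.
apply/gr1P; split; first by rewrite spr_spr.
have h : sdeg (-1) (cau (@vee K V) lt y m).
  apply: lspan_sum => j _; rewrite -[-1]addr0; apply: vee_sdeg; first by case/gr1P: (ltg j).
  have := gflow_deg charK ltg Psi0 hPsi (m - j) (sdeg_mon [::]).
  by rewrite wdeg0 add0r.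
by apply: spr_deg; rewrite -[-1]add0r; apply: mor_hom_deg.
Qed.

Lemma mor_mul_cop (x : S) d : gr1 d x ->
  hcop V' ** (f ** hmul x) = htens (f ** hmul x) f ** hcop V +
    htens (f ** hsgn V d) (f ** hmul x) ** hcop V.
Proof.
move=> hx; rewrite hcompA mor_hom_cop -hcompA (hcop_mul hx) (biadd_hcomp _ _ _).2 !hcompA.
by rewrite !htens_comp hcomp1r.
Qed.

Lemma mul_mor_cop (x : S') d : gr1 d x ->
  hcop V' ** (hmul x ** f) = htens (hmul x ** f) f ** hcop V +
    htens (f ** hsgn V d) (hmul x ** f) ** hcop V.
Proof.
move=> hx; rewrite hcompA (hcop_mul hx) (biadd_hcomp _ _ _).1 -!hcompA mor_hom_cop !hcompA.
by rewrite !htens_comp hcomp1l (hsgn_comm _ mor_hom_deg) ksgn0r scale1r.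
Qed.

Lemma gauge_mul_deg (U : fgspace K) (x : Sym U) d : gr1 d x -> hdeg d (hmul x).
Proof. by case/gr1P => _; apply: hdeg_mul. Qed.

(** The composite of [F] with multiplication by lambda is a coderivation along [F], hence the
    convolution of its Taylor coefficient with [F]. On the group-like series exp(pi) this
    convolution is the product lambda' v F(exp(pi)). *)
Lemma mor_gauge m : F (cau (@vee K V) lt y m) = cau (@vee K V') lt' (fun j => F (y j)) m.
Proof.
pose B j := f ** hmul (lt j).
have hB : coders (-1) (consts f) B by apply: coders_consts => j; apply: mor_mul_cop.
have Bd j : hdeg (-1) (B j).
  by apply: hdeg_comp0l; [exact: mor_hom_deg | exact: gauge_mul_deg].
have F0 j : hdeg 0 (consts f j) by case: j => [|j]; [exact: mor_hom_deg | exact: hdeg0].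
have BE j : B j = hstar (hspr V' 1 ** B j) f.
  rewrite {1}(coders_taylor charK mor_hom_comults hB F0 Bd (comults_counit mor_hom_comults mor_hom_one)).
  rewrite cau_constsr //; split=> [b g g'|g b b'] /=; last exact: (biadd_hstar _ _).2.
  by rewrite (biadd_hcomp _ _ _).2 (biadd_hstar _ _).1.
(* The Taylor formula as a map on the tensor square, where the coproduct of the group-like series is
   available. *)
pose M j : lhom (tensor S S) S' := hsmul V' ** htens (hspr V' 1 ** B j) f.
have [ycop _] := gflow_grouplike charK ltg Psi0 hPsi.
transitivity (cau3 (fun (b : lhom S S') x z => vee (spr 1 (b x)) (F z)) B y y m).
  transitivity (cau (fun (b : lhom _ S') z => b z) M (cau (@tens K S S) y y) m).
    rewrite -[LHS]/(f _) hom_sum; apply: eq_bigr => j _.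
    rewrite -ycop -[LHS](_ : B j (y (m - j)%N) = _); last by rewrite hcompE hmulE.
    by rewrite {1}BE.
  rewrite cau_caur; last by move=> b; exact: hom_add.
  do 3!apply: eq_bigr => ? _.
  by rewrite /M hcompE htensE /= smul_tens.
rewrite -(@cau_caul _ _ _ _ _ (fun s z => vee s (F z)) (fun (b : lhom S S') x => spr 1 (b x))).
  apply: eq_bigr => j _; congr (vee _ _).
  rewrite /push_gauge_coef -[RHS]/(hspr V' 1 (f _)) !hom_sum; apply: eq_bigr => i _.
  by rewrite hcompE hmulE.
by move=> z; exact: (biadd_vee V').1.
Qed.

Variable Psi' : nat -> lhom S' S'.
Local Notation P' := (gauge_op hQ' lt').
Hypotheses (Psi'0 : Psi' 0%N = hid _) (hPsi' : ode (@hcomp K _ _ _) P' Psi').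

Lemma mor_flow_one m : F (y m) = Psi' m (sone V').
Proof.
apply: (@ode_unique _ _ _ (fun (b : lhom S' S') x => b x) P' charK (fun m => F (y m))
  (fun m => Psi' m (sone V'))).
- by rewrite Psi0 Psi'0; exact: (cm_one (mor_coalg hF)).
- move=> {}m; rewrite (@pderiv_map _ _ f y); last exact: hom_add.
  rewrite (gflow_one_ode charK Psi0 hPsi) -[LHS]/((f ** q) _) mor_hom_comm hcompE.
  (* F(exp(pi)) is closed, so the missing term lambda' v Q'(F(exp(pi))) of the flow equation can be
     supplied as zero. *)
  rewrite [f _]mor_gauge hom_sum; apply: eq_bigr => j _.
  rewrite hom_evalD !hcompE !hmulE -[q' (F _)]/((q' ** f) _) -mor_hom_comm hcompE.
  by rewrite [q _](gflow_one_closed charK Psi0 hPsi) hom_zero vee0r addr0.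
- by move=> {}m; rewrite /pderiv -homMnE -[_ *+ _]/(pderiv Psi' m) hPsi' hom_sumE.
Qed.

Variable Theta : nat -> lhom S' S'.
Hypotheses (Theta0 : Theta 0%N = hid _) (hTheta : ode (@rcomp _ _ _) P' Theta).

Lemma rflow_comm m : Theta m ** q' = q' ** Theta m.
Proof.
apply: (ode_ind charK (C := fun g => g ** q' = q' ** g)) hTheta m.
- by rewrite (biadd0r (biadd_hcomp _ _ _)) (biadd0l (biadd_hcomp _ _ _)).
- move=> a x z hx hz; rewrite (biadd_hcomp _ _ _).1 (biadd_hcomp _ _ _).2.
  by rewrite hcompZl hcompZr hx hz.
- move=> j x hx; rewrite /rcomp (biaddNl (biadd_hcomp _ _ _)) (biaddNr (biadd_hcomp _ _ _)).
  by rewrite -hcompA (gauge_comm hQ') hcompA hx hcompA.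
- by rewrite Theta0 hcomp1l hcomp1r.
Qed.

Lemma rflow_deg m : hdeg 0 (Theta m).
Proof.
apply: (ode_ind charK (C := hdeg 0)) hTheta m; [exact: hdeg0|exact: hdegP| |].
  by move=> j x hx; apply: hdegN; apply: hdeg_comp0l => //; apply: gauge_deg push_gauge_gr1 _.
by rewrite Theta0; apply: hdeg_id.
Qed.

Lemma rflow_comults : comults Theta.
Proof.
apply: (rode_comults charK _ Theta0 hTheta) => j; apply: gauge_evcoder => //.
exact: push_gauge_gr1.
Qed.

(** With Theta inverse to the flow on L', [mor_path] is Psi'^{-1} F Psi and
    [gauge_path] is Psi'^{-1} (F (lambda v -) - (lambda' v -) F) Psi. *)
Definition defect (j : nat) : lhom S S' := f ** hmul (lt j) - hmul (lt' j) ** f.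
Definition mor_path : nat -> lhom S S' := cau (@hcomp K _ _ _) Theta (fun m => f ** Psi m).
Definition gauge_path : nat -> lhom S S' :=
  cau (@hcomp K _ _ _) Theta (cau (@hcomp K _ _ _) defect Psi).

Lemma coders_defect : coders (-1) (consts f) defect.
Proof.
apply: coders_consts => j; rewrite /defect (biaddBr (biadd_hcomp _ _ _)).
rewrite (mor_mul_cop (ltg j)) (mul_mor_cop (push_gauge_gr1 j)).
rewrite (biaddBl (biadd_htens _ _ _ _)) (biaddBr (biadd_htens _ _ _ _)).
by rewrite !(biaddBl (biadd_hcomp _ _ _)) opprD addrACA.
Qed.

Lemma defect_deg j : hdeg (-1) (defect j).
Proof.
apply: hdegD; first by apply: hdeg_comp0l; [exact: mor_hom_deg | exact: gauge_mul_deg].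
apply: hdegN; apply: hdeg_comp0r; last exact: mor_hom_deg.
exact/gauge_mul_deg/push_gauge_gr1.
Qed.

Lemma consts_comp m (g : lhom S S') (X : nat -> lhom S S) :
  cau (@hcomp K _ _ _) (consts g) X m = g ** X m.
Proof. exact: (cau_constsl _ _ _ (biadd_hcomp _ _ _)). Qed.

Lemma mor_path_cau m : mor_path m =
  cau (@hcomp K _ _ _) Theta (cau (@hcomp K _ _ _) (consts f) Psi) m.
Proof. by apply: eq_bigr => j _; rewrite consts_comp. Qed.

Lemma mor_path_comults : comults mor_path.
Proof.
have h : comults (cau (@hcomp K _ _ _) Theta (cau (@hcomp K _ _ _) (consts f) Psi)).
  apply: comults_comp rflow_comults _; apply: comults_comp mor_hom_comults _.
  exact: (gflow_comults charK ltg Psi0 hPsi).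
have e : mor_path = cau (@hcomp K _ _ _) Theta (cau (@hcomp K _ _ _) (consts f) Psi).
  by apply/funext => m; exact: mor_path_cau.
by rewrite e.
Qed.

Lemma mor_path_coders : coders (-1) mor_path gauge_path.
Proof.
have e : mor_path = cau (@hcomp K _ _ _) Theta (cau (@hcomp K _ _ _) (consts f) Psi).
  by apply/funext => m; exact: mor_path_cau.
rewrite e; apply: coders_compl rflow_comults _.
apply: coders_compr coders_defect; first exact: (gflow_comults charK ltg Psi0 hPsi).
by move=> j; exact: (gflow_deg charK ltg Psi0 hPsi).
Qed.

Lemma mor_path_deg m : hdeg 0 (mor_path m).
Proof.
apply: hdeg_sum => j _; apply: hdeg_comp0l; first exact: rflow_deg.
by apply: hdeg_comp0l; [exact: mor_hom_deg | exact: (gflow_deg charK ltg Psi0 hPsi)].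
Qed.

Lemma gauge_path_deg m : hdeg (-1) (gauge_path m).
Proof.
apply: hdeg_sum => j _; apply: hdeg_comp0l; first exact: rflow_deg.
apply: hdeg_sum => i _; apply: hdeg_comp0r; first exact: defect_deg.
exact: (gflow_deg charK ltg Psi0 hPsi).
Qed.

Lemma mor_path_one m : mor_path m (sone V) = psone V' m.
Proof.
transitivity (cau (@hcomp K _ _ _) Theta Psi' m (sone V')).
  by rewrite !hom_sumE; apply: eq_bigr => j _; rewrite !hcompE -mor_flow_one.
by rewrite (ode_rode_inv charK m Psi'0 hPsi' Theta0 hTheta); case: m.
Qed.

(** Psi(1) is group-like, so by [mor_gauge] the defect kills it; this is where the precise choice of
    lambda' enters. *)
Lemma gauge_path_one m : gauge_path m (sone V) = 0.
Proof.
rewrite hom_sumE big1 // => j _; rewrite hcompE [X in Theta _ X](_ : _ = 0) ?hom_zero //.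
move: (m - j)%N => k; rewrite hom_sumE.
transitivity (F (cau (@vee K V) lt y k) - cau (@vee K V') lt' (fun j => F (y j)) k).
  rewrite -[F _]/(f _) hom_sum -sumrB; apply: eq_bigr => i _.
  by rewrite hcompE homBE !hcompE !hmulE.
by rewrite mor_gauge subrr.
Qed.

Lemma mor_path_spr0 m : hspr V' 0 ** mor_path m = consts (heps V V') m.
Proof. exact: (comults_counit mor_path_comults mor_path_one). Qed.

Lemma gauge_path_taylor m :
  gauge_path m = cau (fun b g => hstar (hspr V' 1 ** b) g) gauge_path mor_path m.
Proof.
exact: (coders_taylor charK mor_path_comults mor_path_coders mor_path_deg gauge_path_deg
  mor_path_spr0).
Qed.

Lemma mor_path_comm m : mor_path m ** q = q' ** mor_path m.
Proof.
rewrite /mor_path cau_compr cau_compl; apply: eq_bigr => j _.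
by rewrite -!hcompA (gflow_comm charK Psi0 hPsi) (hcompA f) mor_hom_comm -!hcompA
  hcompA rflow_comm -!hcompA.
Qed.

Lemma defect_differential j :
  q' ** defect j + defect j ** q = f ** P j - P' j ** f.
Proof.
rewrite /defect /gauge_op (biaddBr (biadd_hcomp _ _ _)) (biaddBl (biadd_hcomp _ _ _)).
rewrite (biadd_hcomp _ _ _).2 (biadd_hcomp _ _ _).1 !hcompA -mor_hom_comm.
by rewrite -(hcompA _ f q) mor_hom_comm !hcompA opprD addrACA.
Qed.

Lemma mor_path_ode m : pderiv mor_path m = q' ** gauge_path m + gauge_path m ** q.
Proof.
rewrite (cau_deriv _ _ _ (biadd_hcomp _ _ _)).
rewrite (eq_cau _ (a' := cau (@rcomp _ _ _) P' Theta) (b' := fun m => f ** Psi m)) //.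
rewrite [X in _ + X](eq_cau _ (a' := Theta)
  (b' := cau (fun p x => f ** p ** x) P Psi)) // => [|j _]; last first.
  rewrite (@pderiv_map _ _ (fun g => f ** g)); last exact: (biadd_hcomp _ _ _).2.
  by rewrite hPsi cau_compl; apply: eq_bigr => i _; rewrite hcompA.
rewrite cau_caul; last exact: (biadd_hcomp _ _ _).1.
rewrite cau_caur; last exact: (biadd_hcomp _ _ _).2.
rewrite cau3C12 /gauge_path cau_caur; last exact: (biadd_hcomp _ _ _).2.
rewrite /cau3 comp_sumr comp_suml -!big_split; apply: eq_bigr => i _ /=.
rewrite comp_sumr comp_suml -!big_split; apply: eq_bigr => j _ /=.
rewrite comp_sumr comp_suml -!big_split; apply: eq_bigr => k _ /=.
rewrite [q' ** _]hcompA -rflow_comm -!hcompA (gflow_comm charK Psi0 hPsi).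
rewrite (hcompA q') (hcompA (defect j)) -(biadd_hcomp _ _ _).2 -(biadd_hcomp _ _ _).1.
rewrite defect_differential (biaddBl (biadd_hcomp _ _ _)) (biaddBr (biadd_hcomp _ _ _)).
by rewrite /rcomp (biaddNl (biadd_hcomp _ _ _)) addrC !hcompA.
Qed.
End Pushforward.

(** * The convolution algebra *)

Section ConvolutionAlgebra.
Variables (K : fieldType) (L L' : fgspace K).
Local Notation V := (shift L 1).
Local Notation V' := (shift L' 1).
Local Notation S := (Sym V).
Local Notation S' := (Sym V').
Variables (Q : S -> S) (Q' : S' -> S').
Hypotheses (charK : [pchar K] =i pred0) (hQ : flat_Linfty Q) (hQ' : flat_Linfty Q').
Local Notation q := (codiff hQ).
Local Notation q' := (codiff hQ').
Implicit Types h : lhom S S'.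

Lemma conv_grP d h : hdeg d h -> hfil 0 h -> h (sone V) = 0 ->
  hspr V' 1 ** h = h -> conv_gr d (h : S -> S').
Proof.
move=> hd hf h1 hs; split.
- by split=> //; exact: hom_linear.
- by move=> x; have := congr1 (fun g => hom_fun g x) hs.
- by move=> i _ [x hx <-]; rewrite addrC; apply: hd.
- by move=> k _ [x hx <-]; rewrite -[k]add0r; apply: hf.
Qed.

Lemma conv_filP d h n (m k : int) : hvan n h -> hfil m h -> conv_gr d (h : S -> S') ->
  n%:Z + m = k -> conv_fil k (h : S -> S').
Proof.
move=> hn hm hg e; apply: lspan_gen; exists d, n, m; split=> //.
  by move=> i x lt ex; apply: (hvanP hn lt ex).
by move=> l _ [x hx <-]; rewrite addrC; apply: hm.
Qed.

Lemma sgnop0 (x : S) : sgnop 0 x = x.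
Proof.
suff : hsgn V 0 = hid _ by move=> /(congr1 (fun g => hom_fun g x)).
by apply: mon_ext => w; rewrite /= sgnop_mon ksgn0l scale1r.
Qed.

(** Every term by which the reduced and the full coproduct differ contains a value at 1. *)
Lemma star_hstar h h' : h (sone V) = 0 -> h' (sone V) = 0 ->
  star (h : S -> S') 0 (h' : S -> S') = hstar h h'.
Proof.
move=> h1 h'1; apply/funext => x; rewrite /star hstar_eval.
rewrite (_ : (fun a => h (sgnop 0 a)) = h); last by apply/funext => a; rewrite sgnop0.
rewrite -htens_tmap -[smul _]/(hsmul V' _); congr (hsmul V' _).
have [c ec] := spr0E x.
rewrite /rcop -[cop (_ - _)]/(hcop V _) !hom_sub ec hom_scale htensE h'1 htensE h1.
rewrite (biadd0r (biadd_tens _ _)) (biadd0l (biadd_tens _ _)) !subr0.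
by rewrite [hcop V (sone V)]cop_unsh /= hom_scale htensE h1 (biadd0l (biadd_tens _ _))
  scaler0 subr0.
Qed.

Definition star_list (s : seq (lhom S S')) : lhom S S' :=
  foldr (@hstar K V V') (heps V V') s.

Lemma hstar_one h h' : h (sone V) = 0 -> hstar h h' (sone V) = 0.
Proof. by move=> e; rewrite -[sone V]/(mon [::]) hstarE /= e vee0l. Qed.

(** Only the first entry may have nonzero degree, so every right-hand factor has degree 0 and the
    Koszul signs of [star] are trivial. *)
Lemma starlE d h (s : seq (lhom S S')) : h (sone V) = 0 ->
  (forall g, g \in s -> g (sone V) = 0) ->
  starl ((d, h : S -> S') :: [seq (0, hom_fun g) | g <- s]) = hstar h (star_list s).
Proof.
elim: s d h => [|g s IH] d h h1 hs; first by rewrite [star_list _]/(heps V V') hstar_epsr.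
have g1 : g (sone V) = 0 by apply: hs; rewrite mem_head.
set t := (0 : int, hom_fun g) :: [seq (0 : int, hom_fun g) | g <- s].
have -> : starl ((d, h : S -> S') :: [seq (0, hom_fun g) | g <- g :: s]) =
  star h (\sum_(p <- t) p.1) (starl t) by [].
have -> : \sum_(p <- t) p.1 = 0.
  by rewrite big_cons add0r big_map big1.
rewrite IH //; last by move=> g' g's; apply: hs; rewrite inE g's orbT.
by rewrite star_hstar //; exact: hstar_one.
Qed.

Lemma conv_bracketE h (s : seq (lhom S S')) x : h (sone V) = 0 ->
  (forall g, g \in s -> g (sone V) = 0) -> hspr V' 1 ** h = h ->
  conv_bracket Q Q' ((-1, h : S -> S') :: [seq (0, hom_fun g) | g <- s]) x =
  (if nilp s then h (q x) else 0) + spr 1 (Q' (hstar h (star_list s) x)).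
Proof.
move=> h1 hs hh; have e := starlE (-1) h1 hs; case: s hs e => [|g s] hs e.
  rewrite [star_list _]/(heps V V') hstar_epsr.
  rewrite [LHS]/(spr 1 (Q' (h x)) - (-1) ^ (-1) *: h (Q x)).
  (* In the unary bracket -(-1)^{|h|} equals +1, because h has degree -1. *)
  have -> : (-1 : K) ^ (-1 : int) = -1 by rewrite exprN1 invrN1.
  by rewrite scaleN1r opprK addrC.
by rewrite add0r -e.
Qed.

Section Path.
Variables (F B : nat -> lhom S S').
Hypotheses (F1 : forall j, hspr V' 1 (F j (sone V)) = 0) (B1 : forall j, B j (sone V) = 0).
Local Notation ft := (fun j => hspr V' 1 ** F j).
Local Notation bt := (fun j => hspr V' 1 ** B j).

(** The extra term at n = 0 comes from the unary bracket, the one in which [Q] acts on the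
    source. *)
Lemma conv_flow_coef m n x :
  flow_coef (conv_bracket Q Q') (fun j => ft j : S -> S') (fun j => bt j : S -> S') m n x =
  (if n == 0%N then bt m (q x) else 0) +
  spr 1 (Q' (cau (@hstar K V V') bt (iter n (cau (@hstar K V V') ft) (consts (heps V V'))) m x)).
Proof.
rewrite /flow_coef.
pose G (i : 'I_m.+1) (t : n.-tuple 'I_m.+1) : lhom S S' :=
  (if n == 0%N then bt i ** q else 0) +
  hspr V' 1 ** q' ** hstar (bt i) (star_list [seq ft (x : 'I_m.+1) | x <- t]).
transitivity ((\sum_(j : n.+1.-tuple 'I_m.+1 | (\sum_(x <- j) (x : nat) == m)%N)
    G (thead j) (behead_tuple j)) x).
  rewrite hom_sumE fct_sumE; apply: eq_bigr => j _.
  rewrite -[behead j]/(tval (behead_tuple j)).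
  move: (thead j) (behead_tuple j) => i t {j}.
  have bt1 j : bt j (sone V) = 0 by rewrite hcompE B1 hom_zero.
  have ft1 (g : lhom S S') : g \in [seq ft (x : 'I_m.+1) | x <- t] -> g (sone V) = 0.
    by case/mapP => k _ ->; exact: F1.
  have e := conv_bracketE x (bt1 i) ft1; rewrite -map_comp in e.
  rewrite [LHS]e; last by apply: hom_ext => z; rewrite !hcompE /= spr_spr.
  rewrite /G hom_evalD /nilp size_map size_tuple; congr (_ + _).
  by case: ifP.
rewrite (sum_tuple_cons _ G).
rewrite (_ : cau _ _ _ _ = \sum_(i < m.+1) \sum_(t : n.-tuple 'I_m.+1 | (i + \sum_(x <- t) (x : nat) == m)%N)
  hstar (bt i) (star_list [seq ft (x : 'I_m.+1) | x <- t])); last first.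
  apply: eq_bigr => i _; rewrite -(biadd_sumr (biadd_hstar _ _)); congr hstar.
  rewrite -(@sum_tuple_cau _ _ m.+1 n (m - i)%N ft (@hstar K V V') (heps V V')).
  - by apply: eq_bigl => t; have := ltn_ord i; lia.
  - exact: (biadd_hstar _ _).2.
  - by lia.
set C := \sum_(i < m.+1) \sum_(t : n.-tuple _ | _) hstar _ _.
have -> : \sum_(i < m.+1) \sum_(t : n.-tuple 'I_m.+1 | (i + \sum_(x <- t) (x : nat) == m)%N) G i t =
  \sum_(i < m.+1) \sum_(t : n.-tuple 'I_m.+1 | (i + \sum_(x <- t) (x : nat) == m)%N)
    (if n == 0%N then bt i ** q else 0) + hspr V' 1 ** q' ** C.
  rewrite comp_sumr -big_split; apply: eq_bigr => i _ /=.
  by rewrite comp_sumr -big_split.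
rewrite hom_evalD; congr (_ + _); case: (n) => [|k] /=; last first.
  by rewrite big1 // => i _; rewrite big1.
rewrite (eq_bigr (fun i : 'I_m.+1 => if (i == m :> nat)%N then bt i ** q else 0)).
  by rewrite -big_mkcond /= (@sum_nat_eq _ _ _ (fun i => bt i ** q)).
move=> i _; case: ifP => im.
  rewrite (big_pred1 [tuple]) // => t.
  by rewrite [t]tuple0 big_nil addn0 im; apply/esym/eqP.
by rewrite big_pred0 // => t; rewrite [t]tuple0 big_nil addn0.
Qed.
End Path.

Section ConvolutionODE.
Variables (F B : nat -> lhom S S').
Hypotheses (Fcop : comults F) (F1 : forall j, F j (sone V) = psone V' j).
Hypotheses (Fd : forall j, hdeg 0 (F j)) (Bd : forall j, hdeg (-1) (B j)).
Hypotheses (Ff : forall j, hfil 0 (F j)) (Bf : forall j, hfil 0 (B j)).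
Hypothesis B1 : forall j, B j (sone V) = 0.
Hypothesis BE : forall m, B m = cau (fun b g => hstar (hspr V' 1 ** b) g) B F m.
Hypothesis FODE : forall m, pderiv F m = q' ** B m + B m ** q.
Local Notation ft := (fun j => hspr V' 1 ** F j).
Local Notation bt := (fun j => hspr V' 1 ** B j).

Lemma spr1_series_one j : hspr V' 1 (F j (sone V)) = 0.
Proof. by rewrite F1; case: j => [|j] /=; rewrite ?sprsone ?spr_zero. Qed.

(** Iterating the Euler recursion: a comultiplicative series is the convolution exponential of its
    Taylor coefficient. *)
Lemma comults_pow n j :
  iter n (cau (@hstar K V V') ft) (consts (heps V V')) j = n`!%:R *: (hspr V' n ** F j).
Proof.
elim: n j => [|n IH] j.
  by rewrite (comults_counit Fcop F1) fact0 scale1r.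
rewrite iterS factS natrM mulrC -scalerA comults_spr // /cau scaler_sumr.
apply: eq_bigr => i _; rewrite IH !scaler_nat.
exact: (additiveMn ((biadd_hstar _ _).2 _)).
Qed.

Lemma conv_path_gr j : conv_gr 0 (ft j : S -> S').
Proof.
apply: conv_grP; last by apply: hom_ext => x; rewrite !hcompE /= spr_spr.
- by apply: hdeg_comp0l => //; apply: hdeg_spr.
- by apply: hfil_comp0l => //; apply: hfil_spr.
- exact: spr1_series_one.
Qed.

Lemma conv_gauge_gr j : conv_gr (-1) (bt j : S -> S').
Proof.
apply: conv_grP; last by apply: hom_ext => x; rewrite !hcompE /= spr_spr.
- by apply: hdeg_comp0l => //; apply: hdeg_spr.
- by apply: hfil_comp0l => //; apply: hfil_spr.
- by rewrite hcompE B1 hom_zero.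
Qed.

(** Truncating the exponential at N replaces F by its components in Sym^{<N}. The error is Q'
    applied to the convolution of the Taylor coefficient of B with the remaining tail of F; it
    vanishes on words shorter than N and so is small in the part of the filtration that counts
    letters. *)
Lemma conv_ode m : flim (@conv_fil _ L L')
  (fun N => \sum_(n < N) (n`!%:R : K)^-1 *:
     flow_coef (conv_bracket Q Q') (fun j => ft j : S -> S') (fun j => bt j : S -> S') m n)
  (m.+1%:R *: (ft m.+1 : S -> S')).
Proof.
(* N >= 1 ensures that the term n = 0, with its unary bracket, is in the sum. *)
move=> k; exists (maxn 1 `|k|) => N; rewrite geq_max => /andP[N1 kN].
pose R j := F j - \sum_(n < N) hspr V' n ** F j.
pose D := hspr V' 1 ** q' ** cau (@hstar K V V') bt R m.
have RN j : hvan N (R j).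
  move=> w lt; apply: spr_ext => n; rewrite spr_zero homBE hom_sumE.
  rewrite -[LHS]/(hspr V' n (_ - _)) hom_sub hom_sum.
  have [nN|Nn] := ltnP n N.
    rewrite (bigD1 (Ordinal nN)) //= big1 ?addr0 => [|i].
      by rewrite spr_spr eqxx subrr.
    by rewrite -val_eqE /= spr_spr eq_sym => /negbTE ->.
  rewrite big1 ?subr0 => [|i _].
    by apply: (comults_van charK Fcop F1) => //; lia.
  by rewrite /= spr_spr; case: eqP => // e; have := ltn_ord i; lia.
have Rf j : hfil 0 (R j).
  apply: (filtB (hfil_filtration _ _)) => //; apply: (filt_sum (hfil_filtration _ _)) => i _.
  by apply: hfil_comp0l => //; apply: hfil_spr.
have Rd j : hdeg 0 (R j).
  apply: hdegD => //; apply: hdegN; apply: hdeg_sum => i _.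
  by apply: hdeg_comp0l => //; apply: hdeg_spr.
have DN : hvan N D.
  move=> w lt; rewrite !hcompE hom_sumE big1 ?hom_zero // => j _.
  exact: (@hvan_star _ _ _ 0 N).
have Df : hfil 0 D.
  apply: hfil_comp0l; first by apply: hfil_comp0l; [exact: hfil_spr | exact: codiff_fil].
  apply: (filt_sum (hfil_filtration _ _)) => j _; rewrite -[0]addr0; apply: hfil_star => //.
  by apply: hfil_comp0l => //; apply: hfil_spr.
have Dd : hdeg 0 D.
  rewrite -[0](_ : 1 + -1 = 0) //; apply: hdeg_comp.
    by apply: hdeg_comp0l; [exact: hdeg_spr | exact: codiff_deg].
  apply: hdeg_sum => j _; rewrite -[-1]addr0; apply: hdeg_star => //.
  by apply: hdeg_comp0l => //; apply: hdeg_spr.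
have D1 : D (sone V) = 0 by apply: DN.
have DE : hspr V' 1 ** D = D.
  by apply: hom_ext => x; rewrite !hcompE /= spr_spr.
have Dk : conv_fil k ((- D : lhom S S') : S -> S').
  (* N letters account for N; the remaining shift k - N is at most 0, so preserving the filtration
     is enough. *)
  apply: (@conv_filP 0 _ N (k - N%:Z)).
  - by move=> w lt; rewrite homNE DN ?oppr0.
  - apply: (filtN (hfil_filtration _ _)).
    by apply: (filt_le (hfil_filtration _ _)) Df; lia.
  - apply: conv_grP.
    + exact: hdegN.
    + exact: (filtN (hfil_filtration _ _)).
    + by rewrite homNE D1 oppr0.
    + by rewrite (biaddNr (biadd_hcomp _ _ _)) DE.
  - by rewrite addrC subrK.
rewrite (_ : _ - _ = ((- D : lhom S S') : S -> S')) //.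
apply/funext => x; rewrite -[LHS]/((\sum_(n < N) _) x - m.+1%:R *: spr 1 (F m.+1 x)).
rewrite fct_sumE.
have -> : m.+1%:R *: spr 1 (F m.+1 x) =
    bt m (q x) + spr 1 (q' (cau (@hstar K V V') bt F m x)).
  rewrite -(linZ (@spr_linear K V' 1)) scaler_nat -homMnE -[_ *+ _]/(pderiv F m) FODE.
  rewrite hom_evalD -[LHS]/(hspr V' 1 _) hom_add addrC; congr (_ + _).
  by rewrite {1}BE.
have -> : \sum_(n < N) ((n`!%:R : K)^-1 *: flow_coef (conv_bracket Q Q')
    (fun j => ft j : S -> S') (fun j => bt j : S -> S') m n) x =
    bt m (q x) + spr 1 (q' (cau (@hstar K V V') bt (fun j => \sum_(n < N) hspr V' n ** F j) m x)).
  rewrite (eq_bigr (fun n : 'I_N => (if n == 0%N :> nat then bt m (q x) else 0) +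
      spr 1 (q' (cau (@hstar K V V') bt (fun j => hspr V' n ** F j) m x)))); last first.
    move=> n _; rewrite -[LHS]/(_ *: _ x) conv_flow_coef //; last exact: spr1_series_one.
    rewrite scalerDr; congr (_ + _).
      by case: eqP => [->|_]; rewrite ?scaler0 // fact0 invr1 scale1r.
    rewrite -[LHS]/(_ *: hspr V' 1 (q' _)) -!hom_scale /=; congr (spr 1 (Q' _)).
    rewrite hom_scale -homZE /cau scaler_sumr; congr (hom_fun _ x); apply: eq_bigr => j _.
    rewrite comults_pow scaler_nat (additiveMn ((biadd_hstar _ _).2 _)) -scaler_nat scalerA.
    by rewrite mulVf ?scale1r //; move/pcharf0P: (charK) => ->; rewrite -lt0n fact_gt0.
  rewrite big_split /= -big_mkcond (@sum_nat_eq _ _ _ (fun=> bt m (q x))) //; congr (_ + _).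
  rewrite -[RHS]/(hspr V' 1 (q' _)) /cau hom_sumE !hom_sum.
  under [RHS]eq_bigr => j _ do rewrite (biadd_sumr (biadd_hstar _ _)) hom_sumE !hom_sum.
  rewrite exchange_big; apply: eq_bigr => n _ /=.
  by rewrite hom_sumE -[LHS]/(hspr V' 1 (q' _)) !hom_sum.
rewrite opprD addrACA subrr add0r homNE -opprB; congr (- _).
rewrite -[LHS]/(_ - _) /D !hcompE -[RHS]/(hspr V' 1 _).
rewrite -[LHS](hom_sub (hspr V' 1)) -hom_sub -homBE; congr (hspr V' 1 (q' (hom_fun _ x))).
by rewrite -sumrB; apply: eq_bigr => j _; rewrite (biaddBr (biadd_hstar _ _)).
Qed.
End ConvolutionODE.
End ConvolutionAlgebra.

(** * Evaluation at t = 1 *)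

Section Limits.
Variable K : fieldType.
Hypothesis charK : [pchar K] =i pred0.
Implicit Types U V W : fgspace K.

Lemma psum_hom V W (A : nat -> lhom (Sym V) (Sym W)) n x :
  psum A n x = psum (fun j => A j x) n.
Proof. exact: hom_sumE. Qed.

Lemma tends0_eval V W (A : nat -> lhom (Sym V) (Sym W)) x : complete_filtration V ->
  tends0 (@hfil K V W) A -> tends0 (@sfil K W) (fun n => A n x).
Proof.
move=> hV hA k; have [l hl] := sfil_exh hV x; have [N hN] := hA `|k%:Z - l|%N.
by exists N => n /hN /(_ l x hl); apply: (filt_le (@sfil_filtration _ _)); lia.
Qed.

Lemma uniform_lim V W (A : nat -> lhom (Sym V) (Sym W)) (g : lhom (Sym V) (Sym W)) :
  nulls (@hfil K V W) A ->
  (forall x, tends0 (@sfil K W) (fun n => psum (fun j => A j x) n - g x)) ->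
  tends0 (@hfil K V W) (fun n => psum A n - g).
Proof.
move=> [A0 hA] hg k; have [N hN] := psum_cauchy (hfil_filtration _ _) hA k.
exists N => n Nn l x hx; have [N' hN'] := hg x `|(k%:Z + l)%R|%N.
pose n' := maxn N N'.
have -> : (psum A n - g) x = (psum A n - psum A n') x + (psum (fun j => A j x) n' - g x).
  by rewrite !homBE -psum_hom addrA subrK.
apply: (filtD (@sfil_filtration _ _)); first by apply: hN => //; apply: leq_maxl.
by apply: (filt_le (@sfil_filtration _ _)) (hN' n' (leq_maxr _ _)); lia.
Qed.

Lemma lim_fil V W (A : nat -> lhom (Sym V) (Sym W)) (g : lhom (Sym V) (Sym W)) (k : nat) :
  tends0 (@hfil K V W) (fun n => A n - g) -> (forall n, (0 < n)%N -> hfil k (A n)) -> hfil k g.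
Proof.
move=> h hA; have [N hN] := h k.
have -> : g = A N.+1 - (A N.+1 - g) by rewrite opprB addrC subrK.
by apply: (filtB (hfil_filtration _ _)); [apply: hA | apply: hN; apply: leqnSn].
Qed.

Lemma eventually_tends0 (A : zmodType) (fA : int -> A -> Prop) (u v : nat -> A) M :
  (forall n, (M <= n)%N -> u n = v n) -> tends0 fA v -> tends0 fA u.
Proof.
move=> e hv k; have [N hN] := hv k; exists (maxn M N) => n.
by rewrite geq_max => /andP[/e -> /hN].
Qed.

Lemma tends0_scale V W c (A : nat -> lhom (Sym V) (Sym W)) :
  tends0 (@hfil K V W) A -> tends0 (@hfil K V W) (fun n => c *: A n).
Proof. by move=> h k; have [N hN] := h k; exists N => n /hN; apply: hfilZ. Qed.

Lemma nulls_compl V W X (A : nat -> lhom (Sym V) (Sym W)) (g : lhom (Sym W) (Sym X)) :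
  hfil 0 g -> nulls (@hfil K V W) A -> nulls (@hfil K V X) (fun n => g ** A n).
Proof.
move=> g0 [A0 hA]; split=> [n|k]; first exact: hfil_comp0l.
by have [N hN] := hA k; exists N => n /hN; apply: hfil_comp0l.
Qed.

Lemma tends0_compl V W X (A : nat -> lhom (Sym V) (Sym W)) (g : lhom (Sym W) (Sym X)) :
  hfil 0 g -> tends0 (@hfil K V W) A -> tends0 (@hfil K V X) (fun n => g ** A n).
Proof. by move=> g0 hA k; have [N hN] := hA k; exists N => n /hN; apply: hfil_comp0l. Qed.

Lemma psum_compl V W X (A : nat -> lhom (Sym V) (Sym W)) (g : lhom (Sym W) (Sym X)) n :
  psum (fun j => g ** A j) n = g ** psum A n.
Proof. by rewrite /psum comp_sumr. Qed.

(** Convergence is assumed for Taylor coefficients only. [comults_spr], used for the series and for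
    the limit, passes it from Sym^r to Sym^{r+1}; a word meets finitely many components, and
    [uniform_lim] makes the pointwise convergence uniform. *)
Lemma comults_lim V W (A : nat -> lhom (Sym V) (Sym W)) (g : lhom (Sym V) (Sym W)) :
  nulls (@hfil K V W) A -> comults A -> (forall m, A m (sone V) = psone W m) ->
  hcop W ** g = htens g g ** hcop V -> g (sone V) = sone W ->
  (forall x, tends0 (@sfil K W) (fun n => psum (fun j => spr 1 (A j x)) n - spr 1 (g x))) ->
  complete_filtration V -> tends0 (@hfil K V W) (fun n => psum A n - g).
Proof.
move=> hA Acop A1 gcop g1 h hV.
have gc := comults_consts gcop; have g1' := consts_one g1.
have An r : nulls (@hfil K V W) (fun j => hspr W r ** A j).
  exact: nulls_compl (@hfil_spr _ _ r) hA.
have h1 : tends0 (@hfil K V W) (fun n => psum (fun j => hspr W 1 ** A j) n - hspr W 1 ** g).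
  by apply: uniform_lim => // x; apply: eq_tends0 (h x).
have gf1 : hfil 0 (hspr W 1 ** g).
  by apply: (lim_fil (k := 0) h1) => n _; apply: (psum_fil (hfil_filtration _ _)) => j; case: (An 1%N).
have hr r : tends0 (@hfil K V W) (fun n => psum (fun j => hspr W r ** A j) n - hspr W r ** g).
  elim: r => [|r IH].
    apply: (@eventually_tends0 _ _ _ (fun=> 0) 1) => [n n0|k]; last first.
      by exists 0%N => n _; exact: (filt0 (hfil_filtration _ _)).
    rewrite -[hspr W 0 ** g]/(hspr W 0 ** consts g 0) (comults_counit gc g1').
    case: n n0 => // n _; rewrite /psum big_ord_recl big1 ?addr0 => [|j _];
      by rewrite (comults_counit Acop A1) ?subrr.
  pose c : K := (r.+1%:R)^-1.
  have c0 : c * r.+1%:R = 1 by rewrite /c mulVf // (nat_succ_neq0 charK).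
  have E (X : nat -> lhom (Sym V) (Sym W)) m : comults X -> hspr W r.+1 ** X m =
    c *: cau (@hstar K V W) (fun j => hspr W 1 ** X j) (fun j => hspr W r ** X j) m.
    by move=> hX; rewrite -[RHS](congr1 _ (comults_spr r m hX)) scalerA c0 scale1r.
  have e n : psum (fun j => hspr W r.+1 ** A j) n - hspr W r.+1 ** g =
    c *: (psum (cau (@hstar K V W) (fun j => hspr W 1 ** A j) (fun j => hspr W r ** A j)) n -
      hstar (hspr W 1 ** g) (hspr W r ** g)).
    rewrite scalerBr; congr (_ - _).
      by rewrite scaler_sumr; apply: eq_bigr => j _; rewrite E.
    rewrite -[hspr W r.+1 ** g]/(hspr W r.+1 ** consts g 0) E // /cau big_ord1.
    by [].
  apply: eq_tends0 (tends0_scale c _); first by move=> n; rewrite e.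
  apply: (psum_cau (hfil_filtration _ _) (hfil_filtration _ _)
    (biadd_hstar _ _) (@hfil_star _ _ _)
    (al := fun=> hspr W 1 ** g) (be := fun=> hspr W r ** g)) => //.
apply: uniform_lim => //; apply: mon_ind => [|a w y hy].
  move=> k; exists 0%N => n _; rewrite hom_zero /psum big1 ?subr0 => [|j _]; last exact: hom_zero.
  exact: lspan0.
have hw : tends0 (@sfil K W) (fun n => psum (fun j => A j (mon w)) n - g (mon w)).
  case: (boolP (w == [::])) => [/eqP ->|w0].
    apply: (@eventually_tends0 _ _ _ (fun=> 0) 1) => [n n0|k]; last first.
      by exists 0%N => n _; exact: lspan0.
    rewrite -[mon [::]]/(sone V) g1; case: n n0 => // n _.
    by rewrite /psum big_ord_recl A1 big1 ?addr0 ?subrr => // j _; rewrite A1.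
  apply: (@eq_tends0 _ _ (fun n => \sum_(1 <= k < (size w).+1)
     (psum (fun j => hspr W k ** A j) n - hspr W k ** g) (mon w))).
    move=> n; rewrite -[g (mon w)]/(consts g 0 (mon w)) (comults_split charK gc g1') //.
    rewrite sumrB; congr (_ - _); under eq_bigr => k _ do rewrite psum_hom.
    rewrite /psum exchange_big; apply: eq_bigr => j _.
    by rewrite [RHS](comults_split charK Acop A1).
  elim: (index_iota _ _) => [|r s IH].
    by move=> k; exists 0%N => n _; rewrite big_nil; exact: lspan0.
  apply: eq_tends0 (tends0D (@sfil_filtration _ _) (tends0_eval (mon w) hV (hr r)) IH) => n.
  by rewrite big_cons.
move=> k; have [M hM] := hw k; have [N hN] := hy k; exists (maxn M N) => n.
rewrite geq_max => /andP[/hM h2 /hN h3].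
have -> : psum (fun j => A j (a *: mon w + y)) n - g (a *: mon w + y) =
  a *: (psum (fun j => A j (mon w)) n - g (mon w)) + (psum (fun j => A j y) n - g y).
  rewrite -!psum_hom hom_add hom_scale hom_add hom_scale scalerBr opprD addrACA.
  by [].
by apply: lspanD => //; apply: lspanZ.
Qed.

Lemma vpow_fil V (x : Sym V) (n : nat) : sfil 1 x -> sfil n (vpow x n).
Proof.
move=> hx; elim: n => [|n IH]; first by apply: sfil_mon.
by rewrite intS; apply: vee_sfil.
Qed.

Lemma vpow_deg V (x : Sym V) n : sdeg 0 x -> sdeg 0 (vpow x n).
Proof.
move=> hx; elim: n => [|n IH]; first by have := sdeg_mon ([::] : word V); rewrite wdeg0.
by rewrite -[0]addr0; apply: vee_sdeg.
Qed.

Lemma sexp_fil V (x : Sym V) n : sfil 1 x -> sfil 0 (sexp n x).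
Proof.
move=> hx; apply: lspan_sum => i _; apply: lspanZ.
by apply: (filt_le (@sfil_filtration _ _)) (vpow_fil i hx).
Qed.

Lemma pspow_fil V (p : nat -> Sym V) (n m : nat) : (forall j, sfil 1 (p j)) -> sfil n (pspow p n m).
Proof.
move=> hp; elim: n m => [|n IH] m.
  by case: m => [|m]; [apply: sfil_mon | exact: lspan0].
by rewrite intS; apply: lspan_sum => j _; apply: vee_sfil.
Qed.

Lemma nulls_pspow V (p : nat -> Sym V) n : (forall j, sfil 1 (p j)) ->
  tends0 (@sfil K V) p -> nulls (@sfil K V) (pspow p n).
Proof.
move=> p1 hp; elim: n => [|n IH].
  split=> [[|m]|k]; [by apply: sfil_mon|exact: lspan0|].
  by exists 1%N => -[//|m] _; exact: lspan0.
apply: (nulls_cau (@sfil_filtration _ _) (@vee_sfil _ _)) IH; split=> // j.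
by apply: (filt_le (@sfil_filtration _ _)) (p1 j).
Qed.

Lemma psexp_lim V (p : nat -> Sym V) (al : Sym V) n : (forall j, sfil 1 (p j)) ->
  tends0 (@sfil K V) p -> sfil 1 al ->
  tends0 (@sfil K V) (fun N => psum p N - al) ->
  tends0 (@sfil K V) (fun N => psum (psexp n p) N - sexp n al).
Proof.
move=> p1 hp al1 hal.
have al0 : sfil 0 al by apply: (filt_le (@sfil_filtration _ _)) al1.
have p0 : nulls (@sfil K V) p.
  by split=> // j; apply: (filt_le (@sfil_filtration _ _)) (p1 j).
have hpow i : tends0 (@sfil K V) (fun N => psum (pspow p i) N - vpow al i).
  elim: i => [|i IH].
    apply: (@eventually_tends0 _ _ _ (fun=> 0) 1) => [N N0|k]; last first.
      by exists 0%N => N _; exact: lspan0.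
    by case: N N0 => // N _; rewrite /psum big_ord_recl big1 ?addr0 ?subrr.
  apply: (psum_cau (@sfil_filtration _ _) (@sfil_filtration _ _) (biadd_vee V)
    (@vee_sfil _ _) (al := fun=> al) (be := fun=> vpow al i)) => //.
  exact: nulls_pspow.
have e N : psum (psexp n p) N - sexp n al =
    \sum_(i < n) (i`!%:R)^-1 *: (psum (pspow p i) N - vpow al i).
  rewrite /psum /psexp exchange_big -sumrB; apply: eq_bigr => i _.
  by rewrite scalerBr scaler_sumr.
apply: eq_tends0 (fun N => esym (e N)) _; elim: (index_enum _) => [|i s IH].
  by move=> k; exists 0%N => N _; rewrite big_nil; exact: lspan0.
apply: eq_tends0 (tends0D (@sfil_filtration _ _) _ IH) => [N|]; first by rewrite big_cons.
by move=> k; have [M hM] := hpow i k; exists M => N /hM; apply: lspanZ.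
Qed.

(** Powers from the k-th on lie in filtration k, for every order in t. Modulo filtration k both
    exponentials can thus be cut at k, which leaves finitely many powers to compare. *)
Lemma exp_lim V (p : nat -> Sym V) (al : Sym V) (E : nat -> lhom (Sym V) (Sym V)) :
  (forall j, gr1 0 (p j)) -> p 0%N = 0 -> E 0%N = hid _ ->
  ode (@hcomp K _ _ _) (fun j => hmul (pderiv p j)) E ->
  (forall j, sfil 1 (p j)) -> tends0 (@sfil K V) p -> sfil 1 al ->
  tends0 (@sfil K V) (fun N => psum p N - al) ->
  tends0 (@sfil K V) (fun N => psum (fun j => E j (sone V)) N - sexp N al).
Proof.
move=> pg p0 E0 hE p1 hp al1 hal k.
have [N hN] := psexp_lim k p1 hp al1 hal k.
exists (maxn N k) => n; rewrite geq_max => /andP[/hN h2 kn].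
pose e j := E j (sone V).
have h1 : sfil k (psum e n - psum (psexp k p) n).
  rewrite -sumrB; apply: lspan_sum => j _.
  rewrite /e -(exp_psexp charK pg p0 E0 hE (leq_maxr k j.+1)) /psexp.
  rewrite -!(big_mkord xpredT (fun i => (i`!%:R)^-1 *: pspow p i j)).
  rewrite (@big_cat_nat _ _ _ k) ?leq_maxl //= [X in lspan _ X]addrC addKr big_nat.
  apply: lspan_sum => i /andP[ki _]; apply: lspanZ.
  by apply: (filt_le (@sfil_filtration _ _)) (pspow_fil i j p1); lia.
have h3 : sfil k (sexp k al - sexp n al).
  rewrite -opprB -scaleN1r; apply: lspanZ.
  rewrite /sexp -!(big_mkord xpredT (fun i => (i`!%:R)^-1 *: vpow al i)).
  rewrite (@big_cat_nat _ _ _ k 0 n) //= [X in lspan _ X]addrC addKr big_nat.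
  apply: lspan_sum => i /andP[ki _]; apply: lspanZ.
  by apply: (filt_le (@sfil_filtration _ _)) (vpow_fil i al1); lia.
have -> : psum e n - sexp n al = (psum e n - psum (psexp k p) n) +
    (psum (psexp k p) n - sexp k al) + (sexp k al - sexp n al).
  by rewrite !addrA !subrK.
by apply: lspanD => //; apply: lspanD.
Qed.

(** ** Inverses *)

(** From x = a x - (a - id) x, the element x moves from filtration j to j+1 as long as j < k.
    Exhaustiveness provides a starting j, so the inverse is controlled without a Neumann series. *)
Lemma unipotent_fil V (a : lhom (Sym V) (Sym V)) : hfil 1 (a - hid _) ->
  complete_filtration V -> forall k x, sfil k (a x) -> sfil k x.
Proof.
move=> ha hV k x hx; have [j hj] := sfil_exh hV x.
have [jk|kj] := leP j k; last by apply: (filt_le (@sfil_filtration _ _)) hj; apply: ltW.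
have [n e] : exists n : nat, k = j + n%:Z by exists `|k - j|%N; lia.
elim: n j e hj {jk} => [|n IH] j e hj; first by rewrite e addr0.
apply: (IH (j + 1)); first by rewrite e intS addrA.
have -> : x = a x - (a - hid _) x by rewrite homBE opprB addrC subrK.
apply: lspanB; last by rewrite addrC; apply: ha.
by apply: (filt_le (@sfil_filtration _ _)) hx; rewrite e intS addrA lerDl.
Qed.

(** * Projection to a fixed degree, used for inverses of degree 0 maps *)

Section DegreeProjection.
Variable (V : fgspace K) (d : int).

Let degw (w : word V) : Sym V := if wdeg w == d then mon w else 0.

Let degw_rel g : sym_rel g -> ext degw g = 0.
Proof.
apply: sym_lift => {g} [u w i c a b|u w a b]; rewrite /degw !wdeg_cat !wdeg_cons /=.
  by case: ifP => _; [exact: mon_lin | rewrite scaler0 addr0].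
by rewrite (addrCA (tag a)); case: ifP => _; [exact: mon_comm | rewrite scaler0].
Qed.

Definition degproj : lhom (Sym V) (Sym V) := locked (LHom (plift_linear degw_rel)).

Lemma degprojE w : degproj (mon w) = if wdeg w == d then mon w else 0.
Proof. by rewrite /degproj -lock; exact: plift_gen degw_rel w. Qed.

Lemma degproj_sdeg x : sdeg d (degproj x).
Proof.
move: x; apply: mon_ind => [|a w y hy]; first by rewrite hom_zero; exact: lspan0.
rewrite hom_linear; apply: lspanD => //; apply: lspanZ; rewrite degprojE.
by case: eqP => [<-|_]; [exact: sdeg_mon | exact: lspan0].
Qed.

Lemma degproj_id x : sdeg d x -> degproj x = x.
Proof.
move: x; apply: sdeg_ind => [|a w y e hy]; first exact: hom_zero.
by rewrite hom_linear hy degprojE e eqxx.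
Qed.
End DegreeProjection.

Lemma degproj_comm V W (a : lhom (Sym V) (Sym W)) d : hdeg 0 a ->
  degproj W d ** a = a ** degproj V d.
Proof.
move=> ha; apply: mon_ext => w; rewrite !hcompE degprojE.
have hw := ha _ _ (sdeg_mon w); rewrite add0r in hw.
case: eqP => [e|ne]; first by apply: degproj_id; rewrite -e.
rewrite hom_zero; move: (a (mon w)) hw; apply: sdeg_ind => [|c u y e hy]; first exact: hom_zero.
by rewrite hom_linear hy degprojE e; case: eqP ne => // _ _; rewrite scaler0 addr0.
Qed.

(** A map of degree 0 commutes with the projection to degree i, and therefore its inverse does
    too. *)
Lemma inverse_deg V (a b : lhom (Sym V) (Sym V)) : cancel a b -> cancel b a ->
  hdeg 0 a -> hdeg 0 b.
Proof.
move=> ab ba ha i x hx; rewrite add0r.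
suff -> : b x = degproj V i (b x) by exact: degproj_sdeg.
apply: (can_inj ab); rewrite ba.
have := congr1 (fun f => hom_fun f (b x)) (degproj_comm i ha); rewrite !hcompE ba => <-.
by rewrite degproj_id.
Qed.

Lemma inverse_linear V (a : lhom (Sym V) (Sym V)) (b : Sym V -> Sym V) :
  cancel a b -> cancel b a -> linear b.
Proof. by move=> ab ba c x y; apply: (can_inj ab); rewrite hom_linear !ba. Qed.

Lemma inverse_cop V (a b : lhom (Sym V) (Sym V)) : cancel a b -> cancel b a ->
  hcop V ** a = htens a a ** hcop V -> hcop V ** b = htens b b ** hcop V.
Proof.
move=> ab ba h.
have ba1 : a ** b = hid _ by apply: hom_ext.
have ab1 : b ** a = hid _ by apply: hom_ext.
rewrite -[LHS]hcomp1l -htens1 -ab1 -htens_comp -hcompA; congr (_ ** _).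
by rewrite hcompA -h -hcompA ba1 hcomp1r.
Qed.

(** ** Limits in Sym^1 *)

(** [the_lim] chooses some limit in Sym^1, with default 0; separation identifies it with any limit
    at hand. *)
Lemma the_limE V i (u : nat -> Sym V) l : complete_filtration V -> gr1 i l ->
  tends0 (@sfil K V) (fun n => u n - l) -> the_lim (@sfil K V) (gr1 i) u = l.
Proof.
move=> hV hl hu; rewrite /the_lim; case: xgetP => [x _ [hx /flimE hx']|]; last first.
  by move=> /(_ l); case; split=> //; apply/flimE.
apply/eqP; rewrite -subr_eq0; apply/eqP; apply: (spr1_sep hV) => [|k].
  by rewrite -[LHS]/(hspr V 1 _) hom_sub /= !(spr1_gr1 (i := i)).
have [M hM] := hu k; have [N hN] := hx' k.
have -> : x - l = (u (maxn M N) - l) - (u (maxn M N) - x) by rewrite opprB [RHS]addrC addrA subrK.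
by apply: lspanB; [apply: hM; apply: leq_maxl | apply: hN; apply: leq_maxr].
Qed.

Lemma the_lim_stable V i (u : nat -> Sym V) l m : complete_filtration V -> gr1 i l ->
  (forall N, (m < N)%N -> u N = l) -> the_lim (@sfil K V) (gr1 i) u = l.
Proof.
move=> hV hl e; apply: the_limE => //.
apply: (@eventually_tends0 _ _ _ (fun=> 0) m.+1) => [n /e ->|k]; first by rewrite subrr.
by exists 0%N => n _; exact: lspan0.
Qed.
End Limits.

(** * The homotopy *)

Section Estimates.
Variable K : fieldType.
Hypothesis charK : [pchar K] =i pred0.

Lemma hfil_rcomp (V W : fgspace K) k l (p : lhom (Sym V) (Sym V)) (a : lhom (Sym V) (Sym W)) :
  hfil k p -> hfil l a -> hfil (k + l) (rcomp p a).
Proof.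
by move=> hp ha; apply: (filtN (hfil_filtration _ _)); rewrite addrC; apply: hfil_comp.
Qed.

Lemma exp_nulls (V : fgspace K) (p : nat -> Sym V) E : (forall j, sfil 1 (p j)) ->
  tends0 (@sfil K V) p -> E 0%N = hid _ ->
  ode (@hcomp K _ _ _) (fun j => hmul (pderiv p j)) E ->
  nulls (@hfil K V V) E /\ forall m, hfil 1 (E m.+1).
Proof.
move=> p1 hp E0; apply: (ode_fil charK (hfil_filtration _ _) (@hfilZ _ _ _) (@hfil_comp _ _ _ _)).
- by move=> j; apply: hfil_mul; rewrite /pderiv -scaler_nat; apply: sfilZ.
- move=> k; have [N hN] := hp k; exists N => j Nj; apply: hfil_mul.
  by rewrite /pderiv -scaler_nat; apply: sfilZ; apply: hN; lia.
- by rewrite E0; apply: hfil_id.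
Qed.

Variables (L : fgspace K) (Q : Sym (shift L 1) -> Sym (shift L 1)) (hQ : flat_Linfty Q).
Variable l : nat -> Sym (shift L 1).
Hypotheses (l1 : forall j, sfil 1 (l j)) (hl : tends0 (@sfil K _) l).

Lemma gauge_tends0 : tends0 (@hfil K _ _) (gauge_op hQ l).
Proof. by move=> k; have [N hN] := hl k; exists N => j /hN; apply: gauge_fil. Qed.

Lemma gflow_nulls Psi : Psi 0%N = hid _ -> ode (@hcomp K _ _ _) (gauge_op hQ l) Psi ->
  nulls (@hfil K _ _) Psi /\ forall m, hfil 1 (Psi m.+1).
Proof.
move=> Psi0; apply: (ode_fil charK (hfil_filtration _ _) (@hfilZ _ _ _) (@hfil_comp _ _ _ _)).
- by move=> j; apply: gauge_fil.
- exact: gauge_tends0.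
- by rewrite Psi0; apply: hfil_id.
Qed.

Lemma rflow_nulls Theta : Theta 0%N = hid _ -> ode (@rcomp K _ _) (gauge_op hQ l) Theta ->
  nulls (@hfil K _ _) Theta /\ forall m, hfil 1 (Theta m.+1).
Proof.
move=> Theta0; apply: (ode_fil charK (hfil_filtration _ _) (@hfilZ _ _ _) (@hfil_rcomp _ _)).
- by move=> j; apply: gauge_fil.
- exact: gauge_tends0.
- by rewrite Theta0; apply: hfil_id.
Qed.

End Estimates.

Lemma eval_one_fil (K : fieldType) (V W : fgspace K) k (f : lhom (Sym V) (Sym W)) :
  hfil k f -> sfil k (f (sone V)).
Proof. by move=> h; rewrite -[k]addr0; apply: h; apply: sfil_mon. Qed.

Lemma nulls_eval_one (K : fieldType) (V W : fgspace K) (A : nat -> lhom (Sym V) (Sym W)) :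
  nulls (@hfil K V W) A -> nulls (@sfil K W) (fun j => A j (sone V)).
Proof.
move=> [A0 hA]; split=> [j|k]; first exact: eval_one_fil.
by have [N hN] := hA k; exists N => j /hN; apply: eval_one_fil.
Qed.

Section Homotopy.
Variables (K : fieldType) (charK : [pchar K] =i pred0) (L L' : fgspace K).
Local Notation V := (shift L 1).
Local Notation V' := (shift L' 1).
Local Notation S := (Sym V).
Local Notation S' := (Sym V').
Variables (Q : S -> S) (Q' : S' -> S') (hQ : flat_Linfty Q) (hQ' : flat_Linfty Q').
Variables (F : S -> S') (hF : Linfty_morphism Q Q' F).
Local Notation f := (mor_hom hF).
Variables (pt lt : nat -> S).
Hypotheses (pt0 : pt 0%N = 0) (ptg : forall j, gr1 0 (pt j)) (ltg : forall j, gr1 (-1) (lt j)).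
Hypotheses (pt1 : forall j, sfil 1 (pt j)) (lt1 : forall j, sfil 1 (lt j)).
Hypotheses (ptn : tends0 (@sfil K _) pt) (ltn : tends0 (@sfil K _) lt).
Variables (Psi : nat -> lhom S S).
Hypotheses (Psi0 : Psi 0%N = hid _) (hPsi : ode (@hcomp K _ _ _) (gauge_op hQ lt) Psi).
Hypothesis PsiE : forall N m, (m < N)%N -> psexp N pt m = Psi m (sone V).
Local Notation lt' := (push_gauge_coef F lt Psi).
Variables (Psi' Theta : nat -> lhom S' S').
Hypotheses (Psi'0 : Psi' 0%N = hid _) (hPsi' : ode (@hcomp K _ _ _) (gauge_op hQ' lt') Psi').
Hypotheses (Theta0 : Theta 0%N = hid _) (hTheta : ode (@rcomp _ _ _) (gauge_op hQ' lt') Theta).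

Definition push_path_coef (m : nat) : S' := spr 1 (Psi' m (sone V')).
Local Notation pt' := push_path_coef.
Local Notation mpath := (mor_path hF Psi Theta).
Local Notation gpath := (gauge_path hF lt Psi Theta).

Let hV := complete_shift 1 (Linfty_complete hQ).
Let hV' := complete_shift 1 (Linfty_complete hQ').
Let lt'g := push_gauge_gr1 charK hF ltg Psi0 hPsi.
Let f0 := mor_hom_fil hF.
Let PsiN := (gflow_nulls charK lt1 ltn Psi0 hPsi).1.

Lemma spr_fil (W : fgspace K) n k (x : Sym W) : sfil k x -> sfil k (spr n x).
Proof. by move=> h; have := @hfil_spr K W n k x h; rewrite add0r. Qed.

Lemma F_fil k x : sfil k x -> sfil k (F x).
Proof. by move=> h; have := f0 h; rewrite add0r. Qed.

Lemma push_gauge_fil1 j : sfil 1 (lt' j).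
Proof.
apply/spr_fil/F_fil; apply: (filt_sum (@sfil_filtration _ _)) => i _.
by apply: (opf0r (@vee_sfil _ _)) => //; apply: (nulls_eval_one PsiN).1.
Qed.

Lemma push_gauge_tends0 : tends0 (@sfil K _) lt'.
Proof.
have ltN : nulls (@sfil K _) lt.
  by split=> // j; apply: (filt_le (@sfil_filtration _ _)) (lt1 j).
have [_ h] := nulls_cau (@sfil_filtration _ _) (@vee_sfil _ _) ltN (nulls_eval_one PsiN).
by move=> k; have [N hN] := h k; exists N => j /hN hj; exact/spr_fil/F_fil.
Qed.

Let Psi'N := gflow_nulls charK push_gauge_fil1 push_gauge_tends0 Psi'0 hPsi'.
Let ThetaN := (rflow_nulls charK push_gauge_fil1 push_gauge_tends0 Theta0 hTheta).1.

Lemma push_path_gr1 j : gr1 0 (pt' j).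
Proof.
apply/gr1P; split; first by rewrite spr_spr.
have := gflow_deg charK lt'g Psi'0 hPsi' j (sdeg_mon [::]).
by rewrite wdeg0 add0r; apply: spr_deg.
Qed.

Lemma push_path0 : pt' 0%N = 0.
Proof. by rewrite /push_path_coef Psi'0 sprsone. Qed.

Lemma push_path_fil1 j : sfil 1 (pt' j).
Proof.
case: j => [|j]; first by rewrite push_path0; exact: lspan0.
by apply: spr_fil; apply: eval_one_fil; exact: Psi'N.2.
Qed.

Lemma push_path_tends0 : tends0 (@sfil K _) pt'.
Proof. by move=> k; have [N hN] := (nulls_eval_one Psi'N.1).2 k; exists N => j /hN hj; exact/spr_fil. Qed.

Lemma mor_flow_exp m : F (Psi m (sone V)) = Psi' m (sone V').
Proof. exact: (mor_flow_one charK hF ltg Psi0 hPsi Psi'0 hPsi'). Qed.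

Lemma push_gaugeE : push_gauge F pt lt = lt'.
Proof.
apply/funext => m; apply: (the_lim_stable (m := m) hV') => [|N mN]; first exact: lt'g.
congr (spr 1 (F _)); apply: eq_cau => // j jm; apply: PsiE; lia.
Qed.

Lemma psexpbarE N m : (0 < N)%N -> psexpbar N pt m = psexp N pt m - psone V m.
Proof.
move=> N0; rewrite /psexp -(big_mkord xpredT (fun n => (n`!%:R : K)^-1 *: pspow pt n m)).
by rewrite (big_ltn N0) fact0 invr1 scale1r addrC addKr.
Qed.

Lemma push_pathE : push_path F pt = pt'.
Proof.
apply/funext => m; apply: (the_lim_stable (m := m) hV') => [|N mN]; first exact: push_path_gr1.
 rewrite psexpbarE ?PsiE //; last by lia.
rewrite -[LHS]/(hspr V' 1 (f _)) !hom_sub /= mor_flow_exp.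
case: m mN => [|m] _ /=; last by rewrite (lin0 (cm_linear (mor_coalg hF))) spr_zero subr0.
by rewrite (cm_one (mor_coalg hF)) sprsone subr0.
Qed.

Lemma mor_path_nulls : nulls (@hfil K V V') mpath.
Proof.
apply: (nulls_cau (hfil_filtration _ _) (@hfil_comp _ _ _ _) ThetaN).
exact: (nulls_compl f0 PsiN).
Qed.

Lemma defect_nulls : nulls (@hfil K V V') (defect hF lt Psi).
Proof.
have D k j : sfil k (lt j) -> sfil k (lt' j) -> hfil k (defect hF lt Psi j).
  move=> h h'; apply: (filtB (hfil_filtration _ _)).
    by apply: hfil_comp0l => //; apply: hfil_mul.
  by apply: hfil_comp0r => //; apply: hfil_mul.
split=> [j|k].
  apply: D; apply: (filt_le (@sfil_filtration _ _) (k := 1)) => //; exact: push_gauge_fil1.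
have [M hM] := ltn k; have [N hN] := push_gauge_tends0 k; exists (maxn M N) => j.
by rewrite geq_max => /andP[/hM h /hN h']; apply: D.
Qed.

Lemma gauge_path_nulls : nulls (@hfil K V V') gpath.
Proof.
apply: (nulls_cau (hfil_filtration _ _) (@hfil_comp _ _ _ _) ThetaN).
exact: (nulls_cau (hfil_filtration _ _) (@hfil_comp _ _ _ _) defect_nulls PsiN).
Qed.

(** ** Evaluation of the path at t = 1 *)

Variables (E E' : nat -> lhom S S) (G' : nat -> lhom S' S').
Hypotheses (E0 : E 0%N = hid _) (hE : ode (@hcomp K _ _ _) (fun j => hmul (pderiv pt j)) E).
Hypotheses (E'0 : E' 0%N = hid _)
  (hE' : ode (@hcomp K _ _ _) (fun j => hmul (pderiv (fun j => - pt j) j)) E').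
Hypotheses (G'0 : G' 0%N = hid _)
  (hG' : ode (@hcomp K _ _ _) (fun j => hmul (pderiv (fun j => - pt' j) j)) G').
Local Notation phi := (twisted_flow Psi E').
Local Notation phi' := (twisted_flow Psi' G').

Lemma hcomp_series_assoc (X Y Z T : lmodType K) (a : nat -> lhom Z T) (b : nat -> lhom Y Z)
    (c : nat -> lhom X Y) :
  cau (@hcomp K _ _ _) a (cau (@hcomp K _ _ _) b c) =
  cau (@hcomp K _ _ _) (cau (@hcomp K _ _ _) a b) c.
Proof.
apply/funext => m; rewrite cau_caur; last exact: (biadd_hcomp _ _ _).2.
rewrite cau_caul; last exact: (biadd_hcomp _ _ _).1.
by apply: eq_cau3 => *; rewrite hcompA.
Qed.

Definition twisted_path : nat -> lhom S S' := cau (@hcomp K _ _ _) G' (fun j => f ** E j).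

Lemma path_identity :
  cau (@hcomp K _ _ _) phi' mpath = cau (@hcomp K _ _ _) twisted_path phi.
Proof.
rewrite /twisted_flow /mor_path /twisted_path -!hcomp_series_assoc; congr cau.
rewrite !hcomp_series_assoc.
have -> : cau (@hcomp K _ _ _) Psi' Theta = consts (hid _).
  by apply/funext => m; exact: (rode_ode_inv charK m Psi'0 hPsi' Theta0 hTheta).
apply/funext => m; rewrite (cau_constsl _ _ _ (biadd_hcomp _ _ _)) hcomp1l -hcomp_series_assoc.
transitivity (f ** cau (@hcomp K _ _ _) E phi m).
  by rewrite (exp_twisted_flow charK Psi ptg E0 hE E'0 hE').
by rewrite cau_compl; apply: eq_bigr => j _; rewrite hcompA.
Qed.

Let EN := (exp_nulls charK pt1 ptn E0 hE).1.

Let E'N : nulls (@hfil K _ _) E' /\ forall m, hfil 1 (E' m.+1).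
Proof.
apply: (exp_nulls charK _ _ E'0 hE') => [j|].
  exact: (filtN (@sfil_filtration _ _)).
exact: (tends0N (@sfil_filtration _ _)).
Qed.

Let G'N : nulls (@hfil K _ _) G' /\ forall m, hfil 1 (G' m.+1).
Proof.
apply: (exp_nulls charK _ _ G'0 hG') => [j|].
  exact/(filtN (@sfil_filtration _ _))/push_path_fil1.
exact/(tends0N (@sfil_filtration _ _))/push_path_tends0.
Qed.

Lemma twisted_flow_nulls : nulls (@hfil K _ _) phi.
Proof. exact: (nulls_cau (hfil_filtration _ _) (@hfil_comp _ _ _ _) E'N.1 PsiN). Qed.

Lemma twisted_flow_nulls' : nulls (@hfil K _ _) phi'.
Proof. exact: (nulls_cau (hfil_filtration _ _) (@hfil_comp _ _ _ _) G'N.1 Psi'N.1). Qed.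

Lemma twisted_flow_fil1 m : hfil 1 (phi' m.+1).
Proof.
apply: (filt_sum (hfil_filtration _ _)) => j _; case: (nat_of_ord j) => [|i].
  by apply: hfil_comp0l; [case: G'N => -[] | rewrite subn0; exact: Psi'N.2].
by apply: hfil_comp0r; [exact: G'N.2 | case: Psi'N => -[]].
Qed.

Variable p : S.
Hypotheses (p1 : sfil 1 p) (pg : gr1 0 p) (plim : tends0 (@sfil K _) (fun n => psum pt n - p)).

Lemma psum_one_lim : tends0 (@sfil K _) (fun n => psum (fun j => E j (sone V)) n - sexp n p).
Proof. exact: (exp_lim charK ptg pt0 E0 hE pt1 ptn p1 plim). Qed.

(** The partial sums of pi'(t) at t = 1 and the truncations F^1 of the reduced exponential of pi
    differ by a null sequence. The latter are therefore Cauchy, and completeness of L' supplies the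
    limit without which [the_lim] would return its default. *)
Lemma push_MC_lim :
  sfil 1 (push_MC F p) /\ tends0 (@sfil K _) (fun n => psum pt' n - push_MC F p).
Proof.
pose v n := spr 1 (F (sexpbar n p)).
have h1 : tends0 (@sfil K _) (fun n => psum pt' n - v n).
  apply: (@eventually_tends0 _ _ _
      (fun n => spr 1 (F (psum (fun j => E j (sone V)) n - sexp n p))) 1) => [n n0|k].
    have -> : sexp n p = sone V + sexpbar n p.
      rewrite /sexp -(big_mkord xpredT (fun n => (n`!%:R : K)^-1 *: vpow p n)).
      by rewrite (big_ltn n0) fact0 invr1 scale1r.
    rewrite -[RHS]/(hspr V' 1 (f _)) !hom_sub !hom_add opprD addrA; congr (_ - _).
    rewrite /= (cm_one (mor_coalg hF)) sprsone subr0.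
    rewrite -[RHS]/(hspr V' 1 (f _)) /psum !hom_sum; apply: eq_bigr => j _ /=.
    by rewrite -(exp_psexp charK ptg pt0 E0 hE (ltnSn j)) PsiE // mor_flow_exp.
  by have [N hN] := psum_one_lim k; exists N => n /hN hn; exact/spr_fil/F_fil.
have vg n : gr1 0 (v n).
  apply/gr1P; split; first by rewrite spr_spr.
  have hs : sdeg 0 (sexpbar n p).
    by apply: lspan_sum => i _; apply/lspanZ/vpow_deg; case/gr1P: pg.
  by have := mor_hom_deg hF hs; rewrite add0r; apply: spr_deg.
have [l lg hl] : exists2 l, gr1 0 l & tends0 (@sfil K _) (fun n => v n - l).
  apply: (gr1_limit hV' vg) => k; have [M hM] := h1 k.
  have [N hN] := psum_cauchy (@sfil_filtration _ _) push_path_tends0 k.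
  exists (maxn M N) => m n; rewrite !geq_max => /andP[Mm Nm] /andP[Mn Nn].
  have -> : v m - v n = (psum pt' m - psum pt' n) + (psum pt' n - v n) - (psum pt' m - v m).
    by rewrite addrA subrK opprB [RHS]addrC addrA subrK.
  apply: lspanB; last exact: hM.
  by apply: lspanD; [apply: hN | apply: hM].
rewrite /push_MC (the_limE hV' lg hl).
have h2 : tends0 (@sfil K _) (fun n => psum pt' n - l).
  by apply: eq_tends0 (tends0D (@sfil_filtration _ _) h1 hl) => n; rewrite addrA subrK.
split=> //; have [N hN] := h2 1%N.
have -> : l = psum pt' N - (psum pt' N - l) by rewrite opprB addrC subrK.
apply: lspanB; last exact: hN.
exact: (psum_fil (@sfil_filtration _ _) _ push_path_fil1).
Qed.

(** The value at t = 1 is expressed against truncations, because exp(al) need not lie in Sym. *)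
Lemma exp_hmul (W : fgspace K) (r : nat -> Sym W) (X : nat -> lhom (Sym W) (Sym W)) al :
  (forall j, gr1 0 (r j)) -> r 0%N = 0 -> X 0%N = hid _ ->
  ode (@hcomp K _ _ _) (fun j => hmul (pderiv r j)) X ->
  (forall j, sfil 1 (r j)) -> tends0 (@sfil K _) r -> sfil 1 al ->
  tends0 (@sfil K _) (fun N => psum r N - al) ->
  tends0 (@hfil K _ _) (fun N => psum X N - hmul (sexp N al)).
Proof.
move=> rg r0 X0 hX r1 hr al1 hal k.
have [N hN] := exp_lim charK rg r0 X0 hX r1 hr al1 hal k; exists N => n /hN hn.
have -> : psum X n - hmul (sexp n al) =
    hmul (psum (fun j => X j (sone W)) n - sexp n al).
  rewrite hmulD (additiveN (@hmulD _ _)) /psum; congr (_ - _).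
  by rewrite (additive_sum (@hmulD _ _)); apply: eq_bigr => j _; exact: (exp_mul charK X0 hX).
exact: hfil_mul.
Qed.

Lemma twisted_path_nulls : nulls (@hfil K V V') twisted_path.
Proof.
exact: (nulls_cau (hfil_filtration _ _) (@hfil_comp _ _ _ _) G'N.1 (nulls_compl f0 EN)).
Qed.

Lemma twisted_path_lim (Fp : S -> S') : twisted_morphism F p Fp ->
  forall x, tends0 (@sfil K V') (fun n => psum (fun j => twisted_path j x) n - Fp x).
Proof.
move=> [_ hFp] x; have [s1 hs] := push_MC_lim; set s := push_MC F p in s1 hs hFp.
have pt'N0 j : gr1 0 (- pt' j) by apply/gr1N/push_path_gr1.
have s1' : sfil 1 (- s) by apply: (filtN (@sfil_filtration _ _)).
have h1 : tends0 (@hfil K V' V') (fun n => psum G' n - hmul (sexp n (- s))).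
  apply: (exp_hmul pt'N0 _ G'0 hG') => //.
  - by rewrite push_path0 oppr0.
  - by move=> j; exact/(filtN (@sfil_filtration _ _))/push_path_fil1.
  - exact/(tends0N (@sfil_filtration _ _))/push_path_tends0.
  - apply: eq_tends0 (tends0N (@sfil_filtration _ _) hs) => n.
    by rewrite /psum sumrN opprB opprK addrC.
have h2 : tends0 (@hfil K V V') (fun n => psum (fun j => f ** E j) n - f ** hmul (sexp n p)).
  apply: eq_tends0 (tends0_compl f0 (exp_hmul ptg pt0 E0 hE pt1 ptn p1 plim)) => n.
  by rewrite psum_compl (biaddBr (biadd_hcomp _ _ _)).
have h3 := psum_cau (hfil_filtration _ _) (hfil_filtration _ _) (biadd_hcomp _ _ _)
  (@hfil_comp _ _ _ _) G'N.1 (nulls_compl f0 EN)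
  (fun n => hfil_mul (sexp_fil n s1')) h1 h2.
apply: eq_tends0 (tends0D (@sfil_filtration _ _) (tends0_eval x hV h3)
  ((flimE _ _).1 (hFp x))) => n.
by rewrite homBE !hcompE !hmulE addrA subrK psum_hom.
Qed.

Variables (a1 g : lhom S S') (b1 : lhom S S) (a1' b1' : lhom S' S').
Hypothesis a1lim : forall x, tends0 (@sfil K V') (fun n => psum (fun j => twisted_path j x) n - a1 x).
Hypothesis b1lim : tends0 (@hfil K V V) (fun n => psum phi n - b1).
Hypothesis a1'lim : tends0 (@hfil K V' V') (fun n => psum phi' n - a1').
Hypotheses (a1'K : cancel a1' b1') (b1'K : cancel b1' a1') (gE : a1' ** g = a1 ** b1).

Lemma limit_fil0 (U W : fgspace K) (A : nat -> lhom (Sym U) (Sym W)) h :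
  nulls (@hfil K U W) A -> tends0 (@hfil K U W) (fun n => psum A n - h) -> hfil 0 h.
Proof.
move=> [A0 _] hA; apply: (lim_fil (k := 0) hA) => n _.
exact: (psum_fil (hfil_filtration _ _)).
Qed.

(** Phi'_t starts with id and its higher coefficients raise the filtration, so its value at t = 1 is
    unipotent. *)
Lemma inverse_fil : hfil 0 b1'.
Proof.
have u : hfil 1 (a1' - hid _).
  apply: (@lim_fil _ _ _ (fun n => psum phi' n - hid _) _ 1) => [|n n0].
    by apply: eq_tends0 a1'lim => n; rewrite opprB addrA subrK.
  case: n n0 => // n _; rewrite /psum big_ord_recl.
  rewrite (_ : phi' 0%N = hid _); last by rewrite /twisted_flow /cau big_ord1 G'0 Psi'0 hcomp1l.
  rewrite addrC addKr; apply: (filt_sum (hfil_filtration _ _)) => j _.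
  exact: twisted_flow_fil1.
by move=> l x hx; rewrite add0r; apply: (unipotent_fil u hV'); rewrite b1'K.
Qed.

(** Summing [path_identity] shows that a1' composed with (partial sum of F_t minus g) tends to 0;
    the inverse b1' preserves the filtration and can be applied. *)
Lemma mor_path_lim : tends0 (@hfil K V V') (fun n => psum mpath n - g).
Proof.
(* The limit of F_t is what is sought, so its partial sums are compared with themselves. *)
have h1 := psum_cau (hfil_filtration _ _) (hfil_filtration _ _) (biadd_hcomp _ _ _)
  (@hfil_comp _ _ _ _) twisted_flow_nulls' mor_path_nulls
  (fun=> limit_fil0 twisted_flow_nulls' a1'lim) a1'lim (be := psum mpath)
  (fun k => ex_intro _ 0%N (fun n _ => eq_ind_r (hfil k) (filt0 (hfil_filtration _ _) k) (subrr _))).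
have a1u := uniform_lim twisted_path_nulls a1lim.
have h2 := psum_cau (hfil_filtration _ _) (hfil_filtration _ _) (biadd_hcomp _ _ _)
  (@hfil_comp _ _ _ _) twisted_path_nulls twisted_flow_nulls
  (fun=> limit_fil0 twisted_path_nulls a1u) (al := fun=> a1) (be := fun=> b1) a1u b1lim.
rewrite path_identity in h1.
have h3 := tends0B (hfil_filtration _ _) h2 h1.
apply: eq_tends0 (tends0_compl inverse_fil h3) => n.
rewrite -gE opprB [X in b1' ** X]addrC addrA subrK -(biaddBr (biadd_hcomp _ _ _)) hcompA.
by rewrite (_ : b1' ** a1' = hid _) ?hcomp1l //; apply: hom_ext.
Qed.

(** The commutator of h with the codifferentials is a coderivation along h. Its Taylor coefficient
    is a limit of zeros in the separated space Sym^1, and a coderivation without Taylor coefficient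
    is zero. *)
Lemma limit_comm (h : lhom S S') : hcop V' ** h = htens h h ** hcop V ->
  h (sone V) = sone V' -> hdeg 0 h -> tends0 (@hfil K V V') (fun n => psum mpath n - h) ->
  h ** codiff hQ = codiff hQ' ** h.
Proof.
set q := codiff hQ; set q' := codiff hQ' => hc h1 hd hlim.
pose D := h ** q - q' ** h.
have Dcop : coders 1 (consts h) (consts D).
  apply: coders_const; rewrite /D !(biaddBr (biadd_hcomp _ _ _)).
  have -> : hcop V' ** (h ** q) = htens (h ** q) h ** hcop V + htens (h ** hsgn V 1) (h ** q) ** hcop V.
    rewrite hcompA hc -hcompA /q codiff_cop (biadd_hcomp _ _ _).2 !hcompA !htens_comp.
    by rewrite hcomp1r.
  have -> : hcop V' ** (q' ** h) = htens (q' ** h) h ** hcop V + htens (h ** hsgn V 1) (q' ** h) ** hcop V.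
    rewrite hcompA /q' codiff_cop (biadd_hcomp _ _ _).1 -!hcompA hc !hcompA !htens_comp.
    by rewrite hcomp1l (hsgn_comm _ hd) ksgn0r scale1r.
  rewrite (biaddBl (biadd_htens _ _ _ _)) (biaddBr (biadd_htens _ _ _ _)).
  by rewrite !(biaddBl (biadd_hcomp _ _ _)) opprD addrACA.
have Dd : hdeg 1 D.
  apply: hdegD; first by apply: hdeg_comp0l => //; exact: codiff_deg.
  by apply: hdegN; apply: hdeg_comp0r => //; exact: codiff_deg.
have D1 : hspr V' 1 ** D = 0.
  apply: hom_ext => x; rewrite hcompE; apply: (spr1_sep hV') => [|k]; first by rewrite /= spr_spr.
  have l1 := tends0_eval (q x) hV hlim.
  have l2 := tends0_eval x hV (tends0_compl (codiff_fil hQ') hlim).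
  have [N hN] := tends0B (@sfil_filtration _ _) l2 l1 k.
  apply: spr_fil; have := hN N (leqnn N); congr sfil.
  have e : psum mpath N (q x) = q' (psum mpath N x).
    rewrite !psum_hom /psum hom_sum; apply: eq_bigr => j _.
    rewrite -!hcompE; congr (hom_fun _ x).
    exact: (mor_path_comm charK hF Psi0 hPsi Theta0 hTheta).
  by rewrite !(homBE, hcompE) hom_sub e opprB [LHS]addrC addrA subrK.
have fc := comults_consts hc; have h1' := consts_one h1.
have Fd j : hdeg 0 (consts h j) by case: j => [|j] //; exact: hdeg0.
have DD j : hdeg 1 (consts D j) by case: j => [|j] //; exact: hdeg0.
have := coders_taylor charK fc Dcop Fd DD (comults_counit fc h1') 0.
rewrite /cau big_ord1 /= D1 (biadd0l (biadd_hstar _ _)) /D.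
by move/eqP; rewrite subr_eq0 => /eqP.
Qed.

End Homotopy.

(** * Assembly of the homotopy *)

Theorem proposition6p20 (K : fieldType) (charK : [pchar K] =i pred0)
  (L L' : fgspace K)
  (Q : Sym (shift L 1) -> Sym (shift L 1))
  (Q' : Sym (shift L' 1) -> Sym (shift L' 1))
  (hQ : flat_Linfty Q) (hQ' : flat_Linfty Q')
  (p : Sym (shift L 1)) (pt lt : nat -> Sym (shift L 1))
  (hp : MC Q p) (hpt : MC_equiv_via Q 0 p pt lt)
  (F : Sym (shift L 1) -> Sym (shift L' 1)) (hF : Linfty_morphism Q Q' F)
  (Fp : Sym (shift L 1) -> Sym (shift L' 1)) (hFp : twisted_morphism F p Fp)
  (Phi1 : Sym (shift L 1) -> Sym (shift L 1))
  (hPhi1 : associated_iso Q pt lt Phi1)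
  (Phi1' invPhi1' : Sym (shift L' 1) -> Sym (shift L' 1))
  (hPhi1' : associated_iso Q' (push_path F pt) (push_gauge F pt lt) Phi1')
  (Phi1'K : cancel Phi1' invPhi1') (invPhi1'K : cancel invPhi1' Phi1') :
  homotopic Q Q' F (fun x => invPhi1' (Fp (Phi1 x))).
Proof.
have [pt0 ptg ltg ptE] := MC_equiv_ode hQ hpt erefl.
have [[ptf ptn'] [ltf ltn'] _ _ plim'] := hpt.
have [pg p1 _] := hp.
have pt1 j : sfil 1 (pt j) by have [] := ptf j.
have lt1 j : sfil 1 (lt j) by have [] := ltf j.
have ptn : tends0 (@sfil K _) pt by move=> k; apply: ptn'.
have ltn : tends0 (@sfil K _) lt by move=> k; apply: ltn'.
have plim : tends0 (@sfil K _) (fun n => psum pt n - p) by exact/flimE.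
have [Psi Psi0 hPsi] := ode_exists (@hcomp K _ _ _) (gauge_op hQ lt) charK (hid _).
have Psi1 := gflow_one_spr1 charK ltg Psi0 hPsi pt0 ptE.
have PsiE := gflow_one_exp charK ltg Psi0 hPsi pt0 ptE.
have [E E0 hE] := ode_exists (@hcomp K _ _ _) (fun j => hmul (pderiv pt j)) charK (hid _).
have [E' E'0 hE'] := ode_exists (@hcomp K _ _ _)
  (fun j => hmul (pderiv (fun j => - pt j) j)) charK (hid _).
pose lt' := push_gauge_coef F lt Psi.
have lt'g : forall j, gr1 (-1) (lt' j) := push_gauge_gr1 charK hF ltg Psi0 hPsi.
have [Psi' Psi'0 hPsi'] := ode_exists (@hcomp K _ _ _) (gauge_op hQ' lt') charK (hid _).
have [Theta Theta0 hTheta] := ode_exists (@rcomp K _ _) (gauge_op hQ' lt') charK (hid _).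
pose pt' := push_path_coef Psi'.
have pt'g := push_path_gr1 charK hF ltg Psi0 hPsi Psi'0 hPsi'.
have pt'0 : pt' 0%N = 0 := push_path0 Psi'0.
(* [G] and [G'] are multiplication by exp(pi'(t)) and exp(-pi'(t)); they identify the given Phi'_t
   with exp(-pi'(t)) v Psi'_t. *)
have [G G0 hG] := ode_exists (@hcomp K _ _ _) (fun j => hmul (pderiv pt' j)) charK (hid _).
have [G' G'0 hG'] := ode_exists (@hcomp K _ _ _)
  (fun j => hmul (pderiv (fun j => - pt' j) j)) charK (hid _).
have [Phi1c [Phi hPhi Phi1lim]] := hPhi1.
have [Phi1'c [Phi' hPhi' Phi1'lim]] := hPhi1'.
(* The limits defining pi' and lambda' are exact in every order of t and are replaced by the series
   read off from the flows. *)
rewrite (push_gaugeE charK hQ' hF ltg Psi0 hPsi PsiE) in hPhi'.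
rewrite (push_pathE charK hF ltg Psi0 hPsi PsiE Psi'0 hPsi') in hPhi'.
have PhiE := associated_flowE charK ltg Psi0 hPsi ptg pt0 Psi1 E0 hE E'0 hE' hPhi.
have Phi'E := associated_flowE charK lt'g Psi'0 hPsi' pt'g pt'0 (fun=> erefl) G0 hG G'0 hG' hPhi'.
have hV := complete_shift 1 (Linfty_complete hQ).
have hV' := complete_shift 1 (Linfty_complete hQ').
have cop_hom (U W : fgspace K) (h : Sym U -> Sym W) (hc : coalgebra_morphism h) :
    hcop W ** LHom (cm_linear hc) = htens (LHom (cm_linear hc)) (LHom (cm_linear hc)) ** hcop U.
  by apply: hom_ext => x; rewrite !hcompE htens_tmap; exact: (cm_cop hc).
have deg_hom (U W : fgspace K) (h : Sym U -> Sym W) (hc : coalgebra_morphism h) :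
    hdeg 0 (LHom (cm_linear hc)).
  by move=> i x hx; rewrite add0r; apply: (cm_deg hc); exists x.
pose a1 := LHom (cm_linear hFp.1); pose b1 := LHom (cm_linear Phi1c).
pose a1' := LHom (cm_linear Phi1'c).
have b1'_lin : linear invPhi1' := inverse_linear (a := a1') Phi1'K invPhi1'K.
pose b1' := LHom b1'_lin; pose g := b1' ** a1 ** b1.
have phiN := twisted_flow_nulls charK pt1 lt1 ptn ltn Psi0 hPsi E'0 hE'.
have phi'N := twisted_flow_nulls' charK hF lt1 ltn Psi0 hPsi Psi'0 hPsi' G'0 hG'.
have a1lim := twisted_path_lim charK hF pt0 ptg ltg pt1 lt1 ptn ltn Psi0 hPsi PsiE
  Psi'0 hPsi' E0 hE G'0 hG' p1 pg plim hFp.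
have b1lim : tends0 (@hfil K _ _) (fun n => psum (twisted_flow Psi E') n - b1).
  apply: (comults_lim charK phiN _ _ (cop_hom _ _ _ Phi1c) (cm_one Phi1c) _ hV).
  - exact: (twisted_flow_comults charK ltg Psi0 hPsi ptg E'0 hE').
  - exact: (twisted_flow_one charK ltg Psi0 hPsi ptg pt0 Psi1 E0 hE E'0 hE').
  - move=> x; apply: eq_tends0 ((flimE _ _).1 (Phi1lim x)) => n.
    by congr (_ - _); apply: eq_bigr => j _; rewrite PhiE.
have a1'lim : tends0 (@hfil K _ _) (fun n => psum (twisted_flow Psi' G') n - a1').
  apply: (comults_lim charK phi'N _ _ (cop_hom _ _ _ Phi1'c) (cm_one Phi1'c) _ hV').
  - exact: (twisted_flow_comults charK lt'g Psi'0 hPsi' pt'g G'0 hG').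
  - exact: (twisted_flow_one charK lt'g Psi'0 hPsi' pt'g pt'0 (fun=> erefl) G0 hG G'0 hG').
  - move=> x; apply: eq_tends0 ((flimE _ _).1 (Phi1'lim x)) => n.
    by congr (_ - _); apply: eq_bigr => j _; rewrite Phi'E.
have gE : a1' ** g = a1 ** b1 by apply: hom_ext => x; exact: invPhi1'K.
have glim := mor_path_lim charK ptg pt1 lt1 ptn ltn Psi0 hPsi Psi'0 hPsi' Theta0 hTheta
  E0 hE E'0 hE' G'0 hG' (a1 := a1) (b1 := b1) (b1' := b1') a1lim b1lim a1'lim
  Phi1'K invPhi1'K gE.
have mN := mor_path_nulls charK hF lt1 ltn Psi0 hPsi Theta0 hTheta.
have gN := gauge_path_nulls charK hF lt1 ltn Psi0 hPsi Theta0 hTheta.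
have gf : hfil 0 g := limit_fil0 mN glim.
have gd : hdeg 0 g.
  apply: hdeg_comp0l; last exact: deg_hom.
  apply: hdeg_comp0l; last exact: deg_hom.
  exact: (inverse_deg (a := a1') (b := b1') Phi1'K invPhi1'K (deg_hom _ _ _ Phi1'c)).
have gc : hcop _ ** g = htens g g ** hcop _.
  have bc : hcop _ ** b1' = htens b1' b1' ** hcop _.
    exact: (inverse_cop (a := a1') (b := b1') Phi1'K invPhi1'K (cop_hom _ _ _ Phi1'c)).
  rewrite /g -hcompA hcompA bc -hcompA (hcompA _ a1) (cop_hom _ _ _ hFp.1).
  by rewrite -(hcompA _ _ b1) (cop_hom _ _ _ Phi1c) !hcompA !htens_comp.
have g1 : g (sone _) = sone _.
  apply: (can_inj Phi1'K); rewrite [LHS]invPhi1'K /= (cm_one Phi1c) (cm_one hFp.1).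
  by rewrite (cm_one Phi1'c).
have gq := limit_comm charK Psi0 hPsi Theta0 hTheta gc g1 gd glim.
pose mp := mor_path hF Psi Theta; pose gp := gauge_path hF lt Psi Theta.
have mp1 : forall m, mp m (sone _) = psone _ m :=
  mor_path_one charK hF ltg Psi0 hPsi Psi'0 hPsi' Theta0 hTheta.
have gp1 : forall m, gp m (sone _) = 0 :=
  gauge_path_one charK hF ltg Psi0 hPsi Theta.
have mpd : forall m, hdeg 0 (mp m) := mor_path_deg charK hF ltg Psi0 hPsi Theta0 hTheta.
have gpd : forall m, hdeg (-1) (gp m) := gauge_path_deg charK hF ltg Psi0 hPsi Theta0 hTheta.
have mpg j := conv_path_gr mp1 mpd mN.1 j.
have gpg j := conv_gauge_gr gpd gN.1 gp1 j.
have van1 (h : lhom (Sym (shift L 1)) (Sym (shift L' 1))) : h (sone _) = 0 -> hvan 1 h.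
  by move=> h1 [].
have hat d (X : nat -> lhom (Sym (shift L 1)) (Sym (shift L' 1))) :
    nulls (@hfil K _ _) X -> (forall j, conv_gr d (hspr _ 1 ** X j : _ -> _)) ->
    (forall j, hspr _ 1 (X j (sone _)) = 0) ->
    hat1 (@conv_gr _ L L') (@conv_fil _ L L') d (fun j => hspr _ 1 ** X j : _ -> _).
  move=> [X0 hX] Xg X1; split=> [j|k].
    (* Filtration degree 1 comes from vanishing at 1, that is n = 1 and m = 0; decay of the
       coefficients comes from the shift of filtrations, that is n = 0 and m = k. *)
    split=> //; apply: (@conv_filP _ _ _ d (hspr _ 1 ** X j) 1 0 1) => //.
      by apply: van1; exact: X1.
    by apply: hfil_comp0l => //; apply: hfil_spr.
  have [N hN] := hX `|k|%N; exists N => j /hN hj.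
  apply: (@conv_filP _ _ _ d _ 0 k) => //; last exact: add0r.
  apply: hfil_comp0l; first exact: hfil_spr.
  by apply: (filt_le (hfil_filtration _ _)) hj; lia.
split=> //.
  split.
  - split; [exact: hom_linear g| |exact: g1|] => [i|x].
      by move=> _ [x hx <-]; have := gd _ _ hx; rewrite add0r.
    have := congr1 (fun h => hom_fun h x) gc; rewrite !hcompE htens_tmap; exact.
  - by move=> x; have := congr1 (fun h => hom_fun h x) gq.
  - by move=> k _ [x hx <-]; have := gf _ _ hx; rewrite add0r.
exists (fun j => hom_fun (hspr _ 1 ** mp j)), (fun j => hom_fun (hspr _ 1 ** gp j)); split.
- exact: hat mN mpg (spr1_series_one mp1).
- by apply: hat gN gpg _ => j; rewrite gp1 hom_zero.
- move=> m; apply: (conv_ode charK _ mp1 mpd gpd mN.1 gN.1 gp1).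
  + exact: (mor_path_comults charK hF ltg Psi0 hPsi Theta0 hTheta).
  + exact: (gauge_path_taylor charK hF ltg Psi0 hPsi Psi'0 hPsi' Theta0 hTheta).
  + exact: (mor_path_ode charK hF Psi0 hPsi Theta0 hTheta).
- by apply/funext => x; rewrite /mp /mor_path /cau big_ord1 Theta0 Psi0 hcomp1l hcomp1r.
(* The end point t = 1 uses the uniform convergence: pointwise convergence would not give membership
   in the filtration of the convolution algebra. *)
move=> k; have [N hN] := glim `|k|%N; exists N => n /hN hn.
pose D := hspr (shift L' 1) 1 ** (psum mp n - g).
have -> : \sum_(j < n) (hspr (shift L' 1) 1 ** mp j : Sym (shift L 1) -> Sym (shift L' 1)) -
    (fun x => spr 1 (invPhi1' (Fp (Phi1 x)))) = D.
  apply/funext => x; rewrite -[LHS]/((\sum_(j < n) _) x - spr 1 (g x)) fct_sumE.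
  by rewrite /D hcompE homBE hom_sub hom_sumE hom_sum.
have Df l : hfil l (psum mp n - g) -> hfil l D.
  by apply: hfil_comp0l; apply: hfil_spr.
have pf : hfil 0 (psum mp n - g).
  apply: (filtB (hfil_filtration _ _)) => //.
  by apply: (psum_fil (hfil_filtration _ _)); exact: mN.1.
apply: (@conv_filP _ _ _ 0 _ 0 k) => //; last exact: add0r.
  by apply: Df; apply: (filt_le (hfil_filtration _ _)) hn; lia.
apply: conv_grP.
- apply: hdeg_comp0l; first exact: hdeg_spr.
  by apply: hdegD; [apply: hdeg_sum | apply: hdegN].
- exact: Df.
- rewrite hcompE homBE hom_sub hom_sumE hom_sum g1 /= sprsone subr0 big1 // => j _.
  exact: (spr1_series_one mp1).
- by apply: hom_ext => x; rewrite !hcompE /= spr_spr.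
Qed.
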